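(* Let $P\subsetneq\mathbb{R}^d$ be a full-dimensional polyhedron not containing lines. Then $$\Omega(\bar P)=\frac{\mathrm{adj}_{C(P)^*}(\bar{\mathbf z})}{B_{\mathbf z}(P)}\,dz_1\,dz_2\cdots dz_d,\qquad \bar{\mathbf z}=(1,\mathbf z).$$ Thus the zero set of $\Omega(\bar P)$ is the vanishing set of $\mathrm{adj}_{C(P)^*}$ in $\mathbb{P}^d$.
   Context: View $\mathbb{P}^d=\mathbb{R}^d\sqcup H_\infty$ with homogeneous coordinates $(z_0:z_1:\cdots:z_d)$ and affine coordinates $\mathbf z=(z_1,\dots,z_d)$ on $z_0=1$; $\bar P$ is the closure of $P$ in $\mathbb{P}^d(\mathbb{R})$, a projective polytope, with the orientation inherited from $\mathbb{R}^d$. Canonical form (known existence and uniqueness theorem): for each full-dimensional oriented projective polytope $\bar P\subseteq\mathbb{P}^d(\mathbb{R})$ there is a unique nonzero meromorphic (rational) $d$-form $\Omega(\bar P)$ on $\mathbb{P}^d$ such that: if $d=0$, $\Omega(\bar P)=\pm1$ according to orientation; if $d>0$, it has poles exactly along the facet hyperplanes of $\bar P$, all simple, and $\mathrm{Res}_F\Omega(\bar P)=\Omega(F)$ for each facet $F$ (if $\Omega=\frac{df}{f}\wedge\eta+\cdots$ near $f=0$ then the residue is $\eta|_{f=0}$; $F$ is oriented so that an inward normal followed by the orientation of $F$ gives that of $\bar P$). The zero set of $\Omega(\bar P)$ means the support of its divisor of zeros on $\mathbb{P}^d$. $h_P(\mathbf v)=-\min_{\mathbf y\in P}\langle\mathbf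 v,\mathbf y\rangle$; $\mathcal N(P)$ is the normal fan, consisting of the cones $C_F=\{\mathbf v:h_P(\mathbf v)=-\langle\mathbf v,\mathbf y\rangle\ne\infty\ \forall\mathbf y\in F\}$, $F$ a face of $P$. Fix a generator $\mathbf v$ of each ray of $\mathcal N(P)$, with set $V(\mathcal N(P))$, and put $B_{\mathbf z}(P)=\prod_{\mathbf v\in V(\mathcal N(P))}(h_P(\mathbf v)+\langle\mathbf v,\mathbf z\rangle)$. $C(P)$ is the closure of $\{(t,t\mathbf y):t\ge0,\mathbf y\in P\}\subset\mathbb{R}^{d+1}$ and $C(P)^*$ its dual cone $\{\mathbf w:\langle\mathbf w,\mathbf u\rangle\ge0\ \forall\mathbf u\in C(P)\}$. Its extreme rays are generated by the vectors $(h_P(\mathbf v),\mathbf v)$, $\mathbf v\in V(\mathcal N(P))$, together with $(1,\mathbf 0)$ when the latter spans an extreme ray; these generators form $V(C(P)^* )$. For a full-dimensional pointed cone $C\subset\mathbb{R}^{d+1}$ with generators $V(C)$ of its extreme rays, and any triangulation $T$ of $C$ into $(d+1)$-dimensional simplicial cones with generators in $V(C)$, the adjoint polynomial is $\mathrm{adj}_C(\mathbf u)=\sum_{F\in T}|\det(F)|\prod_{\mathbf w\in V(C)\setminus V(F)}\langle\mathbf w,\mathbf u\rangle$, a homogeneous polynomial in $\mathbf u\in\mathbb{R}^{d+1}$ independent of $T$, where $V(F)$ denotes the generators of $F$ and $\det(F)$ their determinant. Its vanishing set in $\mathbb{P}^d$ is called the adjoint hypersurface (of the polar $P^\vee$).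 *)

(* Defs.v *)
(* mpoly must be imported before the analysis files: in the other order their
   notations clash. *)
From mathcomp Require Export all_boot all_order all_algebra fraction.
From mathcomp Require Export complex mpoly.
From mathcomp Require Export boolp classical_sets functions reals.
From mathcomp Require Export constructive_ereal ereal topology normedtype.

Set Implicit Arguments.
Unset Strict Implicit.
Unset Printing Implicit Defensive.

Export Order.TTheory GRing.Theory Num.Theory.
Export numFieldNormedType.Exports.

Local Open Scope classical_set_scope.
Local Open Scope ring_scope.

Section Polyhedra.
Variable R : realType.

Definition dot n (u v : 'rV[R]_n) : R := \sum_i u 0 i * v 0 i.

Definition polyhedron d (P : set 'rV[R]_d) : Prop :=
  exists (m : nat) (a : 'I_m -> 'rV[R]_d) (b : 'I_m -> R),
    P = [set y | forall i, b i <= dot (a i) y].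

Definition contains_line d (P : set 'rV[R]_d) : Prop :=
  exists y v, v != 0 /\ forall t : R, P (y + t *: v).

Definition hvec d (t : R) (y : 'rV[R]_d) : 'rV[R]_d.+1 :=
  row_mx (t%:M : 'M[R]_1) y.

(* The linear span of X has dimension k. *)
Definition span_dim n (X : set 'rV[R]_n) (k : nat) : Prop :=
  exists U : 'M[R]_(k, n),
    [/\ row_free U, forall i, X (row i U) & forall x, X x -> (x <= U)%MS].

(* The affine hull of P has dimension d: the span of {1} x P is R^(d+1). *)
Definition full_dimensional d (P : set 'rV[R]_d) : Prop :=
  span_dim [set hvec 1 y | y in P] d.+1.

(* h_P(v) = - min_{y in P} <v, y>, which is +oo when there is no minimum. *)
Definition support_fun d (P : set 'rV[R]_d) (v : 'rV[R]_d) : \bar R :=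
  (- ereal_inf [set (dot v y)%:E | y in P])%E.

(* The empty face is excluded: its "normal cone" would be all of R^d. *)
Definition face d (P : set 'rV[R]_d) : set (set 'rV[R]_d) :=
  [set F | F !=set0 /\ exists (v : 'rV[R]_d) (c : R),
     (forall y, P y -> c <= dot v y) /\ F = P `&` [set y | dot v y = c]].

Definition normal_cone d (P F : set 'rV[R]_d) : set 'rV[R]_d :=
  [set v | forall y, F y -> support_fun P v = (- dot v y)%:E].

Definition normal_fan d (P : set 'rV[R]_d) : set (set 'rV[R]_d) :=
  [set normal_cone P F | F in face P].

Definition ray n (v : 'rV[R]_n) : set 'rV[R]_n :=
  [set t *: v | t in [set t : R | 0 <= t]].

Definition fan_generators d (P : set 'rV[R]_d) (V : seq 'rV[R]_d) : Prop :=
  [/\ uniq V,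
      forall v, v \in V -> v != 0 /\ normal_fan P (ray v) &
      forall v, v != 0 -> normal_fan P (ray v) ->
        exists! v', v' \in V /\ ray v' = ray v].

Definition cone_over d (P : set 'rV[R]_d) : set 'rV[R]_d.+1 :=
  closure [set u | exists t y, [/\ 0 <= t, P y & u = hvec t (t *: y)]].

Definition dual_cone n (K : set 'rV[R]_n) : set 'rV[R]_n :=
  [set w | forall u, K u -> 0 <= dot w u].

Definition extreme_ray n (K : set 'rV[R]_n) (w : 'rV[R]_n) : Prop :=
  [/\ K w, w != 0 &
      forall a b, K a -> K b -> w = a + b -> ray w a /\ ray w b].

(* V(C(P)^* ), for the choice V of generators of the rays of N(P). *)
Definition dual_generators d (P : set 'rV[R]_d) (V : seq 'rV[R]_d) :
    seq 'rV[R]_d.+1 :=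
  [seq hvec (fine (support_fun P v)) v | v <- V] ++
  (if `[< extreme_ray (dual_cone (cone_over P)) (hvec 1 0) >]
   then [:: hvec 1 0] else [::]).

(* A simplicial cone with generators in W is given by the set F of the indices
   in W of its generators. *)

Definition simplicial_cone n (W : seq 'rV[R]_n) (F : {set 'I_(size W)}) :
    set 'rV[R]_n :=
  [set u | exists c : 'I_(size W) -> R, (forall i, 0 <= c i) /\
     u = \sum_(i in F) c i *: W`_i].

(* The matrix of the generators of F (meaningful when #|F| = n). *)
Definition cell_mx n (W : seq 'rV[R]_n) (F : {set 'I_(size W)}) : 'M[R]_n :=
  \matrix_(i < n) [seq W`_(val j) | j <- enum F]`_i.

Definition triangulation n (K : set 'rV[R]_n) (W : seq 'rV[R]_n)
    (T : {set {set 'I_(size W)}}) : Prop :=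
  [/\ forall F, F \in T -> #|F| = n /\ \det (cell_mx F) != 0,
      K = [set u | exists2 F, F \in T & simplicial_cone F u] &
      forall F G, F \in T -> G \in T ->
        simplicial_cone F `&` simplicial_cone G = simplicial_cone (F :&: G)].

Definition linform n (w : 'rV[R]_n) : {mpoly R[n]} := \sum_i w 0 i *: 'X_i.

Definition adj n (W : seq 'rV[R]_n) (T : {set {set 'I_(size W)}}) :
    {mpoly R[n]} :=
  \sum_(F in T) `|\det (cell_mx F)| *: \prod_(i | i \notin F) linform W`_i.

Definition Bpoly d (P : set 'rV[R]_d) (V : seq 'rV[R]_d) : {mpoly R[d]} :=
  \prod_(v <- V) ((fine (support_fun P v))%:MP + linform v).

End Polyhedra.

Definition toC (R : realType) n (p : {mpoly R[n]}) : {mpoly R[i][n]} :=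
  map_mpoly (real_complex R) p.

(* P^d is the complex projective space.  The record stands for the rational
   d-form  (num / den) * omega  on P^d, where
     omega = \sum_j (-1)^j z_j dz_0 ... dz_(j-1) dz_(j+1) ... dz_d
   is the contraction of dz_0 ... dz_d with the Euler vector field.  As
   K_(P^d) = O(-d-1), every rational d-form on P^d is of this shape. *)
Record ratform (R : realType) (d : nat) := RatForm {
  num : {mpoly R[i][d.+1]};
  den : {mpoly R[i][d.+1]};
  den_neq0 : den != 0;
  num_den_homog : exists k : nat,
    num \is k.-homog /\ den \is (k + d.+1).-homog }.

Section Forms.
Variable R : realType.
Local Notation C := R[i].

Definition hcoef d (Om : ratform R d) : {fraction {mpoly C[d.+1]}} :=
  tofrac (num Om) / tofrac (den Om).

Definition mdvd n (p q : {mpoly C[n]}) : Prop := exists r, q = p * r.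

Definition prime_divisor n (p : {mpoly C[n]}) : Prop :=
  [/\ p != 0, p \isn't a GRing.unit,
      forall q r, p = q * r -> q \is a GRing.unit \/ r \is a GRing.unit &
      exists k : nat, p \is k.-homog].

(* Om vanishes to order k along {p = 0} (pole of order - k if k < 0); note that
   omega generates K_(P^d)(d+1), hence contributes nothing to the divisor. *)
Definition has_order d (Om : ratform R d) (p : {mpoly C[d.+1]}) (k : int) :
    Prop :=
  exists n m, [/\ ~ mdvd p n, ~ mdvd p m &
    hcoef Om = tofrac p ^ k * (tofrac n / tofrac m)].

(* Sets of points of P^d(C) are given by their homogeneous coordinates. *)
Definition vanishing_set n (p : {mpoly C[n]}) : set 'rV[C]_n :=
  [set x | x != 0 /\ p.@[fun i => x 0 i] = 0].

Definition zero_set d (Om : ratform R d) : set 'rV[C]_d.+1 :=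
  [set x | exists p k, [/\ prime_divisor p, has_order Om p k, 0 < k &
    vanishing_set p x]].

(* An invertible matrix M with rows b_0, ..., b_d gives the affine chart
     x |-> b_0 + x_1 b_1 + ... + x_d b_d
   of P^d (homogeneous coordinates on the right); M = 1 is the chart z_0 = 1.
   The variable x_(i+1) is the i-th variable of {mpoly C[d]}. *)

Definition chart_point d (M : 'M[C]_d.+1) : d.+1.-tuple {mpoly C[d]} :=
  [tuple (M ord0 j)%:MP + \sum_(i < d) M (lift ord0 i) j *: 'X_i | j < d.+1].

(* The coefficient of dx_1 ... dx_d in the pullback of Om by the chart M; the
   pullback of omega is det (b_0 + \sum_i x_i b_i, b_1, ..., b_d) = det M. *)
Definition chart_coef d (M : 'M[R]_d.+1) (Om : ratform R d) :
    {fraction {mpoly C[d]}} :=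
  let x := chart_point (map_mx (real_complex R) M) in
  tofrac ((\det M)%:C%C%:MP) * (tofrac (num Om \mPo x) / tofrac (den Om \mPo x)).

Definition set_x1_0 e (p : {mpoly C[e.+1]}) : {mpoly C[e]} :=
  p \mPo [tuple if unlift ord0 i is Some j then 'X_j else 0 | i < e.+1].

(* The index of the row b_1, and the rows b_0, b_2, ..., b_d, which give
   homogeneous coordinates on the hyperplane x_1 = 0. *)
Definition ix1 {e} : 'I_e.+2 := lift ord0 ord0.
Definition hyp_mx e (M : 'M[R]_e.+2) : 'M[R]_(e.+1, e.+2) := row' ix1 M.

(* In the chart M, Om = dx_1 / x_1 /\ (n / m) dx_2 ... dx_d with n / m regular
   along x_1 = 0, and eta = (n / m)|_(x_1 = 0) dx_2 ... dx_d. *)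
Definition residue e (M : 'M[R]_e.+2) (Om : ratform R e.+1)
    (eta : ratform R e) : Prop :=
  exists n m, [/\ set_x1_0 m != 0,
    chart_coef M Om = tofrac n / tofrac ('X_ord0 * m) &
    chart_coef 1%:M eta = tofrac (set_x1_0 n) / tofrac (set_x1_0 m)].

(* A full-dimensional projective polytope in P^d(R) is the image of a pointed
   full-dimensional polyhedral cone K in R^(d+1).  Its two orientations are
   indexed by s : bool.  A tangent vector at the point [u], u in K, is a vector
   of R^(d+1) modulo u, and the frame of the rows of V is positive at [u] when
   (-1)^s det (u, V) > 0.  For P in R^d, K = cone_over P and u = (1, y), the
   orientation s = false is the one inherited from R^d. *)

Definition pos_frame d (s : bool) (u : 'rV[R]_d.+1) (V : 'M[R]_(d, d.+1)) :
    bool :=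
  0 < (-1) ^+ s * \det (col_mx u V : 'M[R]_d.+1).

(* w is an inner normal of a facet of K. *)
Definition facet_normal d (K : set 'rV[R]_d.+1) (w : 'rV[R]_d.+1) : Prop :=
  [/\ w != 0, dual_cone K w & span_dim (K `&` [set u | dot w u = 0]) d].

(* In the chart M, the hyperplane w = 0 is x_1 = 0. *)
Definition facet_chart e (w : 'rV[R]_e.+2) (M : 'M[R]_e.+2) : Prop :=
  M \in unitmx /\ forall i, i != ix1 -> dot w (row i M) = 0.

(* The facet of K with normal w, in the homogeneous coordinates hyp_mx M of
   its hyperplane. *)
Definition facet_cone e (K : set 'rV[R]_e.+2) (w : 'rV[R]_e.+2)
    (M : 'M[R]_e.+2) : set 'rV[R]_e.+1 :=
  [set y | K (y *m hyp_mx M) /\ dot w (y *m hyp_mx M) = 0].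

(* An inward vector followed by a frame of the facet is positive for K iff the
   frame is positive for the facet. *)
Definition facet_orientation e (K : set 'rV[R]_e.+2) (w : 'rV[R]_e.+2)
    (M : 'M[R]_e.+2) (s s' : bool) : Prop :=
  forall (y : 'rV[R]_e.+1) (n : 'rV[R]_e.+2) (V : 'M[R]_(e, e.+1)),
    facet_cone K w M y -> 0 < dot w n ->
    pos_frame s' y V =
      pos_frame s (y *m hyp_mx M) (col_mx n (V *m hyp_mx M)).

(* canonical_form K s Om: Om is the canonical form of the projective polytope
   of K with orientation s.  On P^0 (K a half-line) the 0-form Om must be the
   constant 1 or -1, according to the sign of the empty frame. *)
Fixpoint canonical_form (d : nat) :
    set 'rV[R]_d.+1 -> bool -> ratform R d -> Prop :=
  match d with
  | 0%N => fun K s Om => forall u, K u -> u != 0 ->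
      chart_coef 1%:M Om = if pos_frame s u (0 : 'M[R]_(0, 1)) then 1 else -1
  | e.+1 => fun K s Om =>
      [/\ num Om != 0,
          forall w, facet_normal K w -> has_order Om (toC (linform w)) (-1),
          forall p k, prime_divisor p -> has_order Om p k -> k < 0 ->
            exists w c, facet_normal K w /\ p = c *: toC (linform w) &
          forall w M, facet_normal K w -> facet_chart w M ->
            exists s' eta, [/\ facet_orientation K w M s s', residue M Om eta &
              canonical_form (facet_cone K w M) s' eta]]
  end.

End Forms.

(* Main.v *)
(* The dual volume of a simplicial cone with generators w_0, ..., w_d is the
   rational function |det w| / \prod_i <w_i, z>, and the adjoint of a triangulated
   cone, divided by the product of its generators, is the sum of the dual volumes
   of the cells.  The residue of such a sum along w^\perp is the sum of the signed
   dual volumes of the cells cut out in R^(d+1) / w, where the multiplicity of a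
   line parallel to w is its multiplicity at one end minus that at the other.  By
   induction on d, two things follow: signed cells whose multiplicity is invariant
   under a translation have dual volume 0, so walls that are not facets give no
   pole; and along a facet the residue is the dual volume of the dual cone of that
   facet.  So the dual volume satisfies the recursion of the canonical form, and
   a form satisfying it is unique, because a difference of two has no pole and
   negative degree.  The zero divisor is then that of the adjoint: all facets are
   poles, hence no linear form cancels. *)

(* Multiplicities are compared only off finitely many hyperplanes, so a boundary point never has to
   be attributed to one cell or another, and the signed cells cut out by a residue need not fit face
   to face. For this reason the recursion carries [cover], a statement about multiplicities, and not
   a triangulation: the links along a facet normal form a cover again, while those along an
   arbitrary generator are only signed cells. The other obstacle is that poles and zeros are tested
   on all prime divisors over the complex numbers, although the data are real and linear.
   Factoriality of polynomial rings and homogeneity of factors bridge this gap: a form whose poles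
   are facets has a product of real linear forms as denominator. All the fractions involved are
   homogeneous of degree -(d+1); this degree makes a fraction without poles vanish and makes the
   affine charts faithful. *)
From HB Require Import structures.
Require Import Defs.
From mathcomp Require Import perm ring lra zify.

Set Implicit Arguments.
Unset Strict Implicit.
Unset Printing Implicit Defensive.
Local Open Scope ring_scope.
Local Notation "x %:F" := (tofrac x).

(** * Factorial domains *)

Definition rdvd (A : idomainType) (p q : A) : Prop := exists r, q = p * r.

Definition rirred (A : idomainType) (p : A) : Prop :=
  [/\ p != 0, p \isn't a GRing.unit &
      forall q r, p = q * r -> q \is a GRing.unit \/ r \is a GRing.unit].

Definition rprime (A : idomainType) (p : A) : Prop :=
  [/\ p != 0, p \isn't a GRing.unit &
      forall a b, rdvd p (a * b) -> rdvd p a \/ rdvd p b].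

(** Factorization into primes and not into irreducibles: uniqueness is then automatic, and
    irreducible elements are prime by [factorial_irred_prime]. *)
Definition factorial (A : idomainType) : Prop :=
  forall a : A, a != 0 -> exists s u,
    [/\ forall p, p \in s -> rprime p, u \is a GRing.unit &
        a = u * \prod_(p <- s) p].

Section Divisibility.
Variable A : idomainType.
Implicit Types p q a b : A.

Lemma rdvd_refl p : rdvd p p. Proof. by exists 1; rewrite mulr1. Qed.

Lemma rdvd_mulr p a b : rdvd p a -> rdvd p (a * b).
Proof. by case=> r ->; exists (r * b); rewrite mulrA. Qed.

Lemma rdvd_mull p a b : rdvd p b -> rdvd p (a * b).
Proof. by rewrite mulrC; apply: rdvd_mulr. Qed.

Lemma rdvdD p a b : rdvd p a -> rdvd p b -> rdvd p (a + b).
Proof. by case=> r -> [s ->]; exists (r + s); rewrite mulrDr. Qed.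

Lemma rdvdB p a b : rdvd p a -> rdvd p b -> rdvd p (a - b).
Proof. by case=> r -> [s ->]; exists (r - s); rewrite mulrBr. Qed.

Lemma rdvd0 p : rdvd p 0. Proof. by exists 0; rewrite mulr0. Qed.

Lemma rdvd_sum p (I : Type) (r : seq I) (P : pred I) (G : I -> A) :
  (forall i, P i -> rdvd p (G i)) -> rdvd p (\sum_(i <- r | P i) G i).
Proof.
move=> h; apply: (big_ind (rdvd p)) => //; [exact: rdvd0 | exact: rdvdD].
Qed.

Lemma rdvd_trans p q a : rdvd p q -> rdvd q a -> rdvd p a.
Proof. by move=> [r ->] [s ->]; exists (r * s); rewrite mulrA. Qed.

Lemma rdvd_unitl u p q : u \is a GRing.unit -> rdvd p (u * q) -> rdvd p q.
Proof.
by move=> uu [r e]; exists (u^-1 * r); rewrite mulrCA -e mulKr.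
Qed.

Lemma rdvd_unit p u : u \is a GRing.unit -> rdvd p u -> p \is a GRing.unit.
Proof. by move=> uu [r e]; move: uu; rewrite e unitrM => /andP[]. Qed.

Lemma rprime_dvd_prod p s u : rprime p -> u \is a GRing.unit ->
  rdvd p (u * \prod_(q <- s) q) -> exists2 q, q \in s & rdvd p q.
Proof.
move=> [p0 pu pp] uu /(rdvd_unitl uu).
elim: s => [|q s IH].
  rewrite big_nil => /(rdvd_unit (unitr1 _)).
  by rewrite (negPf pu).
rewrite big_cons => /pp [h|/IH [r rs h]].
  by exists q; rewrite ?mem_head.
by exists r; rewrite ?inE ?rs ?orbT.
Qed.

Lemma rprime_irred p : rprime p -> rirred p.
Proof.
move=> [p0 pu pp]; split=> // q r e.
have qr0 : q * r != 0 by rewrite -e.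
move: qr0; rewrite mulf_eq0 negb_or => /andP[q0 r0].
have : rdvd p (q * r) by rewrite -e; apply: rdvd_refl.
case/pp => -[s es].
  right; apply/unitrPr; exists s; apply: (mulfI q0).
  by rewrite mulrA [q * r]mulrC mulr1 {2}es e; ring.
left; apply/unitrPr; exists s; apply: (mulfI r0).
by rewrite mulr1 {2}es e; ring.
Qed.

Lemma rprime_assoc p q : rprime p -> rprime q -> rdvd p q ->
  exists2 u, u \is a GRing.unit & q = p * u.
Proof.
move=> pp /rprime_irred[_ _ qi] [r e].
by case: (qi _ _ e) => [|ru]; [case: pp => _ /negPf-> | exists r].
Qed.

Lemma factorial_irred_prime p : factorial A -> rirred p -> rprime p.
Proof.
move=> fA [p0 pu pi]; have [[|q s] [u [sp uu e]]] := fA p p0.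
  by move: pu; rewrite e big_nil mulr1 uu.
have [q0 qu qp] := sp q (mem_head _ _).
move: e; rewrite big_cons mulrCA => e.
have [|vu] := pi _ _ e; first by rewrite (negPf qu).
split=> // a b; rewrite e => h.
have : rdvd q (a * b) by apply: rdvd_trans h; exists (u * \prod_(j <- s) j).
set v := u * _ in vu *.
case/qp => -[r er]; [left | right]; exists (v^-1 * r);
  by rewrite er -mulrA (mulrA v) mulrV // mul1r.
Qed.

End Divisibility.

(** * Gauss's lemma and factoriality of polynomial rings *)

Section Gauss.
Variable A : idomainType.
Hypothesis fA : factorial A.
Implicit Types (c : A) (f g h : {poly A}).

Lemma rdvd_polyCP c f : rdvd c%:P f <-> forall i, rdvd c f`_i.
Proof.
split=> [[r ->] i|h]; first by rewrite coefCM; exists r`_i.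
have [t et] := choice h.
exists (\poly_(i < size f) t i); apply/polyP => i.
rewrite coefCM coef_poly; case: ltnP => hi; first exact: et.
by rewrite mulr0 nth_default.
Qed.

(** Gauss's lemma. If i and j are the first indices at which c fails to divide the coefficients of f
    and of g, then the coefficient of f g at i + j is the product of these two coefficients plus
    multiples of c. *)
Lemma rprime_polyC c : rprime c -> rprime c%:P.
Proof.
move=> [c0 cu cp]; split; first by rewrite polyC_eq0.
  by rewrite poly_unitE coefC eqxx negb_and cu orbT.
move=> f g hfg; apply: contrapT => /not_orP[hf hg].
have ex h : ~ rdvd c%:P h ->
    exists i, ~ rdvd c h`_i /\ forall j, (j < i)%N -> rdvd c h`_j.
  move/rdvd_polyCP/existsNP => ne.
  have ne' : exists i, `[< ~ rdvd c h`_i >] by case: ne => i /asboolP; exists i.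
  exists (ex_minn ne'); case: ex_minnP => i /asboolP hi mi; split=> // j ji.
  apply: contrapT => /asboolP /mi; by rewrite leqNgt ji.
have [i [hi mi]] := ex f hf; have [j [hj mj]] := ex g hg.
have /rdvd_polyCP/(_ (i + j)%N) := hfg; rewrite coefM.
have lt : (i < (i + j).+1)%N by rewrite ltnS leq_addr.
rewrite (bigD1 (Ordinal lt)) //= addKn => hs.
have hr : rdvd c (\sum_(k < (i + j).+1 | k != Ordinal lt)
    f`_k * g`_(i + j - k)).
  apply: rdvd_sum => k; rewrite -val_eqE /= neq_ltn => /orP[ki|ik].
    exact/rdvd_mulr/mi.
  apply/rdvd_mull/mj; rewrite ltn_subLR; first by rewrite ltn_add2r.
  by rewrite -ltnS.
have : rdvd c (f`_i * g`_j) by rewrite -(addrK (\sum_(k < (i + j).+1 |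
   k != Ordinal lt) f`_k * g`_(i + j - k)) (_ * _)); apply: rdvdB.
by case/cp.
Qed.

Definition primitive f := forall c, rprime c -> ~ rdvd c%:P f.

Lemma primitive_part f : f != 0 -> exists s f0,
  [/\ forall c, c \in s -> rprime c, primitive f0 &
      f = (\prod_(c <- s) c)%:P * f0].
Proof.
move=> f0; have lf0 : lead_coef f != 0 by rewrite lead_coef_eq0.
have [s [u [sp uu e]]] := fA lf0.
move: {2}(size s) (erefl (size s)) => n.
elim: n s u f f0 {lf0} sp uu e => [|n IH] s u f f0 sp uu e es.
  exists [::], f; split=> //; last by rewrite big_nil mul1r.
  move=> c cp [g eg]; move: e; rewrite eg lead_coefM lead_coefC => e.
  have : rdvd c (u * \prod_(p <- s) p) by exists (lead_coef g).
  by move/(rprime_dvd_prod cp uu)=> [q]; rewrite (size0nil es).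
have [hp|/existsNP[c /not_implyP[cp /contrapT[g eg]]]] := pselect (primitive f).
  by exists [::], f; split=> //; rewrite big_nil mul1r.
have c0 : c != 0 by case: cp.
have g0 : g != 0 by apply: contraNneq f0 => g0; rewrite eg g0 mulr0.
move: e; rewrite eg lead_coefM lead_coefC => e.
have : rdvd c (u * \prod_(p <- s) p) by exists (lead_coef g).
move/(rprime_dvd_prod cp uu)=> [q qs dq].
have [v vu ev] := rprime_assoc cp (sp _ qs) dq.
have [||||s' [f1 [sp' pf1 e1]]] := IH (rem q s) (u * v) g g0.
- by move=> p /mem_rem /sp.
- by rewrite unitrM uu vu.
- apply: (mulfI c0); rewrite e (perm_big _ (perm_to_rem qs)) /= big_cons ev.
  by ring.
- by rewrite size_rem ?es.
exists (c :: s'), f1; split=> //.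
  by move=> p; rewrite inE => /orP[/eqP->|/sp'].
by rewrite e1 big_cons polyCM mulrA.
Qed.

(** The primes of c stay prime in the polynomial ring and do not divide f, so each of them divides e
    and can be removed. *)
Lemma primitive_cancel f e h c : primitive f -> c != 0 ->
  f * e = c%:P * h -> rdvd f h.
Proof.
move=> pf c0; have [s [u [sp uu ->]]] := fA c0.
elim: s e sp => [|p s IH] e sp.
  rewrite big_nil mulr1 => e1; exists ((u^-1)%:P * e).
  by rewrite mulrCA e1 mulrA -polyCM mulVr // mul1r.
rewrite big_cons mulrCA polyCM -mulrA => e1.
have pp := sp _ (mem_head _ _); have [p0 _ _] := pp.
have [_ _ /(_ f e)] := rprime_polyC pp.
case; first by rewrite e1; apply/rdvd_mulr/rdvd_refl.
  by move/(pf _ pp).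
move=> [e' ee]; apply: (IH e').
  by move=> q qs; apply: sp; rewrite inE qs orbT.
have P0 : p%:P != 0 by rewrite polyC_eq0.
by apply: (mulfI P0); rewrite -e1 ee mulrCA.
Qed.

(** Each prime factor of c divides q or h, by [rprime_polyC], and is cancelled there; c1 and c2
    collect the two shares. *)
Lemma gauss_split f q h c : c != 0 -> c%:P * f = q * h ->
  exists c1 c2 q1 h1, [/\ c1 != 0, c2 != 0, q = c1%:P * q1, h = c2%:P * h1
    & f = q1 * h1].
Proof.
move=> c0; have [s [u [sp uu ->]]] := fA c0.
elim: s q h sp => [|p s IH] q h sp.
  rewrite big_nil mulr1 => e1.
  have u0 : u != 0 by apply: contraTneq uu => ->; rewrite unitr0.
  exists u, 1, ((u^-1)%:P * q), h; split; rewrite ?oner_eq0 ?mul1r //.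
    by rewrite mulrA -polyCM mulrV // mul1r.
  by rewrite -mulrA -e1 mulrA -polyCM mulVr // mul1r.
rewrite big_cons mulrCA polyCM -mulrA => e1.
have pp := sp _ (mem_head _ _); have [p0 _ _] := pp.
have P0 : p%:P != 0 by rewrite polyC_eq0.
have sp' q' : q' \in s -> rprime q' by move=> qs; apply: sp; rewrite inE qs orbT.
have [_ _ /(_ q h)] := rprime_polyC pp.
case; first by rewrite -e1; apply/rdvd_mulr/rdvd_refl.
  move=> [q' eq]; have [|c1 [c2 [q1 [h1 [c10 c20 e2 e3 e4]]]]] := IH q' h sp'.
    by apply: (mulfI P0); rewrite e1 eq mulrA.
  exists (p * c1), c2, q1, h1; split=> //; first by rewrite mulf_neq0.
  by rewrite polyCM -mulrA -e2.
move=> [h' eh]; have [|c1 [c2 [q1 [h1 [c10 c20 e2 e3 e4]]]]] := IH q h' sp'.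
  by apply: (mulfI P0); rewrite e1 eh mulrCA.
exists c1, (p * c2), q1, h1; split=> //; first by rewrite mulf_neq0.
by rewrite polyCM -mulrA -e3.
Qed.

(* An element h of minimal degree in the ideal (f, g) divides, up to constants,
   both f and g. *)
Lemma ideal_min f g : f != 0 -> exists h c c' q q',
  [/\ exists u v, h = u * f + v * g, c != 0, c' != 0,
      c%:P * f = q * h & c'%:P * g = q' * h].
Proof.
move=> f0; pose I h := exists u v, h = u * f + v * g.
have ne : exists n, `[< exists h, [/\ h != 0, I h & size h = n] >].
  exists (size f); apply/asboolP; exists f; split=> //.
  by exists 1, 0; rewrite mul1r mul0r addr0.
have [n /asboolP[h [h0 Ih sh]] mn] := ex_minnP ne.
have div a : I a -> exists c q, c != 0 /\ c%:P * a = q * h.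
  move=> [u [v ea]]; have [u' [v' eh]] := Ih.
  have e := Pdiv.Idomain.divp_eq a h.
  exists (lead_coef h ^+ scalp a h), (divp a h); split.
    by rewrite expf_neq0 // lead_coef_eq0.
  rewrite mul_polyC e; suff -> : (modp a h) = 0 by rewrite addr0.
  apply: contrapT => /eqP r0.
  have : (size (modp a h) < size h)%N by rewrite Pdiv.Idomain.ltn_modp.
  rewrite sh ltnNge mn //; apply/asboolP; exists (modp a h); split=> //.
  exists ((lead_coef h ^+ scalp a h)%:P * u - (divp a h) * u'),
    ((lead_coef h ^+ scalp a h)%:P * v - (divp a h) * v').
  have -> : (modp a h) = lead_coef h ^+ scalp a h *: a - (divp a h) * h.
    by rewrite e addrC addKr.
  rewrite -mul_polyC; move: (_%:P) (divp a h) => cc dd.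
  by rewrite ea eh; ring.
have [|c [q [c0 e]]] := div f; first by exists 1, 0; rewrite mul1r mul0r addr0.
have [|c' [q' [c'0 e']]] := div g.
  by exists 0, 1; rewrite mul1r mul0r add0r.
by exists h, c, c', q, q'; split.
Qed.

(** With h of minimal degree in the ideal of f and g, the factorization of f through h has a unit
    factor. Either h is f up to constants, and f divides a constant multiple of g, or h is constant,
    and the Bezout relation makes f divide a constant multiple of the other factor. Primitivity
    removes the constants. *)
Lemma primitive_irred_prime f : primitive f -> (1 < size f)%N ->
  rirred f -> rprime f.
Proof.
move=> pf sf [f0 fu fi]; split=> // g h0 [x ex].
apply: contrapT => /not_orP[ng nh].
have [h [c [c' [q [q' [[u [v eh] c0 c'0 ecf ecg]]]]]]] := ideal_min g f0.
have [c1 [c2 [q1 [h1 [c10 c20 eq1 eh1 ef]]]]] := gauss_split c0 ecf.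
have [q1u|h1u] := fi _ _ ef.
  apply: ng; apply: (@primitive_cancel f (q1^-1 * q' * c2%:P) g c') => //.
  rewrite ecg eh1 ef.
  have -> : q1 * h1 * (q1^-1 * q' * c2%:P) = (q1 * q1^-1) * (q' * (c2%:P * h1)).
    by ring.
  by rewrite mulrV // mul1r.
apply: nh; move: h1u; rewrite poly_unitE => /andP[/eqP s1 _].
have [d d0 e1] : exists2 d, d != 0 & h1 = d%:P.
  by have /eqP/size_poly1P := s1.
have cd : c2 * d != 0 by rewrite mulf_neq0.
apply: (@primitive_cancel f (u * h0 + v * x) h0 (c2 * d)) => //.
rewrite polyCM -e1 -eh1 eh mulrDl mulrDr (mulrCA f v) -ex; ring.
Qed.

Lemma factorial_polyC c : c != 0 -> exists s u,
  [/\ forall p : {poly A}, p \in s -> rprime p, u \is a GRing.unit &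
      c%:P = u * \prod_(p <- s) p].
Proof.
move=> c0; have [s [u [sp uu ->]]] := fA c0.
exists (map polyC s), u%:P; split.
- by move=> p /mapP[q qs ->]; apply/rprime_polyC/sp.
- by rewrite poly_unitE coefC eqxx uu size_polyC; case: (eqVneq u 0) uu => // ->; rewrite unitr0.
- by rewrite polyCM big_map rmorph_prod.
Qed.

Lemma factorial_mul (B : idomainType) (a b : B) :
  (exists s u, [/\ forall p : B, p \in s -> rprime p, u \is a GRing.unit &
      a = u * \prod_(p <- s) p]) ->
  (exists s u, [/\ forall p : B, p \in s -> rprime p, u \is a GRing.unit &
      b = u * \prod_(p <- s) p]) ->
  exists s u, [/\ forall p : B, p \in s -> rprime p, u \is a GRing.unit &
      a * b = u * \prod_(p <- s) p].
Proof.
move=> [s [u [sp uu ->]]] [t [v [tp vu ->]]]; exists (s ++ t), (u * v); split.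
- by move=> p; rewrite mem_cat => /orP[/sp|/tp].
- by rewrite unitrM uu vu.
- by rewrite big_cat /= mulrACA.
Qed.

(** Induction on the degree. The content factors in A. A reducible primitive polynomial splits into
    two factors of smaller positive degree, since a nonunit constant factor would contradict
    primitivity; an irreducible one is prime by [primitive_irred_prime]. *)
Lemma factorial_poly : factorial {poly A}.
Proof.
move=> f; move: {2}(size f) (leqnn (size f)) => n.
elim: n f => [|n IH] f sf f0; first by move: sf; rewrite leqn0 size_poly_eq0 (negPf f0).
have [s [f1 [sp pf1 e]]] := primitive_part f0.
have c0 : \prod_(c <- s) c != 0.
  by apply: contraNneq f0 => h; rewrite e h mul0r.
have f10 : f1 != 0 by apply: contraNneq f0 => h; rewrite e h mulr0.
have s1 : size f = size f1 by rewrite e size_Cmul.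
rewrite e; apply: factorial_mul; first exact: factorial_polyC.
have [s2|s2] := leqP (size f1) 1.
  have : size f1 = 1 by apply/eqP; rewrite eqn_leq s2 lt0n size_poly_eq0.
  by move/eqP/size_poly1P => [d d0 ->]; apply: factorial_polyC.
have pdiv g h : f1 = g * h -> g \isn't a GRing.unit -> (1 < size g)%N.
  move=> ef gu; rewrite ltnNge; apply/negP => sg.
  have g0 : g != 0 by apply: contraNneq f10 => g0; rewrite ef g0 mul0r.
  have /eqP/size_poly1P[d d0 ed] : size g = 1.
    by apply/eqP; rewrite eqn_leq sg lt0n size_poly_eq0.
  have [[|p t] [u [tp uu eu]]] := fA d0.
    move: gu; rewrite ed poly_unitE size_polyC d0 coefC /= eu big_nil mulr1.
    by rewrite uu.
  apply: (pf1 p); first exact/tp/mem_head.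
  exists ((u * \prod_(j <- t) j)%:P * h).
  by rewrite ef ed eu big_cons [RHS]mulrA -polyCM [u * (p * _)]mulrCA.
have [ir|] := pselect (rirred f1).
  exists [:: f1], 1; split; rewrite ?unitr1 ?big_seq1 ?mul1r //.
  by move=> p; rewrite inE => /eqP->; apply: primitive_irred_prime.
move=> nir; have [g [h [ef gu hu]]] : exists g h,
    [/\ f1 = g * h, g \isn't a GRing.unit & h \isn't a GRing.unit].
  apply: contrapT => ne; apply: nir; split=> //.
    by rewrite poly_unitE; case: eqP s2 => // ->.
  move=> g h ef; apply: contrapT => /not_orP[/negP gu /negP hu].
  by apply: ne; exists g, h.
have sg := pdiv _ _ ef gu.
have sh : (1 < size h)%N by apply: (pdiv h g) => //; rewrite mulrC.
have g0 : g != 0 by rewrite -size_poly_gt0 (ltn_trans _ sg).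
have h0 : h != 0 by rewrite -size_poly_gt0 (ltn_trans _ sh).
have szm := size_mul g0 h0; rewrite -ef -s1 in szm.
rewrite ef; apply: factorial_mul; apply: IH => //.
  rewrite -ltnS (leq_trans _ sf) // szm; move: sg sh; lia.
rewrite -ltnS (leq_trans _ sf) // szm; move: sg sh; lia.
Qed.

End Gauss.

(** * Multivariate polynomials *)

Lemma mpoly_ring_ind (R : nzRingType) n (P : {mpoly R[n]} -> Prop) :
  (forall c, P c%:MP) -> (forall i, P 'X_i) ->
  (forall p q, P p -> P q -> P (p + q)) ->
  (forall p q, P p -> P q -> P (p * q)) -> forall p, P p.
Proof.
move=> hC hX hD hM p; have h1 : P 1 by rewrite -mpolyC1.
rewrite (mpolyE p); apply: (big_ind P); first by rewrite -mpolyC0.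
  exact: hD.
move=> m _.
rewrite -mul_mpolyC; apply: (hM) => //.
rewrite mpolyXE_id; apply: (big_ind P); [by []|exact: hM|move=> i _].
by elim: (m i) => [|k IH]; rewrite ?expr0 // exprS; apply: hM.
Qed.

Lemma factorial_iso (A B : idomainType) (f : {rmorphism A -> B})
    (g : {rmorphism B -> A}) :
  cancel f g -> cancel g f -> factorial A -> factorial B.
Proof.
move=> fK gK fA b b0.
have ga0 : g b != 0 by rewrite -(inj_eq (can_inj fK)) gK rmorph0.
have [s [u [sp uu e]]] := fA _ ga0.
exists (map f s), (f u); split.
- move=> _ /mapP[p /sp [p0 pu pp] ->]; split.
  + by rewrite -(inj_eq (can_inj gK)) fK rmorph0.
  + by apply: contra pu => /(rmorph_unit g); rewrite fK.
  + move=> x y [r e1]; have [|[t et]|[t et]] := pp (g x) (g y).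
    * by exists (g r); rewrite -rmorphM e1 rmorphM fK.
    * by left; exists (f t); rewrite -rmorphM -et gK.
    * by right; exists (f t); rewrite -rmorphM -et gK.
- exact: rmorph_unit.
- by rewrite -[b]gK e rmorphM rmorph_prod big_map.
Qed.

(** * Polynomials in several variables as polynomials in the last one *)

Section Muni.
Variables (F : fieldType) (n : nat).

(** The inverse of [muni], which singles out the last variable; factoriality is transported along
    this isomorphism. *)
Definition unmuni (p : {poly {mpoly F[n]}}) : {mpoly F[n.+1]} :=
  (map_poly (@mwiden n F) p).['X_ord_max].

Fact unmuni_is_additive : zmod_morphism unmuni.
Proof. by move=> p q; rewrite /unmuni rmorphB hornerD hornerN. Qed.

Fact unmuni_is_multiplicative : monoid_morphism unmuni.
Proof.
by split=> [|p q]; rewrite /unmuni ?rmorph1 ?hornerC // rmorphM hornerM.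
Qed.

HB.instance Definition _ := GRing.isZmodMorphism.Build _ _ unmuni
  unmuni_is_additive.
HB.instance Definition _ := GRing.isMonoidMorphism.Build _ _ unmuni
  unmuni_is_multiplicative.

Lemma muniXwiden (i : 'I_n) :
  muni ('X_(widen_ord (leqnSn n) i) : {mpoly F[n.+1]}) = ('X_i)%:P.
Proof.
rewrite /muni mmapX mmap1U; case: splitP => [j /= e|j /= e].
  by congr ('X__)%:P; apply/val_inj.
by have := ltn_ord i; rewrite e ord1 addn0 ltnn.
Qed.

Lemma muniXmax : muni ('X_ord_max : {mpoly F[n.+1]}) = 'X.
Proof.
rewrite /muni mmapX mmap1U; case: splitP => // j /= e.
by have := ltn_ord j; rewrite -e ltnn.
Qed.

Lemma ord_widen_max (i : 'I_n.+1) :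
  i = ord_max \/ exists j : 'I_n, i = widen_ord (leqnSn n) j.
Proof.
have [h|h] := ltnP i n; [right | left].
  by exists (Ordinal h); apply/val_inj.
by apply/val_inj/eqP; rewrite eqn_leq h -ltnS ltn_ord.
Qed.

Lemma unmuniD p q : unmuni (p + q) = unmuni p + unmuni q.
Proof. by rewrite /unmuni rmorphD hornerD. Qed.

Lemma unmuniM p q : unmuni (p * q) = unmuni p * unmuni q.
Proof. by rewrite /unmuni rmorphM hornerM. Qed.

Lemma unmuniC p : unmuni p%:P = mwiden p.
Proof. by rewrite /unmuni map_polyC hornerC. Qed.

Lemma muniK : cancel (@muni n F) unmuni.
Proof.
move=> p; elim/mpoly_ring_ind: p => [c|i|p q ep eq|p q ep eq].
- by rewrite muniC unmuniC mwidenC.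
- case: (ord_widen_max i) => [->|[j ->]].
    by rewrite muniXmax /unmuni map_polyX hornerX.
  by rewrite muniXwiden unmuniC /mwiden mmapX mmap1U.
- by rewrite muniD unmuniD; congr (_ + _).
- by rewrite muniM unmuniM; congr (_ * _).
Qed.

Lemma muni_mwiden (p : {mpoly F[n]}) : muni (mwiden p) = p%:P.
Proof.
elim/mpoly_ring_ind: p => [c|i|p q ep eq|p q ep eq].
- by rewrite mwidenC muniC.
- by rewrite /mwiden mmapX mmap1U muniXwiden.
- by rewrite mwidenD muniD polyCD; congr (_ + _).
- by rewrite mwidenM muniM polyCM; congr (_ * _).
Qed.

Lemma unmuniK : cancel unmuni (@muni n F).
Proof.
elim/poly_ind => [|p c e]; first by rewrite /unmuni rmorph0 horner0 muni0.
rewrite unmuniD unmuniM muniD muniM e unmuniC muni_mwiden.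
by rewrite /unmuni map_polyX hornerX muniXmax.
Qed.

End Muni.

Lemma factorial_mpoly (F : fieldType) n : factorial {mpoly F[n]}.
Proof.
elim: n => [|n IH].
  move=> p p0; exists [::], p; split=> //; last by rewrite big_nil mulr1.
  have e := nvar0_mpolyC p; have c0 : p@_0%MM != 0.
    by apply: contraNneq p0 => h; rewrite e h mpolyC0.
  apply/unitrPr; exists ((p@_0%MM)^-1)%:MP; rewrite {1}e -mpolyCM mulfV //.
apply: (factorial_iso (@unmuniK F n) (@muniK F n)).
exact: factorial_poly.
Qed.

(** Once the powers of the variable are stripped off, both factors have nonzero constant terms.
    Comparing lowest terms gives k = a + b, so what remains of f and g has product c and is
    constant. *)
Lemma factor_monomial (D : idomainType) (f g : {poly D}) c k :
  c != 0 -> f * g = c%:P * 'X^k -> exists e a, f = e%:P * 'X^a.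
Proof.
have aux (a b : nat) : (0 < a)%N -> (0 < b)%N -> (a + b).-1 == 1%N -> a == 1%N.
  by lia.
move=> c0 e.
have X0 : 'X^k != 0 :> {poly D} by rewrite monic_neq0 ?monicXn.
have fg0 : f * g != 0 by rewrite e mulf_neq0 ?polyC_eq0.
move: (fg0); rewrite mulf_eq0 negb_or => /andP[f0 g0].
have strip (h : {poly D}) : h != 0 ->
    exists a h1, ~~ root h1 0 /\ h = h1 * 'X^a.
  move=> h0; have [a [h1]] := multiplicity_XsubC h 0.
  by rewrite h0 /= subr0 => rh ->; exists a, h1.
have [a [f1 [rf ef]]] := strip _ f0.
have [b [g1 [rg eg]]] := strip _ g0.
have f10 : f1 != 0 by apply: contraNneq rf => ->; rewrite root0.
have g10 : g1 != 0 by apply: contraNneq rg => ->; rewrite root0.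
have e1 : (f1 * g1) * 'X^(a + b) = c%:P * 'X^k.
  by rewrite -e ef eg exprD; ring.
have fg1 : (f1 * g1)`_0 != 0.
  by rewrite -horner_coef0 hornerM mulf_neq0.
have kab : k = (a + b)%N.
  have [lt|gt|//] := ltngtP k (a + b)%N.
    have := congr1 (fun h : {poly D} => h`_k) e1.
    rewrite coefMXn lt coefCM coefXn eqxx mulr1 => /esym/eqP.
    by rewrite (negPf c0).
  have := congr1 (fun h : {poly D} => h`_(a + b)%N) e1.
  rewrite coefMXn ltnn subnn coefCM coefXn (ltn_eqF gt) mulr0 => h1.
  by rewrite h1 eqxx in fg1.
have sfg : size (f1 * g1) == 1%N.
  suff -> : f1 * g1 = c%:P by rewrite size_polyC c0.
  by apply: (mulIf X0); rewrite -e1 kab.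
have sf1 : size f1 == 1%N.
  by move: sfg; rewrite size_mul //; apply: aux; rewrite size_poly_gt0.
have /size_poly1P[d d0 ed] := sf1.
by exists d, a; rewrite ef ed.
Qed.

(** * Factors of homogeneous polynomials *)

Section Homogeneous.
Variables (F : fieldType) (n : nat).
Implicit Types p q r : {mpoly F[n]}.

(* The grading as a ring morphism: p = \sum_k p_k is sent to \sum_k p_k T^k. *)
Definition grad p : {poly {mpoly F[n]}} :=
  mmap (polyC \o @mpolyC n F) (fun i => ('X_i : {mpoly F[n]})%:P * 'X) p.

Lemma gradE p :
  grad p = \sum_(m <- msupp p) (p@_m *: 'X_[m])%:P * 'X^(mdeg m).
Proof.
rewrite /grad /mmap; apply: eq_bigr => m _ /=.
rewrite /mmap1 -mul_mpolyC polyCM -mulrA; congr (_ * _).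
rewrite mpolyXE_id rmorph_prod mdegE -prodrXr -big_split /=.
by apply: eq_bigr => i _; rewrite exprMn rmorphXn.
Qed.

Lemma gradM p q : grad (p * q) = grad p * grad q.
Proof. by rewrite /grad rmorphM. Qed.

Lemma grad_horner1 p : (grad p).[1] = p.
Proof.
rewrite gradE horner_sum [RHS]mpolyE; apply: eq_bigr => m _.
by rewrite hornerM hornerXn expr1n mulr1 hornerC.
Qed.

Lemma grad_homogP k p : reflect (grad p = p%:P * 'X^k) (p \is k.-homog).
Proof.
apply: (iffP idP) => [/dhomogP h|h].
  rewrite gradE [in RHS](mpolyE p) raddf_sum mulr_suml big_seq [RHS]big_seq.
  by apply: eq_bigr => m /h ->.
apply/dhomogP => m mp; apply/eqP; apply: contraLR mp => mk.
rewrite -mcoeff_eq0.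
have := congr1 (fun f : {poly {mpoly F[n]}} => (f`_(mdeg m))@_m) h.
rewrite coefCM coefXn (negPf mk) mulr0 mcoeff0 gradE coef_sum => e.
apply/eqP; rewrite -e [in LHS](mpolyE p) !linear_sum /=.
apply: eq_bigr => m' _; rewrite coefCM coefXn.
rewrite mcoeffZ mcoeffX; case: (eqVneq m' m) => [->|nm].
  by rewrite eqxx !mulr1 mcoeffZ mcoeffX eqxx mulr1.
by rewrite mulr0; case: eqP => _; rewrite ?mulr1 ?mulr0 ?mcoeff0 // mcoeffZ mcoeffX (negPf nm) mulr0.
Qed.

(** [grad] is multiplicative and sends homogeneous polynomials to monomials, whose factors are
    monomials. *)
Lemma homog_factor k p q : p * q != 0 -> p * q \is k.-homog ->
  exists j, p \is j.-homog.
Proof.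
move=> pq0 /grad_homogP; rewrite gradM => /(factor_monomial pq0) [e [a ea]].
exists a; apply/grad_homogP; rewrite ea; congr (_%:P * _).
by rewrite -[p]grad_horner1 ea hornerM hornerC hornerXn expr1n mulr1.
Qed.

Lemma dhomog_fact k j p q : p != 0 -> p \is j.-homog -> p * q \is (j + k).-homog ->
  q \is k.-homog.
Proof.
move=> p0 hp hpq; have [->|q0] := eqVneq q 0; first exact: dhomog0.
have pq0 : q * p != 0 by rewrite mulf_neq0.
have [|i hi] := @homog_factor (j + k) q p pq0; first by rewrite mulrC.
have := dhomog_uniq _ (dhomogM hp hi) hpq.
by rewrite mulrC => /(_ pq0) /addnI <-.
Qed.

End Homogeneous.

(** * Fractions and their values along a divisor *)

Section Val.
Variables (A B : idomainType) (phi : {rmorphism A -> B}).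
Implicit Types (f : {fraction A}) (g : {fraction B}) (a b p : A).

(** Restriction of fractions to the locus where phi vanishes identically, as a relation because f
    may have a pole there. Here phi is either the substitution of a hyperplane, for residues, or the
    evaluation at a point. *)
Definition val_at f g : Prop := exists a b,
  [/\ phi b != 0, f = a%:F / b%:F & g = (phi a)%:F / (phi b)%:F].

Lemma morph_neq0 b : phi b != 0 -> b != 0.
Proof. by apply: contra_neq => ->; rewrite rmorph0. Qed.

Lemma val_at_frac a b : phi b != 0 ->
  val_at (a%:F / b%:F) ((phi a)%:F / (phi b)%:F).
Proof. by move=> b0; exists a, b. Qed.

Lemma val_at_tofrac a : val_at a%:F (phi a)%:F.
Proof.
exists a, 1; split; first by rewrite rmorph1 oner_neq0.
  by rewrite tofrac1 divr1.
by rewrite rmorph1 tofrac1 divr1.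
Qed.

Lemma val_at0 : val_at 0 0.
Proof. by have := val_at_tofrac 0; rewrite !rmorph0. Qed.

Lemma val_atD f f' g g' : val_at f g -> val_at f' g' -> val_at (f + f') (g + g').
Proof.
move=> [a [b [b0 -> ->]]] [a' [b' [b'0 -> ->]]].
exists (a * b' + a' * b), (b * b'); split.
- by rewrite rmorphM mulf_neq0.
- by rewrite addf_div ?tofrac_eq0 ?morph_neq0 // tofracD !tofracM.
- by rewrite addf_div ?tofrac_eq0 // rmorphD !rmorphM /= tofracD !tofracM.
Qed.

Lemma val_atM f f' g g' : val_at f g -> val_at f' g' -> val_at (f * f') (g * g').
Proof.
move=> [a [b [b0 -> ->]]] [a' [b' [b'0 -> ->]]].
exists (a * a'), (b * b'); split.
- by rewrite rmorphM mulf_neq0.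
- by rewrite mulf_div !tofracM.
- by rewrite mulf_div !rmorphM.
Qed.

Lemma val_atN f g : val_at f g -> val_at (- f) (- g).
Proof.
move=> /(val_atM (val_at_tofrac (-1))).
by rewrite !rmorphN !rmorph1 !mulN1r.
Qed.

Lemma val_atB f f' g g' : val_at f g -> val_at f' g' -> val_at (f - f') (g - g').
Proof. by move=> h /val_atN; apply: val_atD. Qed.

Lemma val_at_sum (I : Type) (r : seq I) (P : pred I)
    (u : I -> {fraction A}) (v : I -> {fraction B}) :
  (forall i, P i -> val_at (u i) (v i)) ->
  val_at (\sum_(i <- r | P i) u i) (\sum_(i <- r | P i) v i).
Proof.
move=> h; apply: (big_ind2 val_at) => //; first exact: val_at0.
by move=> *; apply: val_atD.
Qed.

Lemma val_at_uniq f g g' : val_at f g -> val_at f g' -> g = g'.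
Proof.
move=> [a [b [b0 -> ->]]] [a' [b' [b'0 /eqP + ->]]].
rewrite eqr_div ?tofrac_eq0 ?morph_neq0 // -!tofracM tofrac_eq => /eqP e.
by apply/eqP; rewrite eqr_div ?tofrac_eq0 // -!tofracM tofrac_eq -!rmorphM e.
Qed.

Definition regular p f : Prop := exists a b, ~ rdvd p b /\ f = a%:F / b%:F.

Lemma rdvd_ker p b : phi p = 0 -> rdvd p b -> phi b = 0.
Proof. by move=> p0 [r ->]; rewrite rmorphM p0 mul0r. Qed.

(** A vanishing residue means no pole: the numerator of [p%:F * f] lies in the kernel of phi, so it
    has a factor p to cancel. *)
Lemma regular_val0 p f : p != 0 -> phi p = 0 ->
  (forall a, phi a = 0 -> rdvd p a) -> val_at (p%:F * f) 0 -> regular p f.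
Proof.
move=> p0 pp ker [a [b [b0 e /esym/eqP]]].
rewrite mulf_eq0 invr_eq0 !tofrac_eq0 (negPf b0) orbF => /eqP/ker[r er].
exists r, b; split; first by move/(rdvd_ker pp)/eqP; rewrite (negPf b0).
have P0 : p%:F != 0 by rewrite tofrac_eq0.
by apply: (mulfI P0); rewrite e er tofracM mulrA.
Qed.

Lemma prime_ker p : p != 0 -> phi p = 0 ->
  (forall a, phi a = 0 -> rdvd p a) -> rprime p.
Proof.
move=> p0 pp ker; split=> //.
  by apply/negP => /(rmorph_unit phi); rewrite pp unitr0.
move=> a b /(rdvd_ker pp)/eqP; rewrite rmorphM mulf_eq0.
by case/orP => /eqP/ker; [left | right].
Qed.

End Val.

Section RegularFractions.
Variable A : idomainType.
Implicit Types (f : {fraction A}) (a b p : A).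

Lemma regular_cancel p f a b : rprime p -> b != 0 -> regular p f ->
  f = a%:F / (p * b)%:F -> exists r, a = p * r /\ f = r%:F / b%:F.
Proof.
move=> [p0 pu pp] b0 [c [d [hd ->]]] /eqP.
have d0 : d != 0 by apply: contra_not_neq hd => ->; apply: rdvd0.
rewrite eqr_div ?tofrac_eq0 ?mulf_neq0 // -!tofracM tofrac_eq => /eqP e.
have : rdvd p (a * d) by rewrite -e mulrCA; exists (c * b).
case/pp => // -[r er]; exists r; split=> //; apply/eqP.
rewrite eqr_div ?tofrac_eq0 // -!tofracM tofrac_eq.
by apply/eqP/(mulfI p0); rewrite mulrCA e er; ring.
Qed.

End RegularFractions.

(** * Linear forms and linear substitutions *)

Section LinearForms.
Variable F : fieldType.

Definition linf n (w : 'rV[F]_n) : {mpoly F[n]} := \sum_i w 0 i *: 'X_i.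

Lemma linf_homog n (w : 'rV[F]_n) : linf w \is 1.-homog.
Proof. by apply: rpred_sum => i _; apply: rpredZ; rewrite dhomogX; apply/eqP/mdeg1. Qed.

Lemma linfE n (w : 'rV[F]_n) i : (linf w)@_U_(i) = w 0 i.
Proof.
rewrite /linf raddf_sum (bigD1 i) //= mcoeffZ mcoeffXU eqxx mulr1.
by rewrite big1 ?addr0 // => j ji; rewrite mcoeffZ mcoeffXU (negPf ji) mulr0.
Qed.

Lemma linf_eq0 n (w : 'rV[F]_n) : (linf w == 0) = (w == 0).
Proof.
apply/eqP/eqP => [e|->]; last by apply: big1 => i _; rewrite mxE scale0r.
by apply/rowP => i; rewrite -linfE e mcoeff0 mxE.
Qed.

Lemma linfZ n c (w : 'rV[F]_n) : linf (c *: w) = c *: linf w.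
Proof.
by rewrite /linf scaler_sumr; apply: eq_bigr => i _; rewrite mxE scalerA.
Qed.

Lemma linfD n (v w : 'rV[F]_n) : linf (v + w) = linf v + linf w.
Proof.
by rewrite /linf -big_split; apply: eq_bigr => i _; rewrite mxE scalerDl.
Qed.

Lemma linf_sum n (I : Type) (r : seq I) (P : pred I) (u : I -> 'rV[F]_n) :
  linf (\sum_(i <- r | P i) u i) = \sum_(i <- r | P i) linf (u i).
Proof.
apply: (big_morph (@linf n)) => [v w|]; first exact: linfD.
by apply/eqP; rewrite linf_eq0.
Qed.

End LinearForms.

(** The pullback of p by the linear map y |-> y *m H of row vectors. It is locked so that the
    composition of polynomials stays folded. *)
HB.lock Definition sub (F : fieldType) m n (H : 'M[F]_(m, n))
  (p : {mpoly F[n]}) : {mpoly F[m]} := p \mPo [tuple linf (\row_i H i j) | j < n].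

Arguments sub {F m n} H p.

Section LinearSubstitutions.
Variable F : fieldType.

Section Sub.
Variables (m n : nat) (H : 'M[F]_(m, n)).

Fact sub_is_additive : zmod_morphism (sub H).
Proof. by move=> p q; rewrite unlock comp_mpolyB. Qed.

Fact sub_is_multiplicative : monoid_morphism (sub H).
Proof. by split=> [|p q]; rewrite unlock ?rmorph1 ?rmorphM. Qed.

HB.instance Definition _ := GRing.isZmodMorphism.Build _ _ (sub H)
  sub_is_additive.
HB.instance Definition _ := GRing.isMonoidMorphism.Build _ _ (sub H)
  sub_is_multiplicative.

Lemma subC c : sub H c%:MP = c%:MP.
Proof. by rewrite unlock comp_mpolyC. Qed.

Lemma subZ c p : sub H (c *: p) = c *: sub H p.
Proof. by rewrite unlock comp_mpolyZ. Qed.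

Lemma subX j : sub H 'X_j = linf (\row_i H i j).
Proof. by rewrite unlock comp_mpolyXU -tnth_nth tnth_mktuple. Qed.

Lemma sub_linf w : sub H (linf w) = linf (w *m H^T).
Proof.
rewrite {1}/linf raddf_sum /=.
under eq_bigr do rewrite subZ subX -linfZ.
rewrite -linf_sum; congr linf; apply/rowP => i; rewrite summxE mxE.
by apply: eq_bigr => j _; rewrite !mxE.
Qed.

Lemma sub_homog k p : p \is k.-homog -> sub H p \is k.-homog.
Proof.
move=> /dhomogP hp; rewrite (mpolyE p) raddf_sum /= big_seq.
apply: rpred_sum => M /hp e; have {e} <- : mdeg M = k := e.
rewrite subZ; apply: rpredZ.
rewrite unlock comp_mpolyX mdegE; apply: (big_ind2 (fun (p : {mpoly F[m]}) k => p \is k.-homog)).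
- exact: dhomog1.
- by move=> ? ? ? ?; apply: dhomogM.
- move=> i _; rewrite tnth_mktuple.
  by have := dhomogMn (M i) (linf_homog (\row_j H j i)); rewrite mul1n.
Qed.

End Sub.

Lemma sub_sub l m n (G : 'M[F]_(l, m)) (H : 'M[F]_(m, n)) p :
  sub G (sub H p) = sub (G *m H) p.
Proof.
elim/mpoly_ring_ind: p => [c|j|p q ep eq|p q ep eq].
- by rewrite !subC.
- rewrite !subX sub_linf; congr linf; apply/rowP => i; rewrite !mxE.
  by apply: eq_bigr => k _; rewrite !mxE mulrC.
- by rewrite !rmorphD /=; congr (_ + _).
- by rewrite !rmorphM /=; congr (_ * _).
Qed.

Lemma sub1 n (p : {mpoly F[n]}) : sub 1%:M p = p.
Proof.
elim/mpoly_ring_ind: p => [c|j|p q ep eq|p q ep eq].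
- by rewrite subC.
- rewrite subX /linf (bigD1 j) //= !mxE eqxx scale1r big1 ?addr0 // => i ij.
  by rewrite !mxE (negPf ij) scale0r.
- by rewrite !rmorphD /=; congr (_ + _).
- by rewrite !rmorphM /=; congr (_ * _).
Qed.

(* The rows of H span the hyperplane orthogonal to w. *)
Definition hyper m n (w : 'rV[F]_n) (H : 'M[F]_(m, n)) : Prop :=
  w *m H^T = 0 /\ exists Y b, 1%:M = Y *m H + w^T *m b.

Section Hyperplane.
Variables (m n : nat) (w : 'rV[F]_n) (H : 'M[F]_(m, n)).
Hypothesis wH : hyper w H.

(* Modulo linf w, the identity substitution agrees with the substitution by
   Y *m H, which factors through the hyperplane. *)
Lemma sub_ker p : sub H p = 0 -> rdvd (linf w) p.
Proof.
have [_ [Y [b e1]]] := wH => hp.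
suff : rdvd (linf w) (p - sub (Y *m H) p).
  by rewrite -sub_sub hp rmorph0 subr0.
elim/mpoly_ring_ind: p {hp} => [c|j|p q ep eq|p q ep eq].
- by rewrite subC subrr; apply: rdvd0.
- rewrite subX; have -> : 'X_j = linf (\row_i (1%:M : 'M[F]_n) i j).
    by rewrite -subX sub1.
  rewrite -[X in _ - X]mul1r -scaleN1r mul1r -linfZ -linfD.
  exists (b 0 j)%:MP; rewrite mulrC mul_mpolyC -linfZ; congr linf.
  apply/rowP => i; rewrite e1 !mxE big_ord1 !mxE.
  by rewrite mulN1r addrC addKr mulrC.
- by rewrite rmorphD /= opprD addrACA; apply: rdvdD.
- rewrite rmorphM /=.
  have -> : p * q - sub (Y *m H) p * sub (Y *m H) q =
    q * (p - sub (Y *m H) p) + sub (Y *m H) p * (q - sub (Y *m H) q) by ring.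
  by apply: rdvdD; apply: rdvd_mull.
Qed.

Lemma sub_hyper : sub H (linf w) = 0.
Proof. by case: wH => e _; apply/eqP; rewrite sub_linf linf_eq0 e. Qed.

Lemma sub_neq0 p : ~ rdvd (linf w) p -> sub H p != 0.
Proof. by apply: contra_not_neq => /sub_ker. Qed.

Lemma linf_hyper_prime : w != 0 -> rprime (linf w).
Proof.
move=> w0; apply: (@prime_ker _ _ (sub H)); rewrite ?linf_eq0 //.
  exact: sub_hyper.
exact: sub_ker.
Qed.

End Hyperplane.

(** The projection onto the hyperplane along a vector b with [w *m b^T = 1]. The rows of H only have
    to span, so a square matrix avoids choosing a basis. *)
Lemma hyper_exists n (w : 'rV[F]_n) : w != 0 -> exists H : 'M[F]_n, hyper w H.
Proof.
move=> /rV0Pn[j wj]; pose b : 'rV[F]_n := (w 0 j)^-1 *: delta_mx 0 j.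
exists (1%:M - w^T *m b); split; last first.
  by exists 1%:M, b; rewrite mul1mx subrK.
rewrite linearB /= trmx1 trmx_mul trmxK mulmxBr mulmx1 mulmxA.
have -> : w *m b^T = 1%:M.
  apply/rowP => i; rewrite ord1 mxE (bigD1 j) //= !mxE !eqxx mulr1 mulfV //.
  by rewrite big1 ?addr0 // => k kj; rewrite !mxE (negPf kj) !mulr0.
by rewrite mul1mx subrr.
Qed.

Lemma linf_prime n (w : 'rV[F]_n) : w != 0 -> rprime (linf w).
Proof. by move=> w0; have [H wH] := hyper_exists w0; exact: (linf_hyper_prime wH). Qed.

Lemma rdvd_linf n (v w : 'rV[F]_n) : w != 0 -> rdvd (linf w) (linf v) ->
  exists c, v = c *: w.
Proof.
move=> w0 [r e]; have [->|v0] := eqVneq v 0; first by exists 0; rewrite scale0r.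
have r0 : r \is 0.-homog.
  apply: (@dhomog_fact F n 0 1 (linf w)); first by rewrite linf_eq0.
    exact: linf_homog.
  by rewrite -e; apply: linf_homog.
have {r0} er : r = (r@_0%MM)%:MP.
  apply/mpolyP => M; rewrite mcoeffC; case: eqVneq => [->|M0]; first by rewrite mulr1.
  rewrite mulr0; apply: (dhomog_nemf_coeff r0); by rewrite mdeg_eq0.
exists r@_0%MM; apply/rowP => i.
by rewrite -linfE e er mulrC mul_mpolyC -linfZ linfE mcoeffC eqxx mulr1.
Qed.

Lemma prod_linf_homog n (s : seq 'rV[F]_n) :
  \prod_(w <- s) linf w \is (size s).-homog.
Proof.
elim: s => [|w s IH]; first by rewrite big_nil dhomog1.
by rewrite big_cons; apply: (dhomogM (linf_homog w) IH).
Qed.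

Lemma prod_linf_neq0 n (s : seq 'rV[F]_n) :
  all (fun w => w != 0) s -> \prod_(w <- s) linf w != 0.
Proof.
by elim: s => [|w s IH]; rewrite ?big_nil ?oner_neq0 // big_cons /= => /andP[w0 /IH];
  apply: mulf_neq0; rewrite linf_eq0.
Qed.

(** Cancels, one at a time, the linear forms along which f is regular, so that only genuine poles
    remain. The equation between sizes records that both representations give f the same degree. *)
Lemma reduce_linf n (f : {fraction {mpoly F[n]}}) k N (s : seq 'rV[F]_n) :
  f != 0 -> all (fun w => w != 0) s -> N \is k.-homog ->
  f = N%:F / (\prod_(w <- s) linf w)%:F ->
  exists s' N' k', [/\ {subset s' <= s}, N' \is k'.-homog,
    (k' + size s = k + size s')%N,
    f = N'%:F / (\prod_(w <- s') linf w)%:F &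
    forall w, w \in s' -> ~ regular (linf w) f].
Proof.
move=> f0; move: {2}(size s) (leqnn (size s)) => l.
elim: l s N k => [|l IH] s N k ls s0 hN ef.
  exists s, N, k; split=> // w.
  by move: ls; rewrite leqn0 => /nilP ->.
have [h|] := pselect (exists2 w, w \in s & regular (linf w) f); last first.
  move=> h; exists s, N, k; split=> // w ws hw; apply: h; by exists w.
have [w ws rw] := h; have w0 := allP s0 _ ws.
have e1 := perm_to_rem ws.
have s0' : all (fun w => w != 0) (rem w s).
  by apply/allP => v /mem_rem; apply: (allP s0).
have [|r [eN ef']] := regular_cancel (linf_prime w0) (prod_linf_neq0 s0') rw
    (a := N).
  by rewrite ef (perm_big _ e1) big_cons.
have sr : size s = (size (rem w s)).+1 by rewrite (perm_size e1).
have N0 : r * linf w != 0.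
  by rewrite mulrC -eN; apply: contraNneq f0 => N0; rewrite ef N0 tofrac0 mul0r.
have [|j hj] := @homog_factor _ _ k r (linf w) N0; first by rewrite mulrC -eN.
have kj : k = j.+1.
  have := dhomog_uniq N0 (dhomogM hj (linf_homog w)).
  by rewrite mulrC -eN addn1 => /(_ k hN) ->.
have [||||s' [N' [k' [ss hN' kk ef2 hr]]]] := IH (rem w s) r j.
- by rewrite -ltnS -sr.
- exact: s0'.
- exact: hj.
- exact: ef'.
exists s', N', k'; split=> //; first by move=> v /ss /mem_rem.
by rewrite sr kj addnS kk addSn.
Qed.

End LinearSubstitutions.

Lemma eq_tofrac (A : idomainType) (a b a' b' : A) : b != 0 -> b' != 0 ->
  a%:F / b%:F = a'%:F / b'%:F <-> a * b' = a' * b.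
Proof.
move=> b0 b'0; split=> [/eqP|e]; last apply/eqP.
  by rewrite eqr_div ?tofrac_eq0 // -!tofracM tofrac_eq => /eqP.
by rewrite eqr_div ?tofrac_eq0 // -!tofracM tofrac_eq e.
Qed.

Lemma morph_frac (A B : idomainType) (phi : {rmorphism A -> B}) (a b a' b' : A) :
  phi b != 0 -> phi b' != 0 -> a%:F / b%:F = a'%:F / b'%:F ->
  (phi a)%:F / (phi b)%:F = (phi a')%:F / (phi b')%:F.
Proof.
move=> b0 b'0 h; apply: (proj2 (eq_tofrac _ _ _ _)) => //; rewrite -!rmorphM; congr (phi _).
apply: (proj1 (eq_tofrac _ _ _ _) h); exact: (morph_neq0 (phi := phi)).
Qed.

(** * Affine charts *)

HB.lock Definition deh (F : fieldType) n (p : {mpoly F[n.+1]}) : {mpoly F[n]} :=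
  p \mPo [tuple if unlift ord0 i is Some j then 'X_j else 1 | i < n.+1].

Section Dehomogenization.
Variables (F : fieldType) (n : nat).
Local Notation deh := (@deh F n).

Fact deh_is_additive : zmod_morphism deh.
Proof. by move=> p q; rewrite unlock comp_mpolyB. Qed.

Fact deh_is_multiplicative : monoid_morphism deh.
Proof. by split=> [|p q]; rewrite unlock ?rmorph1 ?rmorphM. Qed.

HB.instance Definition _ := GRing.isZmodMorphism.Build _ _ deh
  deh_is_additive.
HB.instance Definition _ := GRing.isMonoidMorphism.Build _ _ deh
  deh_is_multiplicative.

Lemma dehC c : deh c%:MP = c%:MP.
Proof. by rewrite unlock comp_mpolyC. Qed.

Lemma dehZ c p : deh (c *: p) = c *: deh p.
Proof. by rewrite unlock comp_mpolyZ. Qed.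

Lemma dehX0 : deh 'X_ord0 = 1.
Proof. by rewrite unlock comp_mpolyXU -tnth_nth tnth_mktuple unlift_none. Qed.

Lemma dehXS j : deh 'X_(lift ord0 j) = 'X_j.
Proof. by rewrite unlock comp_mpolyXU -tnth_nth tnth_mktuple liftK. Qed.

Let toF : F -> {fraction {mpoly F[n.+1]}} := fun c => (c%:MP)%:F.

Fact toF_is_additive : zmod_morphism toF.
Proof. by move=> x y; rewrite /toF mpolyCB tofracB. Qed.
Fact toF_is_multiplicative : monoid_morphism toF.
Proof.
by split=> [|x y]; rewrite /toF ?mpolyC1 ?tofrac1 // mpolyCM tofracM.
Qed.
HB.instance Definition _ := GRing.isZmodMorphism.Build _ _ toF
  toF_is_additive.
HB.instance Definition _ := GRing.isMonoidMorphism.Build _ _ toF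
  toF_is_multiplicative.

(* Homogenization: p(z_1, ..., z_n) is sent to p(z_1/z_0, ..., z_n/z_0). *)
Let hom (p : {mpoly F[n]}) : {fraction {mpoly F[n.+1]}} :=
  mmap toF (fun i => ('X_(lift ord0 i))%:F / ('X_ord0)%:F) p.

Let hom' (p : {mpoly F[n.+1]}) : {fraction {mpoly F[n.+1]}} :=
  mmap toF (fun i => ('X_i)%:F / ('X_ord0)%:F) p.

Let X0 : ('X_ord0 : {mpoly F[n.+1]}) != 0.
Proof. by rewrite -msize_poly_eq0 msizeX. Qed.

Let hom_deh p : hom (deh p) = hom' p.
Proof.
elim/mpoly_ring_ind: p => [c|i|p q ep eq|p q ep eq].
- by rewrite dehC /hom /hom' !mmapC.
- have [->|[j ->]] : i = ord0 \/ exists j, i = lift ord0 j.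
    by case: (unliftP ord0 i) => [j ->|->]; [right; exists j | left].
  + by rewrite dehX0 /hom rmorph1 /hom' mmapX mmap1U divff // tofrac_eq0.
  + by rewrite dehXS /hom /hom' !mmapX !mmap1U.
- by rewrite rmorphD /hom /hom' !mmapD; congr (_ + _).
- by rewrite rmorphM /hom /hom' /= !rmorphM; congr (_ * _).
Qed.

(** Homogenizing [deh p] again gives p divided by the k-th power of z_0, because all monomials of p
    have degree k. *)
Lemma deh_inj k (p : {mpoly F[n.+1]}) : p \is k.-homog -> deh p = 0 -> p = 0.
Proof.
move=> /dhomogP hp /(congr1 hom); rewrite hom_deh (_ : hom 0 = 0); last exact: mmap0.
suff -> : hom' p = p%:F / ('X_ord0 ^+ k)%:F.
  move/eqP; rewrite mulf_eq0 invr_eq0 !tofrac_eq0 expf_eq0 (negPf X0) andbF orbF.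
  by move/eqP.
rewrite [in RHS](mpolyE p) raddf_sum /= mulr_suml /hom' /mmap big_seq [RHS]big_seq.
apply: eq_bigr => m /hp e; have {e} <- : mdeg m = k := e.
rewrite /mmap1 -mul_mpolyC tofracM -mulrA; congr (_ * _).
rewrite ['X_[m]]mpolyXE_id mdegE -prodrXr !rmorph_prod /= -prodf_div.
by apply: eq_bigr => i _; rewrite expr_div_n !rmorphXn.
Qed.

Lemma deh_neq0 k (p : {mpoly F[n.+1]}) : p \is k.-homog -> p != 0 -> deh p != 0.
Proof. by move=> /deh_inj h; apply: contra_neq. Qed.

(** Both fractions have degree - D, so the two cross products have the same degree and [deh_inj]
    applies to their difference. *)
Lemma deh_frac_inj k k' D (a b a' b' : {mpoly F[n.+1]}) :
  a \is k.-homog -> b \is (k + D).-homog ->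
  a' \is k'.-homog -> b' \is (k' + D).-homog -> b != 0 -> b' != 0 ->
  (deh a)%:F / (deh b)%:F = (deh a')%:F / (deh b')%:F ->
  a%:F / b%:F = a'%:F / b'%:F.
Proof.
move=> ha hb ha' hb' b0 b'0 /eqP.
rewrite eqr_div ?tofrac_eq0 ?(deh_neq0 hb) ?(deh_neq0 hb') //.
rewrite -!tofracM tofrac_eq -!rmorphM -subr_eq0 -rmorphB => /eqP/deh_inj h.
apply/eqP; rewrite eqr_div ?tofrac_eq0 // -!tofracM tofrac_eq -subr_eq0.
apply/eqP; apply: (h (k + (k' + D))%N); apply: rpredB; first exact: dhomogM.
by rewrite addnCA; apply: dhomogM.
Qed.

End Dehomogenization.

Section Charts.
Variable F : fieldType.

Definition chart_tuple d (M : 'M[F]_d.+1) : d.+1.-tuple {mpoly F[d]} :=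
  [tuple (M ord0 j)%:MP + \sum_(i < d) M (lift ord0 i) j *: 'X_i | j < d.+1].

Lemma comp_chart d (M : 'M[F]_d.+1) p : p \mPo chart_tuple M = deh (sub M p).
Proof.
elim/mpoly_ring_ind: p => [c|j|p q ep eq|p q ep eq].
- by rewrite comp_mpolyC subC dehC.
- rewrite comp_mpolyXU -tnth_nth tnth_mktuple subX /linf raddf_sum /=.
  rewrite big_ord_recl dehZ dehX0 mxE alg_mpolyC; congr (_ + _).
  by apply: eq_bigr => i _; rewrite dehZ dehXS mxE.
- by rewrite comp_mpolyD !rmorphD /=; congr (_ + _).
- by rewrite !rmorphM /=; congr (_ * _).
Qed.

Definition restrict0 e (p : {mpoly F[e.+1]}) : {mpoly F[e]} :=
  p \mPo [tuple if unlift ord0 i is Some j then 'X_j else 0 | i < e.+1].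

Fact restrict0_is_additive e : zmod_morphism (@restrict0 e).
Proof. by move=> p q; rewrite /restrict0 comp_mpolyB. Qed.

Fact restrict0_is_multiplicative e : monoid_morphism (@restrict0 e).
Proof. by split=> [|p q]; rewrite /restrict0 ?rmorph1 ?rmorphM. Qed.

HB.instance Definition _ e := GRing.isZmodMorphism.Build _ _ (@restrict0 e)
  (@restrict0_is_additive e).
HB.instance Definition _ e := GRing.isMonoidMorphism.Build _ _ (@restrict0 e)
  (@restrict0_is_multiplicative e).

Lemma restrict0M e (p q : {mpoly F[e.+1]}) :
  restrict0 (p * q) = restrict0 p * restrict0 q.
Proof. exact: rmorphM. Qed.

Lemma restrict0C e c : restrict0 (c%:MP : {mpoly F[e.+1]}) = c%:MP.
Proof. exact: comp_mpolyC. Qed.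

Lemma restrict0_deh e (p : {mpoly F[e.+2]}) :
  restrict0 (deh p) = deh (sub (row' (lift ord0 ord0) 1%:M) p).
Proof.
rewrite /restrict0.
elim/mpoly_ring_ind: p => [c|j|p q ep eq|p q ep eq].
- by rewrite dehC subC dehC comp_mpolyC.
- rewrite subX /linf raddf_sum /=.
  case: (unliftP (lift ord0 ord0) j) => [i ->|->]; last first.
    rewrite dehXS comp_mpolyXU -tnth_nth tnth_mktuple unlift_none.
    by rewrite big1 // => i _; rewrite !mxE eq_sym (negPf (neq_lift _ _)) scale0r rmorph0.
  rewrite (bigD1 i) //= !mxE eqxx scale1r big1 ?addr0 => [|k ki]; last first.
    by rewrite !mxE (inj_eq lift_inj) (negPf ki) scale0r rmorph0.
  case: (unliftP ord0 i) => [i' ->|->].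
    have -> : lift (lift ord0 ord0) (lift ord0 i') = lift ord0 (lift ord0 i').
      exact/val_inj.
    by rewrite !dehXS comp_mpolyXU -tnth_nth tnth_mktuple liftK.
  have -> : lift (lift ord0 ord0) ord0 = ord0 :> 'I_e.+2 by apply/val_inj.
  by rewrite !dehX0 rmorph1.
- by rewrite !rmorphD /=; congr (_ + _).
- by rewrite !rmorphM /=; congr (_ * _).
Qed.

Lemma row'_mulmx m n (k : 'I_m) (A : 'M[F]_(m, n)) :
  row' k 1%:M *m A = row' k A.
Proof.
apply/matrixP => i j; rewrite !mxE (bigD1 (lift k i)) //= !mxE eqxx mul1r.
by rewrite big1 ?addr0 // => l li; rewrite !mxE eq_sym (negPf li) mul0r.
Qed.

Lemma restrict0_sub e (M : 'M[F]_e.+2) p :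
  restrict0 (deh (sub M p)) = deh (sub (row' (lift ord0 ord0) M) p).
Proof.
by rewrite restrict0_deh sub_sub row'_mulmx.
Qed.

Section FacetChart.
Variables (e : nat) (M : 'M[F]_e.+2) (w : 'rV[F]_e.+2) (beta : F).
Local Notation ix := (lift ord0 ord0 : 'I_e.+2).
Hypotheses (uM : M \in unitmx) (w0 : w != 0).
Hypothesis wM : w *m M^T = beta *: delta_mx 0 ix.
Local Notation H := (row' ix M).

Lemma facet_beta_neq0 : beta != 0.
Proof.
apply: contraNneq w0 => b0; move: wM; rewrite b0 scale0r => h.
have uMT : M^T \in unitmx by rewrite unitmx_tr.
by rewrite -[w](mulmxK uMT) h mul0mx.
Qed.

Lemma facet_hyper : hyper w H.
Proof.
split.
  apply/rowP => i; have := congr1 (fun A : 'rV_e.+2 => A 0 (lift ix i)) wM.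
  rewrite !mxE eqxx eq_sym (negPf (neq_lift _ _)) andbF mulr0 => h.
  by rewrite -[RHS]h; apply: eq_bigr => k _; rewrite !mxE.
exists (col' ix (invmx M)), (beta^-1 *: row ix M).
have uMT : M^T \in unitmx by rewrite unitmx_tr.
have ew : w^T = beta *: col ix (invmx M).
  rewrite -[w](mulmxK uMT) wM trmx_mul trmx_inv trmxK linearZ /= -scalemxAr.
  by rewrite trmx_delta -colE.
rewrite ew -scalemxAr -scalemxAl scalerA mulVf ?facet_beta_neq0 // scale1r.
rewrite -(mulVmx uM); apply/matrixP => i j; rewrite !mxE big_ord1.
rewrite (bigD1_ord ix) //= addrC !mxE; congr (_ + _).
by apply: eq_bigr => k _; rewrite !mxE.
Qed.

Lemma sub_chart_linf : sub M (linf w) = beta *: 'X_ix.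
Proof.
rewrite sub_linf wM linfZ; congr (_ *: _).
rewrite /linf (bigD1 ix) //= mxE !eqxx scale1r big1 ?addr0 // => i iix.
by rewrite mxE (negPf iix) andbF scale0r.
Qed.

Lemma sub_unit_neq0 p : p != 0 -> sub M p != 0.
Proof.
move=> p0; apply: contraNneq p0 => h.
by rewrite -[p]sub1 -(mulVmx uM) -sub_sub h rmorph0.
Qed.

Variables (N D a b : {mpoly F[e.+2]}) (j k : nat) (dM : F).
Hypotheses (hD : D \is j.-homog) (D0 : D != 0).
Hypotheses (hb : b \is k.-homog) (Hb0 : sub H b != 0).
Hypothesis Nab : N%:F / D%:F = a%:F / (linf w * b)%:F.

(** The definition of the residue leaves the representation n / m free. The denominator [linf w * b]
    fixes one: in the chart [linf w] becomes beta x_1, and cross-multiplication shows that any other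
    admissible n / m has the same restriction to x_1 = 0. *)
Lemma residue_chart (rho : {fraction {mpoly F[e]}}) :
  (exists n m, [/\ restrict0 m != 0,
     (dM%:MP)%:F * ((deh (sub M N))%:F / (deh (sub M D))%:F) =
       n%:F / ('X_ord0 * m)%:F & rho = (restrict0 n)%:F / (restrict0 m)%:F])
  <-> rho = ((dM / beta)%:MP)%:F * ((deh (sub H a))%:F / (deh (sub H b))%:F).
Proof.
have X0 : 'X_ord0 != 0 :> {mpoly F[e.+1]} by rewrite -msize_poly_eq0 msizeX.
set A := deh (sub M a); set B := deh (sub M b).
have rA : restrict0 A = deh (sub H a) by rewrite restrict0_sub.
have rB : restrict0 B = deh (sub H b) by rewrite restrict0_sub.
have HB0 : deh (sub H b) != 0 by apply: (deh_neq0 (sub_homog _ hb)).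
have B0 : B != 0 by apply: (@morph_neq0 _ _ (@restrict0 e)); rewrite /= rB.
have b0 := facet_beta_neq0.
have XB0 : 'X_ord0 * B != 0 by rewrite mulf_neq0.
have bX0 : beta%:MP * ('X_ord0 * B) != 0 by rewrite mulf_neq0 ?mpolyC_eq0.
have sb : sub M b != 0.
  by apply: contraNneq B0 => h; rewrite /B h rmorph0.
have e1 : (deh (sub M N))%:F / (deh (sub M D))%:F =
    A%:F / (beta%:MP * ('X_ord0 * B))%:F.
  have eL : deh (sub M (linf w * b)) = beta%:MP * ('X_ord0 * B).
    by rewrite !rmorphM /= sub_chart_linf dehZ dehXS -scalerAl mul_mpolyC.
  have sD : sub M D != 0 by apply: sub_unit_neq0.
  have sL : sub M (linf w * b) != 0.
    by apply: sub_unit_neq0; rewrite mulf_neq0 ?linf_eq0 // (morph_neq0 Hb0).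
  have := @morph_frac _ _ (@deh F e.+1) (sub M N) (sub M D) (sub M a)
    (sub M (linf w * b)).
  rewrite /= eL; apply=> //; first exact: (deh_neq0 (sub_homog _ hD)).
  exact: (@morph_frac _ _ (sub M) N D a (linf w * b)).
have e2 : (dM%:MP)%:F * ((deh (sub M N))%:F / (deh (sub M D))%:F) =
    ((dM / beta)%:MP * A)%:F / ('X_ord0 * B)%:F.
  rewrite e1 mulrA -tofracM; apply: (proj2 (eq_tofrac _ _ _ _)) => //.
  by rewrite -{1}(divfK b0 dM) mpolyCM; ring.
rewrite e2 mulrA -tofracM; split=> [[n [m [m0 e3 ->]]]|->]; last first.
  exists ((dM / beta)%:MP * A), B; split; rewrite ?rB //.
  by rewrite restrict0M restrict0C rA.
have m0' : m != 0 by apply: (@morph_neq0 _ _ (@restrict0 e)).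
have Xm0 : 'X_ord0 * m != 0 by rewrite mulf_neq0.
apply: (proj2 (eq_tofrac _ _ _ _)) => //; rewrite -rA -rB -restrict0C -!restrict0M; congr restrict0.
have e4 := proj1 (eq_tofrac _ _ XB0 Xm0) e3.
by apply: (mulfI X0); rewrite mulrCA -e4; ring.
Qed.

End FacetChart.
End Charts.

(** * Signed simplicial cones *)

Section Dot.
Variables (R : realType) (n : nat).
Implicit Types u v w : 'rV[R]_n.

Lemma dotE u v : dot u v = (u *m v^T) 0 0.
Proof. by rewrite mxE; apply: eq_bigr => i _; rewrite mxE. Qed.

Lemma dotC u v : dot u v = dot v u.
Proof. by apply: eq_bigr => i _; rewrite mulrC. Qed.

Lemma dotDr u v w : dot u (v + w) = dot u v + dot u w.
Proof. by rewrite -big_split; apply: eq_bigr => i _; rewrite mxE mulrDr. Qed.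

Lemma dotZr c u v : dot u (c *: v) = c * dot u v.
Proof. by rewrite mulr_sumr; apply: eq_bigr => i _; rewrite mxE mulrCA. Qed.

Lemma dotDl u v w : dot (u + v) w = dot u w + dot v w.
Proof. by rewrite !(dotC _ w) dotDr. Qed.

Lemma dotZl c u v : dot (c *: u) v = c * dot u v.
Proof. by rewrite !(dotC _ v) dotZr. Qed.

Lemma dot0r u : dot u 0 = 0.
Proof. by rewrite -(scale0r 0) dotZr mul0r. Qed.

Lemma dot0l u : dot 0 u = 0. Proof. by rewrite dotC dot0r. Qed.

Lemma dotNr u v : dot u (- v) = - dot u v.
Proof. by rewrite -scaleN1r dotZr mulN1r. Qed.

Lemma dotNl u v : dot (- u) v = - dot u v.
Proof. by rewrite dotC dotNr dotC. Qed.

Lemma dot_suml (I : Type) (r : seq I) (P : pred I) (F : I -> 'rV[R]_n) v :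
  dot (\sum_(i <- r | P i) F i) v = \sum_(i <- r | P i) dot (F i) v.
Proof.
by apply: (big_morph (fun u => dot u v)) => [x y|]; rewrite ?dotDl ?dot0l.
Qed.

Lemma dot_sumr (I : Type) (r : seq I) (P : pred I) (F : I -> 'rV[R]_n) v :
  dot v (\sum_(i <- r | P i) F i) = \sum_(i <- r | P i) dot v (F i).
Proof. by rewrite dotC dot_suml; apply: eq_bigr => i _; rewrite dotC. Qed.

Lemma dot_self u : u != 0 -> 0 < dot u u.
Proof.
move=> /rV0Pn[i ui]; rewrite /dot (bigD1 i) //= ltr_wpDr //.
  by apply: sumr_ge0 => j _; rewrite -expr2 sqr_ge0.
by rewrite -expr2 exprn_even_gt0.
Qed.

End Dot.

Lemma dot_mulmx (R : realType) m n (u : 'rV[R]_n) (v : 'rV[R]_m) (H : 'M[R]_(m, n)) :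
  dot u (v *m H) = dot (u *m H^T) v.
Proof. by rewrite !dotE trmx_mul mulmxA. Qed.

(** * Lines meeting an orthant *)

Section Interval.
Variables (R : realType) (n : nat).
Implicit Types x c : 'I_n -> R.

Definition at_infty x c : bool :=
  [forall h, (0 < c h) || ((c h == 0) && (0 <= x h))].

(** At t = - x g / c g the g-th coordinate of x + t c vanishes; the condition says that the line
    meets the orthant there. *)
Definition crossing x c g : bool :=
  [forall h, (h != g) ==> (0 <= x h - x g / c g * c h)].

Lemma at_inftyP x c : exists t0, forall t, t0 <= t ->
  [forall h, 0 <= x h + t * c h] = at_infty x c.
Proof.
(* Beyond all the zeros of the coordinates their signs no longer change. *)
pose T := \sum_h `|x h / c h| + 1.
have Th h : `|x h / c h| < T.
  rewrite /T (bigD1 h) //= -addrA ltrDl ltr_wpDl //.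
  by apply: sumr_ge0.
exists T => t tT; have tp h : `|x h / c h| < t by apply: lt_le_trans tT.
apply/forallP/forallP => hh h; have := hh h; have := tp h.
  have [c0|c0|->] := ltgtP (c h) 0; rewrite ?mulr0 ?addr0 //=.
  move=> h1; rewrite leNgt => /negP; case.
  have : - (x h / c h) < t.
    by apply: le_lt_trans h1; rewrite -normrN; apply: ler_norm.
  by rewrite -mulNr ltr_ndivrMr // => h2; lra.
have [c0|c0|->] := ltgtP (c h) 0; rewrite ?mulr0 ?addr0 //=.
move=> h1 _; have : - (x h / c h) < t.
  by apply: le_lt_trans h1; rewrite -normrN; apply: ler_norm.
by rewrite -mulNr ltr_pdivrMr // => h2; lra.
Qed.

(** No two coordinates vanish at the same point of the line x + t c, and none vanishes on the whole
    line. *)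
Definition generic x c := (forall h, c h = 0 -> x h != 0) /\
  (forall g h, g != h -> c g != 0 -> c h != 0 -> x g * c h != x h * c g).

Let feasible x c := `[< exists t, forall h, 0 <= x h + t * c h >].

Let crossingE x c g : c g != 0 ->
  crossing x c g = [forall h, 0 <= x h + - x g / c g * c h].
Proof.
move=> c0; apply/forallP/forallP => hh h.
  have [->|hg] := eqVneq h g; first by rewrite divfK // addrN.
  by have := hh h; rewrite hg /= !mulNr.
by apply/implyP => _; have := hh h; rewrite !mulNr.
Qed.

(* The feasible t form an interval; a crossing with c g > 0 is its left end. *)
Let left_end x c : generic x c ->
  \sum_(g | 0 < c g) (crossing x c g)%:R =
    (feasible x c)%:R - (at_infty x (fun h => - c h))%:R :> R.
Proof.
move=> [gx gc]; have [[g0 cg0]|np] := pselect (exists g, 0 < c g).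
  have -> : at_infty x (fun h => - c h) = false.
    apply/negbTE/forallPn; exists g0; rewrite oppr_gt0 oppr_eq0.
    by rewrite ltNge (ltW cg0) (gt_eqF cg0).
  rewrite subr0; pose t g := - x g / c g.
  (* The largest zero of an increasing coordinate is the only candidate for a left end; by
     genericity it is attained once. *)
  have [g cg mg] := @arg_maxP _ _ _ g0 (fun g => 0 < c g) t cg0.
  have tg h : 0 < c h -> h != g -> t h < t g.
    move=> ch hg; have mh : t h <= t g by apply: mg.
    rewrite lt_neqAle mh andbT /t.
    rewrite eqr_div ?lt0r_neq0 // !mulNr eqr_opp.
    by apply: gc; rewrite ?lt0r_neq0 // eq_sym.
  rewrite (bigD1 g) //= big1 ?addr0 => [|h /andP[ch hg]]; last first.
    rewrite crossingE ?lt0r_neq0 //; apply/eqP; rewrite pnatr_eq0 eqb0.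
    apply/forallPn; exists g; rewrite -ltNge.
    have := tg h ch hg; rewrite /t => lt.
    have := lt; rewrite ltr_pdivlMr //; lra.
  congr (_%:R); congr nat_of_bool; rewrite crossingE ?lt0r_neq0 //.
  apply/forallP/asboolP => [h|[s hs] h]; first by exists (t g).
  have sg : t g <= s.
    by rewrite /t ler_pdivrMr //; have := hs g; lra.
  have [ch|ch|ch] := ltgtP (c h) 0.
  - have := hs h; rewrite -/(t g); nra.
  - have [->|hg] := eqVneq h g; first by rewrite divfK ?gt_eqF // addrN.
    have := tg h ch hg; rewrite {1}/t ltr_pdivrMr // -/(t g); lra.
  - by have := hs h; rewrite ch !mulr0.
rewrite big1 => [|g cg]; last by case: np; exists g.
have cn h : c h <= 0 by rewrite leNgt; apply/negP => ch; apply: np; exists h.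
apply/esym/eqP; rewrite subr_eq0; apply/eqP; congr (_%:R); congr nat_of_bool.
apply/asboolP/forallP => [[t ht] h|hh].
  have := ht h; rewrite oppr_gt0 oppr_eq0; have := cn h; rewrite le_eqVlt.
  by case/orP => [/eqP->|->//]; rewrite mulr0 addr0 eqxx => ->; rewrite orbT.
have [t0 ht] := at_inftyP x (fun h => - c h).
have /forallP h1 : [forall h, 0 <= x h + t0 * - c h].
  by rewrite ht //; apply/forallP.
by exists (- t0) => h; have := h1 h; rewrite mulrN mulNr.
Qed.

(** The part of the line in the orthant is an interval: its left end counts 1, its right end -1, and
    an end is missing exactly when the interval is unbounded on that side. Right ends are left ends
    of the reversed line. *)
Lemma crossing_sum x c : generic x c ->
  \sum_(g | c g != 0) Num.sg (c g) * (crossing x c g)%:R =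
  (at_infty x c)%:R - (at_infty x (fun h => - c h))%:R.
Proof.
move=> gxc; rewrite (bigID (fun g => 0 < c g)) /=.
have -> : \sum_(g | (c g != 0) && (0 < c g)) Num.sg (c g) * (crossing x c g)%:R =
    \sum_(g | 0 < c g) (crossing x c g)%:R.
  apply: eq_big => [g|g /andP[_ cg]]; last by rewrite gtr0_sg // mul1r.
  by case: ltgtP.
have -> : \sum_(g | (c g != 0) && ~~ (0 < c g)) Num.sg (c g) * (crossing x c g)%:R =
    - \sum_(g | 0 < - c g) (crossing x (fun h => - c h) g)%:R.
  rewrite -sumrN; apply: eq_big => [g|g /andP[c0 cg]].
    by rewrite oppr_gt0; case: ltgtP.
  rewrite ltr0_sg ?mulN1r; last by rewrite lt_neqAle c0 leNgt.
  congr (- _%:R); congr nat_of_bool; apply: eq_forallb => h.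
  by rewrite invrN !mulrN mulNr opprK.
rewrite !left_end //; last first.
  case: gxc => gx gc; split=> [h /eqP|g h gh]; rewrite ?oppr_eq0.
    by move/eqP/gx.
  by move=> cg ch; rewrite !mulrN eqr_opp; apply: gc.
have -> : feasible x (fun h => - c h) = feasible x c.
  by apply/asboolP/asboolP => -[t ht]; exists (- t) => h;
    have := ht h; rewrite mulrN mulNr ?opprK.
have -> : at_infty x (fun h => - - c h) = at_infty x c.
  by apply: eq_forallb => h; rewrite opprK.
lra.
Qed.

End Interval.

(** * Hyperplanes and quotients by a line *)

Section FacetCharts.
Variables (R : realType) (e : nat).
Implicit Types (w : 'rV[R]_e.+2) (M : 'M[R]_e.+2).

Lemma facet_chartE w M : facet_chart w M ->
  w *m M^T = dot w (row ix1 M) *: delta_mx 0 ix1.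
Proof.
move=> [_ h]; apply/rowP => i; rewrite !mxE eqxx /=.
have -> : \sum_j w 0 j * M^T j i = dot w (row i M).
  by apply: eq_bigr => j _; rewrite !mxE.
have [->|ne] := eqVneq i ix1; first by rewrite mulr1.
by rewrite h // mulr0.
Qed.

Lemma facet_chart_exists w : w != 0 -> exists M, facet_chart w M.
Proof.
move=> w0; pose E := row_ebase w; pose c := col_ebase w 0 0.
have uE : E \in unitmx by apply: row_ebase_unit.
have ew : w = c *: row ord0 E.
  rewrite -[LHS](mulmx_ebase w) rank_rV w0.
  apply/rowP => j; rewrite !mxE (bigD1 ord0) //= !mxE big_ord1 !mxE /=.
  rewrite mulr1 big1 ?addr0 // => i i0; rewrite !mxE big_ord1 !mxE /=.
  by rewrite eq_sym -val_eqE /= in i0; rewrite (negPf i0) mulr0 mul0r.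
(* The rows of [invmx E^T] are dual to those of E, and w is a multiple of the first row of E, so all
   but the first are orthogonal to w; the transposition puts that one at [ix1]. *)
pose M := row_perm (tperm ord0 ix1) (invmx E^T).
have uM : M \in unitmx.
  by rewrite /M row_permE unitmx_mul unitmx_perm unitmx_inv unitmx_tr uE.
exists M; split=> // i i1.
have -> : row i M = row (tperm ord0 ix1 i) (invmx E^T).
  by apply/rowP => j; rewrite !mxE.
have : dot w (row (tperm ord0 ix1 i) (invmx E^T)) =
    c * (E *m invmx E) 0 (tperm ord0 ix1 i).
  rewrite ew dotZl mxE; congr (c * _); apply: eq_bigr => j _.
  by rewrite -trmx_inv !mxE.
rewrite mulmxV // mxE => ->.
rewrite -(inj_eq (@perm_inj _ (tperm ord0 ix1))) tpermK tpermL.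
by rewrite eq_sym (negPf i1) mulr0.
Qed.

Section Lift.
Variables (w : 'rV[R]_e.+2) (M : 'M[R]_e.+2).
Hypotheses (w0 : w != 0) (wM : facet_chart w M).
Local Notation H := (hyp_mx M).
Local Notation beta := (dot w (row ix1 M)).

Lemma chart_beta_neq0 : beta != 0.
Proof. by case: (wM) => uM _; apply: (facet_beta_neq0 uM w0 (facet_chartE wM)). Qed.

Lemma chart_hyper : hyper w H.
Proof. by case: (wM) => uM _; apply: (facet_hyper uM w0 (facet_chartE wM)). Qed.

Lemma chart_ortho y : dot w (y *m H) = 0.
Proof. by rewrite dot_mulmx; case: chart_hyper => -> _; rewrite dot0l. Qed.

(** Together with [chart_ker], this makes x |-> x *m H^T the quotient map by the line of w; dually,
    y |-> y *m H parametrizes the hyperplane orthogonal to w. *)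
Lemma chart_lift (x : 'rV[R]_e.+1) : exists x' : 'rV[R]_e.+2, x' *m H^T = x.
Proof.
case: wM => uM _; have uMT : M^T \in unitmx by rewrite unitmx_tr.
pose z : 'rV[R]_e.+2 := \row_j (if unlift ix1 j is Some k then x 0 k else 0).
exists (z *m invmx M^T).
apply/rowP => i; have -> : (z *m invmx M^T *m H^T) 0 i =
    (z *m invmx M^T *m M^T) 0 (lift ix1 i).
  by rewrite !mxE; apply: eq_bigr => j _; rewrite !mxE.
by rewrite mulmxKV // mxE liftK.
Qed.

Lemma chart_ker (x : 'rV[R]_e.+2) : x *m H^T = 0 -> exists s, x = s *: w.
Proof.
case: (wM) => uM _ hx; have uMT : M^T \in unitmx by rewrite unitmx_tr.
pose s := (x *m M^T) 0 ix1 / beta; exists s.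
rewrite -[x](mulmxK uMT) -[w in RHS](mulmxK uMT) scalemxAl; congr (_ *m _).
rewrite (facet_chartE wM) scalerA divfK ?chart_beta_neq0 //.
apply/rowP => i; rewrite [RHS]mxE [delta_mx _ _ _ _]mxE eqxx /=.
case: (unliftP ix1 i) => [k ->|->]; last by rewrite eqxx mulr1.
rewrite eq_sym (negPf (neq_lift _ _)) mulr0.
have := congr1 (fun A : 'rV_e.+1 => A 0 k) hx; rewrite [RHS]mxE => hk.
by rewrite -[RHS]hk !mxE; apply: eq_bigr => j _; rewrite !mxE.
Qed.

Lemma chart_rowspace u : dot w u = 0 -> exists y, u = y *m H.
Proof.
case: (wM) => uM _ hu; exists (col' ix1 (u *m invmx M)).
have e0 : (u *m invmx M) 0 ix1 = 0.
  have : dot w (u *m invmx M *m M) = 0 by rewrite mulmxKV.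
  rewrite dot_mulmx (facet_chartE wM) dotZl.
  move/eqP; rewrite mulf_eq0 (negPf chart_beta_neq0) /= => /eqP.
  rewrite /dot (bigD1 ix1) //= [delta_mx _ _ _ _]mxE !eqxx mul1r big1 ?addr0 //.
  by move=> i i1; rewrite [delta_mx _ _ _ _]mxE (negPf i1) andbF mul0r.
rewrite -[LHS](mulmxKV uM); apply/rowP => j; rewrite !mxE (bigD1_ord ix1) //=.
by rewrite e0 mul0r add0r; apply: eq_bigr => k _; rewrite !mxE.
Qed.

Lemma chart_inj (y : 'rV[R]_e.+1) : y *m H = 0 -> y = 0.
Proof.
case: (wM) => uM _ hy.
pose z : 'rV[R]_e.+2 := \row_j (if unlift ix1 j is Some k then y 0 k else 0).
have : z *m M = 0.
  rewrite -hy; apply/rowP => j; rewrite !mxE (bigD1_ord ix1) //= mxE unlift_none.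
  by rewrite mul0r add0r; apply: eq_bigr => k _; rewrite !mxE liftK.
move/(congr1 (fun A => A *m invmx M)); rewrite mulmxK // mul0mx => z0.
apply/rowP => k; have := congr1 (fun A : 'rV_e.+2 => A 0 (lift ix1 k)) z0.
by rewrite !mxE liftK.
Qed.

End Lift.

End FacetCharts.

(** * Simplicial cells and their links *)

Section Cells.
Variables (R : realType).

Definition ind n (F : 'M[R]_n) (x : 'rV[R]_n) : bool :=
  [forall h, 0 <= (x *m invmx F) 0 h].

Definition gen n (L : seq 'rV[R]_n) (x : 'rV[R]_n) : Prop :=
  forall l, l \in L -> dot l x != 0.

(** A hyperplane not parallel to w meets the line once, so large t avoid it; one that is parallel to
    w only has to miss x. *)
Lemma gen_line n (L : seq 'rV[R]_n) x w :
  (forall l, l \in L -> dot l w = 0 -> dot l x != 0) ->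
  exists t0, forall t, t0 <= `|t| -> gen L (x + t *: w).
Proof.
elim: L => [|l L IH] h; first by exists 0.
have [|t0 ht0] := IH; first by move=> k kL; apply: h; rewrite inE kL orbT.
have hl := h l (mem_head _ _).
pose t1 := `|dot l x / dot l w| + 1.
exists (Num.max t0 t1) => t; rewrite ge_max => /andP[h0 h1] k.
rewrite inE => /orP[/eqP->|]; last exact: ht0.
rewrite dotDr dotZr; have [lw|lw] := eqVneq (dot l w) 0.
  by rewrite lw mulr0 addr0 hl.
apply: contraTneq h1 => h2; rewrite -ltNge /t1.
have -> : t = - (dot l x / dot l w).
  apply: (mulIf lw); rewrite mulNr divfK //.
  by apply/eqP; rewrite -addr_eq0 addrC h2 eqxx.
by rewrite normrN ltrDl.
Qed.

Section Link.
Variables (e : nat) (F : 'M[R]_e.+2) (w : 'rV[R]_e.+2) (M : 'M[R]_e.+2).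
Hypotheses (uF : F \in unitmx) (w0 : w != 0) (wM : facet_chart w M).
Local Notation H := (hyp_mx M).
Local Notation beta := (dot w (row ix1 M)).

(** The facet of the cell opposite to the generator g, seen in the quotient of R^(e+2) by w. *)
Definition link (g : 'I_e.+2) : 'M[R]_e.+1 := row' g F *m H^T.

Definition cellcoord (x : 'rV[R]_e.+2) (h : 'I_e.+2) : R := (x *m invmx F) 0 h.
Local Notation c := (cellcoord w).

Lemma cellcoordE x : x = \sum_h cellcoord x h *: row h F.
Proof. by rewrite -[LHS](mulmxKV uF) mulmx_sum_row. Qed.

(** Row g of F is replaced by w, and the determinant of the result times [M^T] is computed twice: as
    a product of determinants, and by expansion along row g, which in the chart is beta times a unit
    vector. *)
Lemma det_link g : `|\det (link g)| * `|beta| = `|c g| * `|\det F| * `|\det M|.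
Proof.
pose F' := \matrix_(h < e.+2) (if h == g then w else row h F).
have dF' : \det F' = c g * \det F.
  pose E := \matrix_(h < e.+2) (if h == g then w *m invmx F else row h 1%:M).
  have -> : F' = E *m F.
    apply/row_matrixP => h; rewrite row_mul !rowK.
    by case: eqP => _; rewrite ?mulmxKV // -row_mul mul1mx.
  rewrite det_mulmx; congr (_ * _).
  rewrite (expand_det_col _ g) (bigD1 g) //= big1 ?addr0 => [|h hg]; last first.
    by rewrite !mxE (negPf hg) !mxE (negPf hg) mul0r.
  rewrite !mxE eqxx /cofactor addnn -signr_odd odd_double expr0 mul1r.
  have -> : row' g (col' g E) = 1%:M.
    apply/matrixP => i j; rewrite !mxE eq_sym (negPf (neq_lift _ _)) !mxE.
    by rewrite (inj_eq lift_inj).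
  by rewrite det1 mulr1.
have : \det (F' *m M^T) = c g * \det F * \det M.
  by rewrite det_mulmx det_tr dF'.
rewrite (expand_det_row _ g) (bigD1 ix1) //= big1 ?addr0 => [|j j1]; last first.
  have -> : (F' *m M^T) g j = (w *m M^T) 0 j.
    by rewrite !mxE; apply: eq_bigr => k _; rewrite !mxE eqxx.
  by rewrite (facet_chartE wM) !mxE (negPf j1) andbF mulr0 mul0r.
have -> : (F' *m M^T) g ix1 = beta.
  have -> : (F' *m M^T) g ix1 = (w *m M^T) 0 ix1.
    by rewrite !mxE; apply: eq_bigr => k _; rewrite !mxE eqxx.
  by rewrite (facet_chartE wM) !mxE !eqxx mulr1.
rewrite /cofactor; have -> : row' g (col' ix1 (F' *m M^T)) = link g.
  apply/matrixP => i j; rewrite !mxE; apply: eq_bigr => k _.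
  by rewrite !mxE eq_sym (negPf (neq_lift _ _)) !mxE.
move/(congr1 Num.norm); rewrite !normrM normrX normrN1 expr1n mul1r => <-.
by rewrite mulrC.
Qed.

Lemma det_link_neq0 g : c g != 0 -> link g \in unitmx.
Proof.
move=> cg; rewrite unitmxE unitfE -normr_eq0.
have b0 : `|beta| != 0 by rewrite normr_eq0 (chart_beta_neq0 w0 wM).
rewrite -(inj_eq (mulIf b0)) mul0r det_link !mulf_eq0 !normr_eq0 (negPf cg) /=.
case: wM => uM _; move: uF uM; rewrite !unitmxE !unitfE.
by move=> /negPf-> /negPf->.
Qed.

(** Subtracting from x the multiple of w that kills its g-th coordinate does not change the class
    modulo w; the remaining coordinates are those in the link. *)
Lemma ind_link g x : c g != 0 ->
  ind (link g) (x *m H^T) = crossing (cellcoord x) c g.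
Proof.
move=> cg; have ul := det_link_neq0 cg.
pose y := \row_k (cellcoord x (lift g k) - cellcoord x g / c g * c (lift g k)).
have ey : x *m H^T = y *m link g.
  rewrite /link mulmxA; apply/eqP; rewrite -subr_eq0 -mulmxBl; apply/eqP.
  have -> : x - y *m row' g F = (cellcoord x g / c g) *: w.
    have split_g u : u = cellcoord u g *: row g F +
        \sum_k cellcoord u (lift g k) *: row (lift g k) F.
      by rewrite {1}(cellcoordE u) (bigD1_ord g).
    have -> : y *m row' g F = \sum_k (cellcoord x (lift g k) -
        cellcoord x g / c g * c (lift g k)) *: row (lift g k) F.
      rewrite mulmx_sum_row; apply: eq_bigr => k _; rewrite mxE; congr (_ *: _).
      by apply/rowP => j; rewrite !mxE.
    have hs : cellcoord x g / c g * c g = cellcoord x g by rewrite divfK.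
    move: (cellcoord x g / c g) hs => s hs.
    apply/eqP; rewrite subr_eq; apply/eqP.
    have -> : s *: w = cellcoord x g *: row g F +
        s *: \sum_k c (lift g k) *: row (lift g k) F.
      by rewrite [in LHS](split_g w) scalerDr scalerA hs.
    rewrite [LHS]split_g -addrA.
    congr (_ + _); rewrite scaler_sumr -big_split; apply: eq_bigr => k _.
    by rewrite /= scalerA -scalerDl addrC subrK.
  by rewrite -scalemxAl; case: (chart_hyper w0 wM) => -> _; rewrite scaler0.
rewrite /ind ey mulmxK //; apply/forallP/forallP => h k.
  apply/implyP; case: (unliftP g k) => [j ->|->]; last by rewrite eqxx.
  by move=> _; have := h j; rewrite mxE.
have := h (lift g k); rewrite mxE eq_sym neq_lift; exact.
Qed.

Lemma ind_infty x : exists t0, forall t, t0 <= t ->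
  ind F (x + t *: w) = at_infty (cellcoord x) c.
Proof.
have [t0 ht] := at_inftyP (cellcoord x) c; exists t0 => t /ht <-.
by apply: eq_forallb => h; rewrite /cellcoord mulmxDl -scalemxAl !mxE.
Qed.

Lemma ind_minfty x : exists t0, forall t, t0 <= t ->
  ind F (x - t *: w) = at_infty (cellcoord x) (fun h => - c h).
Proof.
have [t0 ht] := at_inftyP (cellcoord x) (fun h => - c h); exists t0 => t /ht <-.
apply: eq_forallb => h.
by rewrite /cellcoord mulmxBl -scalemxAl !mxE mulrN.
Qed.

End Link.
End Cells.

(** * Multiplicities of signed cells and of their links *)

Section SignedCells.
Variable R : realType.

Definition count_at n (cells : seq (R * 'M[R]_n)) (x : 'rV[R]_n) : R :=
  \sum_(p <- cells) p.1 * (ind p.2 x)%:R.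

(** The sign is 1 if a line in direction w enters the half-space of the facet opposite to g, and -1
    if it leaves it. Facets parallel to w, where the coordinate is 0, have no link. *)
Definition links e (w : 'rV[R]_e.+2) (M : 'M[R]_e.+2)
    (cells : seq (R * 'M[R]_e.+2)) : seq (R * 'M[R]_e.+1) :=
  [seq (p.1 * Num.sg (cellcoord p.2 w g), link p.2 M g) |
     p <- cells, g <- [seq g <- enum 'I_e.+2 | cellcoord p.2 w g != 0]].

Lemma big_links (A : nmodType) e w M (cells : seq (R * 'M[R]_e.+2)) (f : R * 'M[R]_e.+1 -> A) :
  \sum_(q <- links w M cells) f q = \sum_(p <- cells)
    \sum_(g | cellcoord p.2 w g != 0) f (p.1 * Num.sg (cellcoord p.2 w g), link p.2 M g).
Proof.
rewrite /links big_allpairs_dep; apply: eq_bigr => p _.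
by rewrite big_filter big_enum_cond.
Qed.

Section LinkCount.
Variables (e : nat) (w : 'rV[R]_e.+2) (M : 'M[R]_e.+2).
Hypotheses (w0 : w != 0) (wM : facet_chart w M).
Local Notation H := (hyp_mx M).

(** Only the hyperplanes parallel to w constrain a whole line in direction w, and these come from
    the quotient. The others are avoided far out on the line, by [gen_line]. *)
Lemma descend (L : seq 'rV[R]_e.+2) : exists L' : seq 'rV[R]_e.+1,
  (forall l, l \in L' -> l != 0) /\
  forall x, gen L' (x *m H^T) ->
    forall l, l \in L -> l != 0 -> dot l w = 0 -> dot l x != 0.
Proof.
elim: L => [|l L [L' [L'0 hL']]]; first by exists [::].
have [[l0 lw]|nl] := pselect (l != 0 /\ dot l w = 0); last first.
  exists L'; split=> // x gx k; rewrite inE => /orP[/eqP->|].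
    by move=> l0 lw; case: nl.
  exact: hL'.
have [y ey] := chart_rowspace w0 wM (etrans (dotC _ _) lw).
exists (y :: L'); split=> [k|x gx k].
  rewrite inE => /orP[/eqP->|]; last exact: L'0.
  by apply: contraNneq l0 => y0; rewrite ey y0 mul0mx.
rewrite inE => /orP[/eqP-> _ _|].
  by rewrite ey dotC dot_mulmx dotC; apply: gx; rewrite mem_head.
by apply: hL' => j jL'; apply: gx; rewrite inE jL' orbT.
Qed.

Lemma link_unit F g : F \in unitmx -> cellcoord F w g != 0 ->
  link F M g \in unitmx.
Proof. by move=> uF; apply: det_link_neq0. Qed.

Definition facet_form (F : 'M[R]_e.+2) h : 'rV[R]_e.+2 := (col h (invmx F))^T.

Lemma facet_formE F h x : dot (facet_form F h) x = cellcoord F x h.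
Proof.
by rewrite /cellcoord !mxE dotC; apply: eq_bigr => i _; rewrite !mxE.
Qed.

Lemma cellcoord_row (F : 'M[R]_e.+2) g h : F \in unitmx -> cellcoord F (row g F) h = (g == h)%:R.
Proof. by move=> uF; rewrite /cellcoord -row_mul mulmxV // !mxE. Qed.

(** The forms of the second family vanish at w, so they descend to the quotient; they detect two
    coordinates with a common zero on a line in direction w. *)
Definition cell_forms (F : 'M[R]_e.+2) : seq 'rV[R]_e.+2 :=
  [seq facet_form F h | h <- enum 'I_e.+2] ++
  [seq cellcoord F w h *: facet_form F g - cellcoord F w g *: facet_form F h |
     g <- enum 'I_e.+2, h <- enum 'I_e.+2].

Lemma cell_forms_generic F x : F \in unitmx ->
  (forall l, l \in cell_forms F -> l != 0 -> dot l w = 0 -> dot l x != 0) ->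
  generic (cellcoord F x) (cellcoord F w).
Proof.
move=> uF hx; split=> [h ch|g h gh cg ch].
  rewrite -facet_formE; apply: hx; rewrite ?facet_formE //.
    by rewrite mem_cat; apply/orP; left; apply: map_f; rewrite mem_enum.
  have := cellcoord_row h h uF; rewrite -facet_formE eqxx.
  by apply: contra_eq_neq => ->; rewrite dot0l eq_sym oner_eq0.
rewrite -subr_eq0 mulrC [cellcoord F x h * _]mulrC -!facet_formE -!dotZl.
rewrite -dotNl -dotDl !facet_formE; apply: hx.
- rewrite mem_cat; apply/orP; right; apply/allpairsP; exists (g, h) => /=.
  by rewrite !mem_enum.
- have : dot (cellcoord F w h *: facet_form F g -
      cellcoord F w g *: facet_form F h) (row g F) = cellcoord F w h.
    rewrite dotDl dotNl !dotZl !facet_formE !cellcoord_row // eqxx (negPf gh).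
    by rewrite mulr1 mulr0 subr0.
  by apply: contra_eq_neq => ->; rewrite dot0l eq_sym.
- by rewrite dotDl dotNl !dotZl !facet_formE mulrC subrr.
Qed.

Lemma crossing_count F x : F \in unitmx ->
  generic (cellcoord F x) (cellcoord F w) ->
  exists t0, forall t, t0 <= t ->
  \sum_(g | cellcoord F w g != 0)
     Num.sg (cellcoord F w g) * (ind (link F M g) (x *m H^T))%:R =
  (ind F (x + t *: w))%:R - (ind F (x - t *: w))%:R.
Proof.
move=> uF gx; have [t0 h0] := ind_infty F w x; have [t1 h1] := ind_minfty F w x.
exists (Num.max t0 t1) => t; rewrite ge_max => /andP[/h0-> /h1->].
rewrite -crossing_sum //; apply: eq_bigr => g cg; congr (_ * _%:R).
by congr nat_of_bool; apply: ind_link.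
Qed.

(** [crossing_count] summed over the cells. The list L' depends only on w, M, the cells and L,
    whereas how far out the two ends must be taken depends on x. *)
Lemma links_count (cells : seq (R * 'M[R]_e.+2)) (L : seq 'rV[R]_e.+2) :
  (forall p, p \in cells -> p.2 \in unitmx) -> (forall l, l \in L -> l != 0) ->
  exists L' : seq 'rV[R]_e.+1, (forall l, l \in L' -> l != 0) /\
    forall x, gen L' (x *m H^T) -> exists t0, forall t, t0 <= t ->
      [/\ gen L (x + t *: w), gen L (x - t *: w) &
        count_at (links w M cells) (x *m H^T) =
        count_at cells (x + t *: w) - count_at cells (x - t *: w)].
Proof.
move=> uc L0.
have [L' [L'0 hL']] := descend (L ++ flatten [seq cell_forms p.2 | p <- cells]).
exists L'; split=> // x gx; have {}hx := hL' x gx.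
have [|t0 ht0] := @gen_line _ _ L x w.
  by move=> l lL lw; apply: hx => //; rewrite ?L0 // mem_cat lL.
have [t1 ht1] : exists t1, forall t, t1 <= t ->
    count_at (links w M cells) (x *m H^T) =
    count_at cells (x + t *: w) - count_at cells (x - t *: w).
  rewrite /count_at big_links.
  have {}hx p : p \in cells -> generic (cellcoord p.2 x) (cellcoord p.2 w).
    move=> pc; apply: cell_forms_generic; first exact: uc.
    move=> l lp; apply: hx; rewrite mem_cat; apply/orP; right.
    by apply/flattenP; exists (cell_forms p.2) => //; apply/mapP; exists p.
  elim: cells uc hx {hL'} => [|p cells IH] uc hx.
    by exists 0 => t _; rewrite !big_nil subr0.
  have [t1 ht1] := crossing_count (uc p (mem_head _ _)) (hx p (mem_head _ _)).
  have [||t2 ht2] := IH.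
  - by move=> q qc; apply: uc; rewrite inE qc orbT.
  - by move=> q qc; apply: hx; rewrite inE qc orbT.
  exists (Num.max t1 t2) => t; rewrite ge_max => /andP[/ht1 e1 /ht2 e2].
  rewrite !big_cons {}e2 /=.
  have -> : \sum_(g | cellcoord p.2 w g != 0) p.1 * Num.sg (cellcoord p.2 w g) *
      (ind (link p.2 M g) (x *m H^T))%:R =
      p.1 * ((ind p.2 (x + t *: w))%:R - (ind p.2 (x - t *: w))%:R).
    by rewrite -e1 mulr_sumr; apply: eq_bigr => g _; rewrite mulrA.
  by ring.
exists (Num.max 0 (Num.max t0 t1)) => t; rewrite !ge_max => /and3P[tp h0 h1].
split; last exact: ht1.
  by apply: ht0; rewrite ger0_norm.
by rewrite -scaleNr; apply: ht0; rewrite normrN ger0_norm.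
Qed.

End LinkCount.
End SignedCells.

(** * Dual volumes and their residues *)

Section DualVolume.
Variables (R : realType) (K : fieldType) (iota : {rmorphism R -> K}).

Definition lin n (w : 'rV[R]_n) : {mpoly K[n]} := linf (map_mx iota w).

Definition cst n (x : R) : {fraction {mpoly K[n]}} := ((iota x)%:MP)%:F.

(* \int_D exp(- <w, z>) dw, for the cone D generated by the rows of F. *)
Definition Phi n (F : 'M[R]_n) : {fraction {mpoly K[n]}} :=
  cst n `|\det F| / (\prod_i lin (row i F))%:F.

Lemma lin_eq0 n (w : 'rV[R]_n) : (lin w == 0) = (w == 0).
Proof. by rewrite /lin linf_eq0 map_mx_eq0. Qed.

Lemma lin_sum n (I : Type) (r : seq I) (P : pred I) (a : I -> R)
    (u : I -> 'rV[R]_n) :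
  lin (\sum_(i <- r | P i) a i *: u i) =
  \sum_(i <- r | P i) (iota (a i))%:MP * lin (u i).
Proof.
rewrite /lin raddf_sum linf_sum; apply: eq_bigr => i _.
by rewrite mul_mpolyC -linfZ /= map_mxZ.
Qed.

Lemma sub_lin m n (H : 'M[R]_(m, n)) (w : 'rV[R]_n) :
  sub (map_mx iota H) (lin w) = lin (w *m H^T).
Proof. by rewrite /lin sub_linf map_mxM map_trmx. Qed.

Lemma cstM n x y : cst n (x * y) = cst n x * cst n y.
Proof. by rewrite /cst rmorphM mpolyCM tofracM. Qed.

Lemma cstD n x y : cst n (x + y) = cst n x + cst n y.
Proof. by rewrite /cst rmorphD mpolyCD tofracD. Qed.

Lemma cst0 n : cst n 0 = 0.
Proof. by rewrite /cst rmorph0 mpolyC0 tofrac0. Qed.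

Lemma cst1 n : cst n 1 = 1.
Proof. by rewrite /cst rmorph1 mpolyC1 tofrac1. Qed.

Lemma cst_eq0 n x : (cst n x == 0) = (x == 0).
Proof. by rewrite tofrac_eq0 mpolyC_eq0 fmorph_eq0. Qed.

Lemma unitmx_row_neq0 n (F : 'M[R]_n) i : F \in unitmx -> row i F != 0.
Proof.
move=> uF; apply/negP => /eqP h.
have : row i (1%:M : 'M[R]_n) = 0 by rewrite -(mulmxV uF) row_mul h mul0mx.
move/(congr1 (fun A : 'rV_n => A 0 i)); rewrite !mxE eqxx => /eqP.
by rewrite oner_eq0.
Qed.

Lemma prod_lin_neq0 n (F : 'M[R]_n) : F \in unitmx -> \prod_i lin (row i F) != 0.
Proof.
move=> uF; apply/prodf_neq0 => i _; by rewrite lin_eq0 unitmx_row_neq0.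
Qed.

Let frac_split (E : fieldType) (a d x q : E) : x != 0 ->
  (a * x) * (d / (x * q)) = (a * d) / q.
Proof.
move=> x0; rewrite invfM.
have -> : a * x * (d * (x^-1 * q^-1)) = (a * d * q^-1) * (x * x^-1) by ring.
by rewrite mulfV // mulr1.
Qed.

Let reorder (E : comPzRingType) (s a b x : E) :
  s * (a * b * x) = a * (b * s * x).
Proof. ring. Qed.

Section Residue.
Variables (e : nat) (w : 'rV[R]_e.+2) (M : 'M[R]_e.+2).
Hypotheses (w0 : w != 0) (wM : facet_chart w M).
Local Notation H := (hyp_mx M).
Local Notation scale := (`|dot w (row ix1 M)| / `|\det M|).

(** Since w is the combination of the rows with coefficients [cellcoord F w g], multiplication by
    [lin w] cancels one row from the denominator in each term, and the other rows restrict to those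
    of the link; [det_link] matches the constants. Terms with coefficient 0 are gone, so no
    denominator vanishes. *)
Lemma Phi_residue F : F \in unitmx ->
  val_at (sub (map_mx iota H)) ((lin w)%:F * Phi F)
    (\sum_(g | cellcoord F w g != 0)
       cst _ (Num.sg (cellcoord F w g) * scale) * Phi (link F M g)).
Proof.
move=> uF; set c := cellcoord F w.
have -> : (lin w)%:F * Phi F = \sum_(g | c g != 0)
    ((iota (c g * `|\det F|))%:MP)%:F / (\prod_k lin (row (lift g k) F))%:F.
  rewrite {1}(cellcoordE uF w) lin_sum raddf_sum mulr_suml.
  rewrite (bigID (fun g => c g != 0)) /= [X in _ + X]big1 ?addr0 => [|g]; last first.
    by rewrite negbK => /eqP cg; rewrite -/(c g) cg rmorph0 mpolyC0 mul0r tofrac0 mul0r.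
  apply: eq_bigr => g cg; rewrite /Phi (bigD1_ord g) //= !tofracM.
  by rewrite frac_split ?tofrac_eq0 ?lin_eq0 ?unitmx_row_neq0 // -/(cst _ _) -cstM.
apply: val_at_sum => g cg; have ul := link_unit w0 wM uF cg.
have eb : sub (map_mx iota H) (\prod_k lin (row (lift g k) F)) =
    \prod_k lin (row k (link F M g)).
  rewrite rmorph_prod; apply: eq_bigr => k _ /=; rewrite sub_lin.
  by rewrite row_mul; congr (lin (_ *m _)); apply/rowP => j; rewrite !mxE.
have := val_at_frac (phi := sub (map_mx iota H)) (iota (c g * `|\det F|))%:MP
  (b := \prod_k lin (row (lift g k) F)).
rewrite /= eb subC => /(_ (prod_lin_neq0 ul)).
suff -> : cst _ (Num.sg (c g) * scale) * Phi (link F M g) =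
  ((iota (c g * `|\det F|))%:MP)%:F / (\prod_k lin (row k (link F M g)))%:F by [].
rewrite /Phi mulrA -cstM; congr (cst _ _ / _).
have m0 : `|\det M| != 0.
  by case: wM => uM _; rewrite normr_eq0 -unitfE -unitmxE.
rewrite [c g in RHS]numEsg; apply: (mulIf m0).
transitivity (Num.sg (c g) * (`|\det (link F M g)| * `|dot w (row ix1 M)|)).
  by rewrite -[in RHS](divfK m0 `|dot w _|); ring.
by rewrite (det_link uF wM); ring.
Qed.

Definition vol n (cells : seq (R * 'M[R]_n)) : {fraction {mpoly K[n]}} :=
  \sum_(p <- cells) cst n p.1 * Phi p.2.

Lemma vol_residue (cells : seq (R * 'M[R]_e.+2)) :
  (forall p, p \in cells -> p.2 \in unitmx) ->
  val_at (sub (map_mx iota H)) ((lin w)%:F * vol cells)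
    (cst _ scale * vol (links w M cells)).
Proof.
move=> uc; rewrite /vol big_links !mulr_sumr big_seq [X in val_at _ _ X]big_seq.
apply: val_at_sum => p pc; rewrite mulrCA.
have -> : cst e.+1 scale * \sum_(g | cellcoord p.2 w g != 0)
    cst e.+1 (p.1 * Num.sg (cellcoord p.2 w g)) * Phi (link p.2 M g) =
  cst e.+1 p.1 * \sum_(g | cellcoord p.2 w g != 0)
       cst _ (Num.sg (cellcoord p.2 w g) * scale) * Phi (link p.2 M g).
  rewrite !mulr_sumr; apply: eq_bigr => g _.
  by rewrite (cstM _ p.1) (cstM _ (Num.sg _)); apply: reorder.
apply: val_atM; last exact/Phi_residue/uc.
by have := val_at_tofrac (sub (map_mx iota H)) (iota p.1)%:MP; rewrite /= subC.
Qed.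

End Residue.
End DualVolume.

Lemma hyper_map (R K : fieldType) (iota : {rmorphism R -> K}) m n
    (w : 'rV[R]_n) (H : 'M[R]_(m, n)) :
  hyper w H -> hyper (map_mx iota w) (map_mx iota H).
Proof.
move=> [e1 [Y [b e2]]]; split; first by rewrite map_trmx -map_mxM e1 map_mx0.
exists (map_mx iota Y), (map_mx iota b).
by rewrite map_trmx -!map_mxM -map_mxD -e2 map_mx1.
Qed.

(** * Vanishing of the volume of translation invariant cells *)

Section Lines.
Variables (R : realType) (K : fieldType) (iota : {rmorphism R -> K}).
Local Notation lin := (lin iota).
Local Notation cst := (cst iota).
Local Notation Phi := (Phi iota).
Local Notation vol := (vol iota).

Definition cell_rows n (cells : seq (R * 'M[R]_n)) : seq 'rV[K]_n :=
  flatten [seq [seq map_mx iota (row i p.2) | i <- enum 'I_n] | p <- cells].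

Lemma size_cell_rows n (cells : seq (R * 'M[R]_n)) :
  size (cell_rows cells) = (size cells * n)%N.
Proof.
elim: cells => //= p cells IH.
by rewrite /cell_rows /= size_cat size_map size_enum_ord -/(cell_rows _) IH mulSn.
Qed.

Lemma cell_rowsP n (cells : seq (R * 'M[R]_n)) w : w \in cell_rows cells ->
  exists p i, p \in cells /\ w = map_mx iota (row i p.2).
Proof. by case/flatten_mapP => p pc /mapP[i _ ->]; exists p, i. Qed.

Lemma prod_cell_rows n (F : 'M[R]_n) m :
  \prod_(w <- cell_rows [:: (m, F)]) linf w = \prod_i lin (row i F).
Proof. by rewrite /cell_rows /= cats0 big_map big_enum. Qed.

Lemma cell_rows_neq0 n (cells : seq (R * 'M[R]_n)) :
  (forall p, p \in cells -> p.2 \in unitmx) ->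
  all (fun w => w != 0) (cell_rows cells).
Proof.
move=> uc; apply/allP => w /cell_rowsP[p [i [pc ->]]].
by rewrite map_mx_eq0; apply/unitmx_row_neq0/uc.
Qed.

(** Over the common denominator the volume has degree - n. One cell is singled out so that the
    degree of the numerator, n times the number of the other cells, is a natural number. *)
Lemma vol_repr n p (cells : seq (R * 'M[R]_n)) :
  (forall q, q \in p :: cells -> q.2 \in unitmx) ->
  exists N, N \is (size cells * n).-homog /\
    vol (p :: cells) = N%:F / (\prod_(w <- cell_rows (p :: cells)) linf w)%:F.
Proof.
elim: cells p => [|q cells IH] p uc.
  exists (iota (p.1 * `|\det p.2|))%:MP; split.
    by rewrite mul0n -alg_mpolyC; apply: dhomogZ; apply: dhomog1.
  rewrite /vol big_seq1; case: p {uc} => m F /=; rewrite prod_cell_rows.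
  by rewrite /Phi mulrA -cstM.
have [|N [hN eN]] := IH q.
  by move=> r rc; apply: uc; rewrite inE rc orbT.
have up : p.2 \in unitmx by apply: uc; rewrite mem_head.
have nz0 : \prod_(w <- cell_rows (q :: cells)) linf w != 0.
  apply/prod_linf_neq0/cell_rows_neq0 => r rc.
  by apply: uc; rewrite inE rc orbT.
have nz1 : \prod_i lin (row i p.2) != 0 by apply: prod_lin_neq0.
have er : cell_rows (p :: q :: cells) =
    cell_rows [:: p] ++ cell_rows (q :: cells).
  by rewrite /cell_rows /= cats0.
exists ((iota (p.1 * `|\det p.2|))%:MP * \prod_(w <- cell_rows (q :: cells)) linf w
  + N * \prod_i lin (row i p.2)); split.
  apply: rpredD; last first.
    rewrite /= mulSn addnC; apply: dhomogM hN _.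
    have := prod_linf_homog (cell_rows [:: p]).
    rewrite size_cell_rows mul1n; case: p {uc up nz1 er} => m F.
    by rewrite prod_cell_rows.
  rewrite mul_mpolyC; apply: dhomogZ.
  by have := prod_linf_homog (cell_rows (q :: cells)); rewrite size_cell_rows.
have -> : vol (p :: q :: cells) = cst n p.1 * Phi p.2 + vol (q :: cells).
  by rewrite /vol big_cons.
rewrite {}eN er; move: (cell_rows (q :: cells)) nz0 => s nz0.
rewrite big_cat /=; case: p {uc er} up nz1 => m F up nz1.
rewrite prod_cell_rows /Phi mulrA -cstM.
by rewrite addf_div ?tofrac_eq0 // tofracD !tofracM.
Qed.

Lemma val_regular m n (w : 'rV[R]_n) (H : 'M[R]_(m, n)) f :
  w != 0 -> hyper w H -> val_at (sub (map_mx iota H)) ((lin w)%:F * f) 0 ->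
  regular (lin w) f.
Proof.
move=> w0 wH; have wH' := hyper_map iota wH; apply: regular_val0.
- by rewrite lin_eq0.
- exact: sub_hyper.
- exact: sub_ker.
Qed.

Definition transl_inv n (cells : seq (R * 'M[R]_n)) (v : 'rV[R]_n) : Prop :=
  exists L, (forall l, l \in L -> l != 0) /\ forall x s,
    gen L x -> gen L (x + s *: v) ->
    count_at cells x = count_at cells (x + s *: v).

(** If v is not parallel to w, its image in the quotient works. Otherwise the multiplicities at the
    two ends of a line in direction w agree, so the links have multiplicity 0 and any nonzero vector
    works. *)
Lemma links_transl_inv e (w v : 'rV[R]_e.+2) M (cells : seq (R * 'M[R]_e.+2)) :
  w != 0 -> facet_chart w M -> v != 0 ->
  (forall p, p \in cells -> p.2 \in unitmx) -> transl_inv cells v ->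
  exists v', v' != 0 /\ transl_inv (links w M cells) v'.
Proof.
move=> w0 wM v0 uc [L [L0 hL]].
have [L' [L'0 hL']] := links_count w0 wM uc L0.
have [hv|hv] := eqVneq (v *m (hyp_mx M)^T) 0; last first.
  exists (v *m (hyp_mx M)^T); split=> //; exists L'; split=> // x1 s.
  have [x <-] := chart_lift wM x1.
  rewrite scalemxAl -mulmxDl => /hL'[t0 h0] /hL'[t1 h1].
  have [gp gm ->] := h0 (Num.max t0 t1) (ltac:(by rewrite le_max lexx)).
  have [gp' gm' ->] := h1 (Num.max t0 t1) (ltac:(by rewrite le_max lexx orbT)).
  rewrite !(addrAC x (s *: v)) in gp' gm' *.
  by rewrite -!hL.
have [s0 ev] := chart_ker w0 wM hv.
have s00 : s0 != 0 by apply: contraNneq v0 => s0z; rewrite ev s0z scale0r.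
have v'0 : const_mx 1 != 0 :> 'rV[R]_e.+1.
  by apply/negP => /eqP/rowP/(_ 0); rewrite !mxE => /eqP; rewrite oner_eq0.
exists (const_mx 1); split=> //; exists L'; split=> //.
suff h0 x : gen L' x -> count_at (links w M cells) x = 0.
  by move=> x s /h0-> /h0->.
have [x' <-] := chart_lift wM x; move=> /hL'[t0 h0].
have [gp gm ->] := h0 t0 (lexx _).
(* The two ends differ by a multiple of w, hence of v. *)
have e1 : x' - t0 *: w = (x' + t0 *: w) + (- 2 * t0 / s0) *: v.
  rewrite ev scalerA divfK // -addrA -scalerDl -scaleNr; congr (_ + _ *: _).
  by ring.
by rewrite e1 -hL ?subrr // -e1.
Qed.

(** In dimension 1 a cell is a half-line, with dual volume 1 / z_0 up to the sign of its generator;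
    this sign is the difference of its multiplicities at 1 and -1. *)
Lemma vol1E (cells : seq (R * 'M[R]_1)) :
  (forall p, p \in cells -> p.2 \in unitmx) ->
  vol cells = cst 1 (count_at cells (const_mx 1) - count_at cells (const_mx (- 1)))
    / ('X_ord0)%:F.
Proof.
move=> uc.
have unit0 (F : 'M[R]_1) : F \in unitmx -> F 0 0 != 0.
  by rewrite unitmxE unitfE det_mx11.
have ePhi F : F \in unitmx -> Phi F = cst 1 (Num.sg (F 0 0)) / ('X_ord0)%:F.
  move=> uF; rewrite /Phi big_ord1 det_mx11.
  have -> : lin (row ord0 F) = (iota (F 0 0))%:MP * 'X_ord0.
    by rewrite /lin /linf big_ord1 !mxE mul_mpolyC.
  have F0 := unit0 F uF.
  rewrite tofracM -/(cst 1 _) normrEsg cstM invfM -mulrA; congr (_ * _).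
  by rewrite mulrA mulfV ?mul1r // cst_eq0.
have iE (F : 'M[R]_1) x : F \in unitmx -> ind F x = (0 <= x 0 0 / F 0 0).
  move=> uF; have F0 := unit0 F uF; rewrite /ind.
  have -> : x *m invmx F = (x 0 0 / F 0 0)%:M.
    rewrite -[RHS](mulmxK uF); congr (_ *m _); apply/rowP => i.
    by rewrite ord1 mul_scalar_mx mxE divfK.
  apply/forallP/idP => [/(_ 0)|h i]; first by rewrite mxE eqxx mulr1n.
  by rewrite ord1 mxE eqxx mulr1n.
have -> : vol cells = cst 1 (\sum_(p <- cells) p.1 * Num.sg (p.2 0 0)) / ('X_ord0)%:F.
  rewrite /vol big_seq.
  have -> : \sum_(p <- cells | p \in cells) cst 1 p.1 * Phi p.2 =
     \sum_(p <- cells) cst 1 (p.1 * Num.sg (p.2 0 0)) / ('X_ord0)%:F.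
    rewrite [RHS]big_seq; apply: eq_bigr => p /uc up.
    by rewrite ePhi // mulrA -cstM.
  rewrite -mulr_suml; congr (_ / _); symmetry.
  by apply: (big_morph (cst 1)) => [x y|]; rewrite ?cstD ?cst0.
congr (cst 1 _ / _).
rewrite /count_at -sumrB big_seq [RHS]big_seq; apply: eq_bigr => p /uc up.
rewrite -mulrBr !iE // !mxE mul1r mulN1r oppr_ge0 invr_ge0 invr_le0.
have := unit0 _ up; case: ltgtP => // lt0 _; congr (_ * _).
  by rewrite gtr0_sg //= subr0.
by rewrite ltr0_sg //= sub0r.
Qed.

Lemma vol_line1 (cells : seq (R * 'M[R]_1)) v :
  (forall p, p \in cells -> p.2 \in unitmx) -> v != 0 -> transl_inv cells v ->
  vol cells = 0.
Proof.
move=> uc v0 [L [L0 hL]]; rewrite vol1E //.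
have g1 c : c != 0 -> gen L (const_mx c).
  move=> c0 l /L0 l0; rewrite /dot big_ord1 mxE mulf_neq0 //.
  by apply: contraNneq l0 => l00; apply/eqP/rowP => i; rewrite ord1 l00 mxE.
have v00 : v 0 0 != 0.
  by apply: contraNneq v0 => l00; apply/eqP/rowP => i; rewrite ord1 l00 mxE.
have e1 : const_mx 1 + (- 2 / v 0 0) *: v = const_mx (- 1) :> 'rV[R]_1.
  by apply/rowP => i; rewrite ord1 !mxE divfK //; ring.
have := hL (const_mx 1) (- 2 / v 0 0).
rewrite e1 => /(_ (g1 _ (oner_neq0 _))) /(_ (g1 _ _)).
rewrite oppr_eq0 oner_neq0 => /(_ isT) ->.
by rewrite subrr cst0 mul0r.
Qed.

(** If f were nonzero, cancelling all the linear forms would leave a polynomial of degree -(n +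
    1). *)
Lemma regular_hcancel n (f : {fraction {mpoly K[n.+1]}}) N k (s : seq 'rV[K]_n.+1) :
  all (fun w => w != 0) s -> N \is k.-homog -> (k + n.+1 = size s)%N ->
  f = N%:F / (\prod_(w <- s) linf w)%:F ->
  (forall w, w \in s -> regular (linf w) f) -> f = 0.
Proof.
move=> s0 hN es ef hr; apply: contrapT => /eqP f0.
have [s' [N' [k' [ss hN' ks ef' hr']]]] := reduce_linf f0 s0 hN ef.
case: s' ss ks ef' hr' => [|w s'] ss ks _ hr'.
  by move: ks; rewrite -es /=; clear; lia.
apply: (hr' w); rewrite ?mem_head //; apply: hr; apply: ss.
by rewrite mem_head.
Qed.

(* The residue of vol cells along w^\perp is the volume of the signed cells
   cut out in R^n / w, which again has a translation invariant multiplicity. *)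
Theorem vol_line n (cells : seq (R * 'M[R]_n.+1)) v :
  (forall p, p \in cells -> p.2 \in unitmx) -> v != 0 -> transl_inv cells v ->
  vol cells = 0.
Proof.
elim: n cells v => [|n IH] cells v uc v0 tv; first exact: vol_line1 v0 tv.
case: cells uc tv => [|p cells] uc tv; first by rewrite /vol big_nil.
have [N [hN eN]] := vol_repr uc.
apply: (regular_hcancel (cell_rows_neq0 uc) hN _ eN).
  by rewrite size_cell_rows /= mulSn addnC.
move=> _ /cell_rowsP[q [i [qc ->]]]; set w := row i q.2.
have w0 : w != 0 by apply/unitmx_row_neq0/uc.
have [M wM] := facet_chart_exists w0.
have [v' [v'0 tv']] := links_transl_inv w0 wM v0 uc tv.
apply: (val_regular w0 (chart_hyper w0 wM)).
rewrite -[0](mulr0 (cst _ (`|dot w (row ix1 M)| / `|\det M|))).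
rewrite -(IH _ _ _ v'0 tv'); first exact: vol_residue.
move=> r /allpairsPdep[a [g [ac + ->]]]; rewrite mem_filter => /andP[cg _] /=.
exact: (link_unit w0 wM (uc _ ac) cg).
Qed.

End Lines.

Local Open Scope classical_set_scope.
Local Open Scope ring_scope.

(** * Polyhedral cones *)

Section Cones.
Variable R : realType.

Inductive cone n (W : seq 'rV[R]_n) : 'rV[R]_n -> Prop :=
| cone0 : cone W 0
| coneS x t w : cone W x -> 0 <= t -> w \in W -> cone W (x + t *: w).

Lemma coneD n (W : seq 'rV[R]_n) x y : cone W x -> cone W y -> cone W (x + y).
Proof.
move=> hx; elim=> [|z t w _ IH t0 wW]; first by rewrite addr0.
by rewrite addrA; apply: coneS.
Qed.

Lemma coneZ n (W : seq 'rV[R]_n) x s : 0 <= s -> cone W x -> cone W (s *: x).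
Proof.
move=> s0; elim=> [|z t w _ IH t0 wW]; first by rewrite scaler0; apply: cone0.
by rewrite scalerDr scalerA; apply: coneS => //; apply: mulr_ge0.
Qed.

Lemma cone_mem n (W : seq 'rV[R]_n) w : w \in W -> cone W w.
Proof.
by move=> wW; rewrite -[w]add0r -[w]scale1r; apply: coneS => //; apply: cone0.
Qed.

Lemma cone_sum n (W : seq 'rV[R]_n) (I : Type) (r : seq I) (P : pred I) (c : I -> R)
    (u : I -> 'rV[R]_n) : (forall i, P i -> 0 <= c i /\ cone W (u i)) ->
  cone W (\sum_(i <- r | P i) c i *: u i).
Proof.
move=> h; apply: big_ind => [||i /h[c0 hu]]; first exact: cone0.
  exact: coneD.
exact: coneZ.
Qed.

Lemma cone_dot n (W : seq 'rV[R]_n) u x : (forall w, w \in W -> 0 <= dot w u) ->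
  cone W x -> 0 <= dot x u.
Proof.
move=> h; elim=> [|z t w _ IH t0 wW]; first by rewrite dot0l.
by rewrite dotDl dotZl addr_ge0 // mulr_ge0 // h.
Qed.

Lemma cone_dot_gt0 n (W : seq 'rV[R]_n) u x : (forall w, w \in W -> 0 < dot w u) ->
  cone W x -> x != 0 -> 0 < dot x u.
Proof.
move=> h hx x0; suff : x = 0 \/ 0 < dot x u by case=> // e; rewrite e eqxx in x0.
elim: hx {x0} => [|z t w _ IH t0 wW]; first by left.
rewrite dotDl dotZl; move: t0; rewrite le_eqVlt => /orP[/eqP<-|t0].
  by rewrite mul0r addr0 scale0r addr0.
right; have h1 : 0 < t * dot w u by rewrite mulr_gt0 // h.
by case: IH => [->|h2]; [rewrite dot0l add0r | rewrite addr_gt0].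
Qed.

Lemma cone_sub n (W W' : seq 'rV[R]_n) x :
  (forall w, w \in W -> cone W' w) -> cone W x -> cone W' x.
Proof.
move=> h; elim=> [|z t w _ IH t0 wW]; first exact: cone0.
by apply: coneD => //; apply: coneZ => //; apply: h.
Qed.

Lemma cone_cons n (W : seq 'rV[R]_n) a x : cone (a :: W) x ->
  exists y s, [/\ cone W y, 0 <= s & x = y + s *: a].
Proof.
elim=> [|z t w _ [y [s [hy s0 ->]]] t0].
  by exists 0, 0; split; rewrite ?scale0r ?addr0 //; apply: cone0.
rewrite inE => /orP[/eqP->|wW].
  by exists y, (s + t); split; rewrite ?addr_ge0 // scalerDl addrA.
by exists (y + t *: w), s; split; [apply: coneS | | rewrite addrAC].
Qed.

Lemma small_eps (T : eqType) (s : seq T) (p q : T -> R) :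
  (forall i, i \in s -> 0 < p i) ->
  exists2 eps, 0 < eps & forall t, 0 < t -> t <= eps ->
    forall i, i \in s -> 0 < p i + t * q i.
Proof.
elim: s => [|i s IH] h; first by exists 1.
have [|eps eps0 he] := IH; first by move=> j js; apply: h; rewrite inE js orbT.
have pi := h i (mem_head _ _).
pose e1 := p i / (`|q i| + 1).
have q1 : 0 < `|q i| + 1 by rewrite ltr_wpDl.
have e10 : 0 < e1 by rewrite divr_gt0.
exists (Num.min eps e1); first by rewrite lt_min eps0.
move=> t t0; rewrite le_min => /andP[te te1] j; rewrite inE => /orP[/eqP->|]; last exact: he.
have : t * (`|q i| + 1) <= p i by rewrite -ler_pdivlMr.
have : - `|q i| <= q i by rewrite lerNl -normrN ler_norm.
by move: (`|q i|) (normr_ge0 (q i)) => a a0 h1 h2; nra.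
Qed.

(** Gordan's alternative, by induction on the number of generators. If u is positive on W but
    negative on a, the generators are pushed along a into the hyperplane orthogonal to u, and a
    functional positive on the pushed generators is corrected by a multiple of u. *)
Lemma gordan n (W : seq 'rV[R]_n) :
  (exists u, forall w, w \in W -> 0 < dot w u) \/
  (exists2 w, w \in W & cone W (- w)).
Proof.
move: {2}(size W) (erefl (size W)) => m.
elim: m W => [|m IH] [|a W] //= sW; first by left; exists 0.
have mono x : cone W x -> cone (a :: W) x.
  by apply: cone_sub => w wW; apply: cone_mem; rewrite inE wW orbT.
have [|[u hu]|[w wW hw]] := IH W; first by case: sW.
  have [au|au|au] := ltgtP (dot a u) 0.
  (* With this choice [w + s w *: a] is orthogonal to u. *)
  - pose s w := - (dot w u / dot a u).
    have sp w : w \in W -> 0 < s w.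
      by move=> /hu wu; rewrite /s -mulrN -invrN pmulr_rgt0 // invr_gt0 oppr_gt0.
    have [|[u' hu']|[w' /mapP[w wW ->] hw]] := IH [seq w + s w *: a | w <- W].
    + by rewrite size_map; case: sW.
    + left; have [|eps eps0 he] := @small_eps _ W (fun w => dot (w + s w *: a) u')
          (fun w => - s w).
        by move=> w wW; apply: hu'; apply: map_f.
      (* Adding a multiple of u keeps the values on the pushed generators; this multiple gives a the
         small positive value eps. *)
      pose lam := (eps - dot a u') / dot a u.
      have ea : dot a (u' + lam *: u) = eps.
        by rewrite dotDr dotZr divfK ?ltr0_neq0 // addrC subrK.
      exists (u' + lam *: u) => w; rewrite inE => /orP[/eqP->|wW].
        by rewrite ea.
      have -> : dot w (u' + lam *: u) = dot (w + s w *: a) u' + eps * - s w.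
        rewrite -ea !dotDl !dotDr !dotZl !dotZr.
        have e1 : s w * dot a u = - dot w u by rewrite mulNr divfK ?ltr0_neq0.
        have -> : dot w u = - (s w * dot a u) by rewrite e1 opprK.
        by ring.
      exact: he.
    + right; exists w; first by rewrite inE wW orbT.
      have -> : - w = - (w + s w *: a) + s w *: a by rewrite opprD subrK.
      apply: coneS; rewrite ?mem_head ?ltW ?sp //.
      apply: cone_sub hw => z /mapP[v vW ->].
      apply: coneS; rewrite ?mem_head ?ltW ?sp //.
      by apply: cone_mem; rewrite inE vW orbT.
  - by left; exists u => w; rewrite inE => /orP[/eqP->|/hu].
  - have [a0|a0] := eqVneq a 0.
      right; exists a; first by rewrite mem_head.
      by rewrite a0 oppr0; apply: cone0.
    left; have [|eps eps0 he] := @small_eps _ W (fun w => dot w u) (fun w => dot w a).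
      by move=> w /hu.
    exists (u + eps *: a) => w; rewrite inE dotDr dotZr => /orP[/eqP->|wW].
      by rewrite au add0r mulr_gt0 // dot_self.
    exact: he.
by right; exists w; [rewrite inE wW orbT | apply: mono].
Qed.

(** [gordan] for - x and W. A strictly positive functional would contradict the hypothesis on x;
    otherwise the opposite of one of these vectors is a nonnegative combination of them, which is
    solved for x. *)
Lemma farkas n (W : seq 'rV[R]_n) u0 x : (forall w, w \in W -> 0 < dot w u0) ->
  (forall u, (forall w, w \in W -> 0 <= dot w u) -> 0 <= dot x u) -> cone W x.
Proof.
move=> hu0 hx; have [[u hu]|[z zW hz]] := gordan (- x :: W).
  have : 0 < dot (- x) u by apply: hu; rewrite mem_head.
  rewrite dotNl oppr_gt0 ltNge hx // => w wW.
  by apply/ltW/hu; rewrite inE wW orbT.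
have [y [s [hy s0 ez]]] := cone_cons hz.
move: zW; rewrite inE => /orP[/eqP ezx|zW].
  have e1 : y = (1 + s) *: x.
    by rewrite scalerDl scale1r -[X in X + _]opprK -ezx ez scalerN subrK.
  have s1 : 0 < 1 + s by rewrite ltr_pwDl.
  have -> : x = (1 + s)^-1 *: y by rewrite e1 scalerA mulVf ?lt0r_neq0 // scale1r.
  by apply: coneZ; rewrite ?invr_ge0 ?ltW.
have e1 : s *: x = y + z.
  by rewrite -[z]opprK ez scalerN opprB addrC subrK.
(* A coefficient 0 of x would give a nontrivial relation among the generators in W, against u0. *)
have [sz|sn] := eqVneq s 0.
  move: e1; rewrite sz scale0r => e1.
  have : 0 < dot (y + z) u0.
    rewrite dotDl ltr_wpDl ?hu0 //; apply: cone_dot hy => w wW.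
    by apply/ltW/hu0.
  by rewrite -e1 dot0l ltxx.
have -> : x = s^-1 *: (y + z) by rewrite -e1 scalerA mulVf // scale1r.
apply: coneZ; first by rewrite invr_ge0.
by apply: coneD => //; apply: cone_mem.
Qed.

Lemma cone_image m n (W : seq 'rV[R]_n) (A : 'M[R]_(n, m)) (W' : seq 'rV[R]_m) x :
  (forall w, w \in W -> cone W' (w *m A)) -> cone W x -> cone W' (x *m A).
Proof.
move=> h; elim=> [|z t w _ IH t0 wW]; first by rewrite mul0mx; apply: cone0.
rewrite mulmxDl -scalemxAl; apply: coneD => //; apply: coneZ => //; exact: h.
Qed.

Lemma cone_preimage m n (W : seq 'rV[R]_n) (A : 'M[R]_(n, m)) (W' : seq 'rV[R]_m) y :
  (forall w', w' \in W' -> exists2 w, w \in W & w' = w *m A) -> cone W' y ->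
  exists2 x, cone W x & y = x *m A.
Proof.
move=> h; elim=> [|z t w' _ [x hx ->] t0 /h[w wW ->]].
  by exists 0; [apply: cone0 | rewrite mul0mx].
by exists (x + t *: w); [apply: coneS | rewrite mulmxDl scalemxAl].
Qed.

Lemma cone_of_ind n (W : seq 'rV[R]_n) (F : 'M[R]_n) x : F \in unitmx ->
  (forall i, row i F \in W) -> ind F x -> cone W x.
Proof.
move=> uF hF /forallP hi; rewrite -[x](mulmxKV uF) mulmx_sum_row.
by apply: cone_sum => i _; split=> //; apply: cone_mem.
Qed.

(** Start from an interior point; when l vanishes at it, a small move along l itself leaves the
    hyperplane and stays in the interior and off the previous hyperplanes. *)
Lemma generic_in_cell n (B : 'M[R]_n) (L : seq 'rV[R]_n) : B \in unitmx ->
  (forall l, l \in L -> l != 0) -> exists x, gen L x /\ ind B x.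
Proof.
move=> uB; suff h : (forall l, l \in L -> l != 0) ->
    exists x, gen L x /\ forall h, 0 < (x *m invmx B) 0 h.
  by move=> /h[x [gx px]]; exists x; split=> //; apply/forallP => k; apply/ltW.
elim: L => [|l L IH] hL.
  by exists (const_mx 1 *m B); split=> // h; rewrite mulmxK // mxE.
have [|x [gx px]] := IH; first by move=> k kL; apply: hL; rewrite inE kL orbT.
have [lx|lx] := eqVneq (dot l x) 0; last first.
  by exists x; split=> // k; rewrite inE => /orP[/eqP->|/gx].
have [|e1 e10 he1] := @small_eps _ L (fun k => `|dot k x|) (fun k => - `|dot k l|).
  by move=> k /gx; rewrite normr_gt0.
have [|e2 e20 he2] := @small_eps _ (enum 'I_n) (fun h => (x *m invmx B) 0 h)
    (fun h => (l *m invmx B) 0 h).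
  by move=> h _; apply: px.
pose t := Num.min e1 e2.
have t0 : 0 < t by rewrite lt_min e10.
have t1 : t <= e1 by rewrite ge_min lexx.
have t2 : t <= e2 by rewrite ge_min lexx orbT.
exists (x + t *: l); split=> [k|h]; last first.
  by rewrite mulmxDl -scalemxAl !mxE; have := he2 t t0 t2 h; rewrite mem_enum !mxE; apply.
rewrite inE dotDr dotZr => /orP[/eqP->|kL].
  by rewrite lx add0r mulf_neq0 ?lt0r_neq0 // dot_self // hL // mem_head.
have := he1 t t0 t1 k kL; rewrite mulrN subr_gt0 => h1.
apply: contraTneq h1 => /eqP; rewrite addr_eq0 => /eqP->.
by rewrite normrN normrM (gtr0_norm t0) ltxx.
Qed.

End Cones.

(** * Facets of a dual cone *)

Section Facets.
Variable R : realType.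

Definition dualc n (W : seq 'rV[R]_n) : set 'rV[R]_n :=
  [set u | forall w, w \in W -> 0 <= dot w u].

Definition pointed n (W : seq 'rV[R]_n) : Prop :=
  exists u0, forall w, w \in W -> 0 < dot w u0.

Lemma dual_dualc n (W : seq 'rV[R]_n) w : pointed W ->
  dual_cone (dualc W) w <-> cone W w.
Proof.
move=> [u0 hu0]; split=> [h|h u hu]; last exact: cone_dot h.
by apply: (farkas hu0) => u /h.
Qed.

(** Describes the facet of [dualc W] with normal w by a point u1 of its relative interior, that is,
    a functional exposing the ray of w in [cone W]. *)
Definition facet n (W : seq 'rV[R]_n) (w : 'rV[R]_n) : Prop :=
  [/\ w != 0, cone W w & exists2 u1, dot w u1 = 0 &
      forall v, v \in W -> (exists s, v = s *: w) \/ 0 < dot v u1].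

Section FacetNormal.
Variables (e : nat) (W : seq 'rV[R]_e.+2) (w : 'rV[R]_e.+2).
Hypothesis pW : pointed W.

(** The sum of a basis of the facet serves as u1: a generator that vanishes there vanishes on the
    whole basis, whose orthogonal is the line of w. *)
Lemma facet_normal_facet : facet_normal (dualc W) w -> facet W w.
Proof.
move=> [w0 /(dual_dualc w pW) cw [U [fU hU _]]]; split=> //.
exists (\sum_i row i U).
  by rewrite dot_sumr big1 // => i _; case: (hU i).
move=> v vW; have pos i : 0 <= dot v (row i U) by case: (hU i) => h _; apply: h.
rewrite dot_sumr; have [hv|hv] := eqVneq (\sum_i dot v (row i U)) 0; last first.
  by right; rewrite lt_neqAle eq_sym hv sumr_ge0.
left; have h0 i : dot v (row i U) = 0.
  by apply/eqP; move/eqP: hv; rewrite psumr_eq0 // => /allP/(_ i); rewrite mem_index_enum; apply.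
have ker x : (forall i, dot x (row i U) = 0) -> (x <= kermx U^T)%MS.
  move=> hx; apply/sub_kermxP/rowP => i; rewrite mxE [RHS]mxE -[RHS](hx i).
  by apply: eq_bigr => j _; rewrite !mxE.
have kw : (w <= kermx U^T)%MS by apply: ker => i; case: (hU i).
have rk : \rank (kermx U^T) = 1%N.
  by rewrite mxrank_ker mxrank_tr (eqP fU) subSnn.
have kw' : (kermx U^T <= w)%MS.
  by rewrite -(geq_leqif (mxrank_leqif_sup kw)) rk rank_rV w0.
exact/sub_rVP/(submx_trans (ker v h0)).
Qed.

(** Small moves from u1 along a basis of the hyperplane stay in the dual cone, and almost all of
    them give independent vectors. *)
Lemma facet_facet_normal : facet W w -> facet_normal (dualc W) w.
Proof.
move=> [w0 cw [u1 wu1 hu1]]; split=> //; first exact/(dual_dualc w pW).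
have [M wM] := facet_chart_exists w0.
pose H := hyp_mx M; have [y ey] := chart_rowspace w0 wM wu1.
have [|eps eps0 he] := @small_eps _ _
  [seq (v, i) | v <- [seq v <- W | 0 < dot v u1], i <- enum 'I_e.+1]
  (fun p => dot p.1 u1) (fun p => dot p.1 (row p.2 H)).
  by move=> p /allpairsP[[v i] [/=]]; rewrite mem_filter => /andP[h _] _ ->.
(* This is when the rank-one perturbation B of the scalar matrix t is invertible; it holds for eps
   or for eps / 2. *)
have [t [t0 te ty]] : exists t, [/\ 0 < t, t <= eps & t + \sum_i y 0 i != 0].
  have [h|h] := eqVneq (eps + \sum_i y 0 i) 0; last by exists eps; split.
  exists (eps / 2); split; rewrite ?divr_gt0 //; first lra.
  by apply: contra_eq_neq h => h; lra.
pose B := t%:M + const_mx 1 *m y : 'M[R]_e.+1.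
have uB : B \in unitmx.
  rewrite -row_free_unit -kermx_eq0; apply/rowV0P => c /sub_kermxP.
  rewrite mulmxDr mul_mx_scalar mulmxA.
  have -> : c *m (const_mx 1 : 'cV_e.+1) = (\sum_i c 0 i)%:M.
    apply/rowP => j; rewrite ord1 !mxE eqxx mulr1n; apply: eq_bigr => i _.
    by rewrite mxE mulr1.
  set s := \sum_i c 0 i; rewrite mul_scalar_mx => hc.
  have hi i : t * c 0 i + s * y 0 i = 0.
    by have := congr1 (fun A : 'rV_e.+1 => A 0 i) hc; rewrite !mxE.
  have : s * (t + \sum_i y 0 i) = 0.
    rewrite mulrDr mulr_sumr mulrC {1}/s mulr_sumr -big_split big1 //= => i _.
  move/eqP; rewrite mulf_eq0 (negPf ty) orbF => /eqP s0.
  apply/rowP => i; rewrite [RHS]mxE; have := hi i; rewrite s0 mul0r addr0.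
  by move/eqP; rewrite mulf_eq0 gt_eqF //= => /eqP.
exists (B *m H); split.
- rewrite -kermx_eq0; apply/rowV0P => c /sub_kermxP; rewrite mulmxA.
  move/(chart_inj wM) => hc; rewrite -[c](mulmxK uB) hc mul0mx //.
- move=> i; have -> : row i (B *m H) = u1 + t *: row i H.
    have -> : row i (B *m H) = (t *: delta_mx 0 i + y) *m H.
      rewrite row_mul; congr (_ *m _); apply/rowP => j; rewrite !mxE big_ord1.
      by rewrite !mxE mul1r eqxx /= eq_sym mulr_natr.
    by rewrite mulmxDl -scalemxAl -rowE -ey addrC.
  have wr : dot w (row i H) = 0 by rewrite rowE (chart_ortho w0 wM).
  split; last by rewrite /= dotDr dotZr wu1 wr mulr0 addr0.
  move=> v vW; rewrite dotDr dotZr; case: (hu1 v vW) => [[s ->]|hv].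
    by rewrite !dotZl wu1 wr !mulr0 addr0.
  apply/ltW; apply: (he t t0 te (v, i)); apply/allpairsP; exists (v, i).
  by rewrite mem_filter hv vW mem_enum.
- move=> x [_ /= /(chart_rowspace w0 wM)[z ->]].
  by rewrite -[z](mulmxKV uB) -(mulmxA _ B) submxMl.
Qed.

End FacetNormal.
End Facets.

(** * Simplicial covers of a pointed cone *)

Section Covers.
Variable R : realType.

(* The cells of S, with generators in W, cover the pointed cone spanned by W
   exactly once, outside finitely many hyperplanes. *)
Record cover n (W : seq 'rV[R]_n) (S : seq 'M[R]_n) : Prop := Cover {
  cover_unit : forall F, F \in S -> F \in unitmx;
  cover_rows : forall F i, F \in S -> row i F \in W;
  cover_nil : S != [::];
  cover_pointed : pointed W;
  cover_count : exists L : seq 'rV[R]_n, (forall l, l \in L -> l != 0) /\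
    forall x, gen L x -> \sum_(F <- S) (ind F x)%:R = (`[< cone W x >])%:R :> R }.

Definition weight1 n (S : seq 'M[R]_n) : seq (R * 'M[R]_n) :=
  [seq (1, F) | F <- S].

Lemma count_weight1 n (S : seq 'M[R]_n) x :
  count_at (weight1 S) x = \sum_(F <- S) (ind F x)%:R.
Proof. by rewrite /count_at big_map; apply: eq_bigr => F _; rewrite mul1r. Qed.

Lemma weight1_unit n (S : seq 'M[R]_n) :
  (forall F, F \in S -> F \in unitmx) ->
  forall p, p \in weight1 S -> p.2 \in unitmx.
Proof. by move=> h p /mapP[F FS ->]; apply: h. Qed.

(** * Projection of a pointed cone along one of its vectors *)

Section Projection.
Variables (e : nat) (W : seq 'rV[R]_e.+2) (w : 'rV[R]_e.+2) (M : 'M[R]_e.+2).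
Hypotheses (pW : pointed W) (w0 : w != 0) (cw : cone W w) (wM : facet_chart w M).
Local Notation H := (hyp_mx M).

Definition proj : seq 'rV[R]_e.+1 := [seq v *m H^T | v <- W].

Lemma cone_projP x : cone proj (x *m H^T) <-> exists s, cone W (x + s *: w).
Proof.
have hw : w *m H^T = 0 by case: (chart_hyper w0 wM).
split=> [|[s]]; last first.
  rewrite -[x in x *m _](addrK (s *: w)) mulmxBl -scalemxAl hw scaler0 subr0.
  by apply: cone_image => v vW; apply/cone_mem/map_f.
move=> hc; have [|z hz e1] := @cone_preimage _ _ _ W H^T _ _ _ hc.
  by move=> v /mapP[u uW ->]; exists u.
have [s es] : exists s, z - x = s *: w.
  by apply: (chart_ker w0 wM); rewrite mulmxBl e1 subrr.
by exists s; rewrite -es addrC subrK.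
Qed.

(** Since w lies in the cone, a line in direction w that meets it stays in it; in direction - w the
    line leaves it because the cone is pointed. Hence the difference of the two ends is the
    indicator of the projected cone. *)
Lemma cone_infty x : exists t0, forall t, t0 <= t ->
  (cone W (x + t *: w) <-> cone proj (x *m H^T)) /\ ~ cone W (x - t *: w).
Proof.
have [u0 hu0] := pW; have wu0 := cone_dot_gt0 hu0 cw w0.
pose t1 := `|dot x u0 / dot w u0| + 1.
have h1 t : t1 <= t -> ~ cone W (x - t *: w).
  move=> tt /(cone_dot (fun v vW => ltW (hu0 v vW))).
  rewrite dotDl dotNl dotZl subr_ge0 -ler_pdivlMr //.
  apply/negP; rewrite -ltNge; apply: lt_le_trans tt.
  by rewrite /t1 (le_lt_trans (ler_norm _)) // ltrDl.
have [hp|hp] := pselect (cone proj (x *m H^T)); last first.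
  exists t1 => t /h1; split=> //; split=> // hc; case: hp.
  by apply/cone_projP; exists t.
have [s hs] := (cone_projP x).1 hp.
exists (Num.max s t1) => t; rewrite ge_max => /andP[st /h1]; split=> //.
split=> // _; have -> : x + t *: w = (x + s *: w) + (t - s) *: w.
  by rewrite -addrA -scalerDl addrC (addrC s) subrK addrC.
by apply: coneD => //; apply: coneZ; rewrite ?subr_ge0.
Qed.

(** Gordan's alternative for the nonzero projected generators: a functional positive on them exposes
    the ray of w, and otherwise the projected cone contains a line. This decides whether w gives a
    pole. *)
Lemma facet_or_line : facet W w \/
  exists2 v, v \in W & v *m H^T != 0 /\ cone proj (- (v *m H^T)).
Proof.
have [[u' hu']|[v' + hv']] := gordan [seq v <- proj | v != 0]; last first.
  rewrite mem_filter => /andP[v0 /mapP[v vW ev]]; right; exists v => //.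
  rewrite -ev; split=> //; apply: cone_sub hv' => z.
  by rewrite mem_filter => /andP[_ zp]; apply: cone_mem.
left; split=> //; exists (u' *m H); first exact: chart_ortho w0 wM _.
move=> v vW; have [hv|hv] := eqVneq (v *m H^T) 0.
  by left; apply: chart_ker w0 wM _ hv.
by right; rewrite dot_mulmx hu' // mem_filter hv; apply: map_f.
Qed.

End Projection.

(** If the projected cone contained a line, a multiple of w would be the sum of a generator off its
    ray and a vector of the cone, against extremality. *)
Lemma extreme_facet e (W : seq 'rV[R]_e.+2) w : pointed W ->
  extreme_ray (cone W) w -> facet W w.
Proof.
move=> pW [cw w0 hw]; have [M wM] := facet_chart_exists w0.
have [//|[v vW [v0 hv]]] := facet_or_line w0 cw wM.
have [|z hz ez] := @cone_preimage _ _ _ W ((hyp_mx M)^T) _ _ _ hv.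
  by move=> v' /mapP[u uW ->]; exists u.
have [s es] : exists s, v + z = s *: w.
  by apply: (chart_ker w0 wM); rewrite mulmxDl -ez subrr.
have [u0 hu0] := pW.
have sp : 0 < s.
  have : 0 < dot (v + z) u0.
    rewrite dotDl ltr_pwDl ?hu0 //.
    by apply: cone_dot hz => u /hu0/ltW.
  by rewrite es dotZl pmulr_lgt0 // (cone_dot_gt0 hu0).
have [|||[r _ er] _] := hw (s^-1 *: v) (s^-1 *: z).
- by apply: coneZ; [rewrite invr_ge0 ltW | apply: cone_mem].
- by apply: coneZ; [rewrite invr_ge0 ltW | ].
- by rewrite -scalerDr es scalerA mulVf ?lt0r_neq0 // scale1r.
case/eqP: v0; have -> : v = (s * r) *: w.
  by rewrite -scalerA er scalerA mulfV ?lt0r_neq0 // scale1r.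
by rewrite -scalemxAl; case: (chart_hyper w0 wM) => -> _; rewrite scaler0.
Qed.

Lemma links_cover e (W : seq 'rV[R]_e.+2) S w M : cover W S -> w != 0 ->
  cone W w -> facet_chart w M ->
  exists L' : seq 'rV[R]_e.+1, (forall l, l \in L' -> l != 0) /\
    forall x, gen L' x -> count_at (links w M (weight1 S)) x =
      (`[< cone (proj W M) x >])%:R.
Proof.
move=> cS w0 cw wM; have [L [L0 hL]] := cover_count cS.
have [L' [L'0 hL']] := links_count w0 wM (weight1_unit (cover_unit cS)) L0.
exists L'; split=> // x; have [y <-] := chart_lift wM x => /hL'[t0 h0].
have [t1 h1] := cone_infty (cover_pointed cS) w0 cw wM y.
have [gp gm ->] := h0 (Num.max t0 t1) (ltac:(by rewrite le_max lexx)).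
have [hp hm] := h1 (Num.max t0 t1) (ltac:(by rewrite le_max lexx orbT)).
rewrite !count_weight1 !hL // (asbool_equiv_eq hp).
by have /asboolPn/negbTE-> := hm; rewrite subr0.
Qed.

(** * The cover of a facet by links *)

Section LinkCover.
Variables (e : nat) (W : seq 'rV[R]_e.+2) (S : seq 'M[R]_e.+2).
Variables (w : 'rV[R]_e.+2) (M : 'M[R]_e.+2).
Hypotheses (cS : cover W S) (fw : facet W w) (wM : facet_chart w M).
Local Notation H := (hyp_mx M).

Let w0 : w != 0. Proof. by case: fw. Qed.
Let cw : cone W w. Proof. by case: fw. Qed.
Let hw : w *m H^T = 0. Proof. by case: (chart_hyper w0 wM). Qed.

(** Only cells with a generator on the ray of w are kept. The signed links of any other cell cancel,
    by [facet_crossing], so no signs remain and the result can be a [cover]. *)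
Definition facet_links : seq 'M[R]_e.+1 :=
  [seq link F M g | F <- S, g <- [seq g <- enum 'I_e.+2 | row g F *m H^T == 0]].

Definition facet_gens : seq 'rV[R]_e.+1 := [seq v <- proj W M | v != 0].

Lemma big_facet_links (A : nmodType) (f : 'M[R]_e.+1 -> A) :
  \sum_(B <- facet_links) f B =
  \sum_(F <- S) \sum_(g | row g F *m H^T == 0) f (link F M g).
Proof.
rewrite /facet_links big_allpairs_dep; apply: eq_bigr => F _.
by rewrite big_filter big_enum_cond.
Qed.

Lemma facet_ray F g : F \in S -> row g F *m H^T = 0 ->
  exists2 s, 0 < s & row g F = s *: w.
Proof.
move=> FS /(chart_ker w0 wM)[s es]; exists s => //.
have [u0 hu0] := cover_pointed cS.
have : 0 < dot (row g F) u0 by apply/hu0/(cover_rows cS).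
by rewrite es dotZl pmulr_lgt0 // (cone_dot_gt0 hu0).
Qed.

Lemma facet_cellcoord F g : F \in S -> row g F *m H^T = 0 ->
  exists2 s, 0 < s & forall h, cellcoord F w h = s * (g == h)%:R.
Proof.
move=> FS /(facet_ray FS)[s s0 es]; exists s^-1; first by rewrite invr_gt0.
move=> h; have := cellcoord_row g h (cover_unit cS FS).
rewrite es /cellcoord -scalemxAl mxE => <-.
by rewrite mulrA mulVf ?mul1r // lt0r_neq0.
Qed.

(* Since w is extreme, a cell containing w has a generator on the ray of w. *)
Lemma facet_mixed F : F \in S -> (forall g, row g F *m H^T != 0) ->
  (exists g, cellcoord F w g < 0) /\ (exists g, 0 < cellcoord F w g).
Proof.
move=> FS nr; have uF := cover_unit cS FS.
have [_ _ [u1 wu1 hu1]] := fw; have [u0 hu0] := cover_pointed cS.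
have pos g : 0 < dot (row g F) u1.
  case: (hu1 _ (cover_rows cS g FS)) => // -[s es].
  by have := nr g; rewrite es -scalemxAl hw scaler0 eqxx.
have ew u : dot w u = \sum_g cellcoord F w g * dot (row g F) u.
  rewrite {1}(cellcoordE uF w) dot_suml; apply: eq_bigr => g _.
  by rewrite dotZl.
split; apply: contrapT => /forallNP h.
  have c0 g : 0 <= cellcoord F w g by rewrite leNgt; apply/negP/h.
  have : w = 0; last by move/eqP: w0.
  rewrite (cellcoordE uF w) big1 // => g _.
  have : \sum_g cellcoord F w g * dot (row g F) u1 == 0 by rewrite -ew wu1.
  rewrite psumr_eq0 => [/allP/(_ g)|k _]; last by rewrite mulr_ge0 // ltW.
  rewrite mem_index_enum /= mulf_eq0 (gt_eqF (pos g)) orbF => /(_ isT)/eqP->.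
  by rewrite scale0r.
have : 0 < dot w u0 by exact: (cone_dot_gt0 hu0 cw w0).
rewrite ltNge ew => /negP; apply; apply: sumr_le0 => g _.
rewrite mulr_le0_ge0 //; first by rewrite leNgt; apply/negP/h.
by apply/ltW/hu0/(cover_rows cS).
Qed.

Lemma facet_big (A : nmodType) F g (f : 'I_e.+2 -> A) : F \in S ->
  row g F *m H^T = 0 -> \sum_(h | row h F *m H^T == 0) f h = f g.
Proof.
move=> FS hg; have [s s0 hs] := facet_cellcoord FS hg.
rewrite (bigD1 g) /= ?hg // big1 ?addr0 // => h /andP[/eqP hh hgh].
have [s' s'0 hs'] := facet_cellcoord FS hh.
have := hs' h; rewrite hs eqxx mulr1 eq_sym (negPf hgh) mulr0 => h0.
by rewrite -h0 ltxx in s'0.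
Qed.

(** A cell with a generator on the ray of w has a single link, with sign 1. For any other cell w has
    coordinates of both signs, so neither end of the line lies in the cell and [crossing_sum] gives
    0. *)
Lemma facet_crossing F x : F \in S ->
  generic (cellcoord F x) (cellcoord F w) ->
  \sum_(g | row g F *m H^T == 0) (ind (link F M g) (x *m H^T))%:R =
  \sum_(g | cellcoord F w g != 0) Num.sg (cellcoord F w g) *
     (ind (link F M g) (x *m H^T))%:R :> R.
Proof.
move=> FS gx; have uF := cover_unit cS FS.
have [[g hg]|/forallNP nr] := pselect (exists g, row g F *m H^T = 0).
  rewrite (facet_big _ FS hg); have [s s0 hs] := facet_cellcoord FS hg.
  rewrite (bigD1 g) /=; last by rewrite hs eqxx mulr1 lt0r_neq0.
  rewrite big1 ?addr0 => [|h /andP[+ hgh]]; last first.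
    by rewrite hs [g == h]eq_sym (negPf hgh) mulr0 eqxx.
  by rewrite hs eqxx mulr1 gtr0_sg // mul1r.
have nr' g : row g F *m H^T != 0 by apply/eqP/nr.
rewrite big1 => [|g hg]; last by have := nr' g; rewrite hg.
have [[g1 n1] [g2 n2]] := facet_mixed FS nr'.
have -> : \sum_(g | cellcoord F w g != 0) Num.sg (cellcoord F w g) *
     (ind (link F M g) (x *m H^T))%:R =
   \sum_(g | cellcoord F w g != 0) Num.sg (cellcoord F w g) *
     (crossing (cellcoord F x) (cellcoord F w) g)%:R.
  by apply: eq_bigr => g cg; rewrite (ind_link uF w0 wM).
rewrite crossing_sum //.
have -> : at_infty (cellcoord F x) (cellcoord F w) = false.
  apply/negbTE/forallPn; exists g1.
  by rewrite ltNge (ltW n1) (lt_eqF n1).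
have -> : at_infty (cellcoord F x) (fun h => - cellcoord F w h) = false.
  apply/negbTE/forallPn; exists g2.
  by rewrite oppr_gt0 oppr_eq0 ltNge (ltW n2) (gt_eqF n2).
by rewrite subrr.
Qed.

Lemma facet_links_cover : cover facet_gens facet_links.
Proof.
have hrow F g k : row k (link F M g) = row (lift g k) F *m H^T.
  by rewrite row_mul; congr (_ *m _); apply/rowP => j; rewrite !mxE.
have unit F g : F \in S -> row g F *m H^T = 0 -> link F M g \in unitmx.
  move=> FS hg; apply: (link_unit w0 wM (cover_unit cS FS)).
  by have [s s0 ->] := facet_cellcoord FS hg; rewrite eqxx mulr1 lt0r_neq0.
have linkP B : B \in facet_links -> exists F g,
    [/\ F \in S, row g F *m H^T = 0 & B = link F M g].
  case/allpairsPdep => F [g [FS + ->]]; rewrite mem_filter => /andP[/eqP hg _].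
  by exists F, g.
have gensP F g : F \in S -> link F M g \in unitmx -> forall k,
    row k (link F M g) \in facet_gens.
  move=> FS ul k; rewrite mem_filter unitmx_row_neq0 // hrow.
  by apply/map_f/(cover_rows cS).
have countS : exists L : seq 'rV[R]_e.+1, (forall l, l \in L -> l != 0) /\
    forall x, gen L x -> \sum_(B <- facet_links) (ind B x)%:R =
       (`[< cone facet_gens x >])%:R :> R.
  have [L [L0 hL]] := links_cover cS w0 cw wM.
  have [L' [L'0 hL']] := descend w0 wM (flatten [seq cell_forms w F | F <- S]).
  exists (L ++ L'); split=> [l|x gx].
    by rewrite mem_cat => /orP[/L0|/L'0].
  have gx1 : gen L x by move=> l lL; apply: gx; rewrite mem_cat lL.
  have gx2 : gen L' x by move=> l lL; apply: gx; rewrite mem_cat lL orbT.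
  have -> : `[< cone facet_gens x >] = `[< cone (proj W M) x >].
    apply: asbool_equiv_eq; split.
      apply: cone_sub => v; rewrite mem_filter => /andP[_ vp].
      exact: cone_mem.
    apply: cone_sub => v vp; have [->|v0] := eqVneq v 0; first exact: cone0.
    by apply: cone_mem; rewrite mem_filter v0.
  rewrite -hL // big_facet_links /count_at big_links /weight1 big_map /=.
  have [y ey] := chart_lift wM x.
  rewrite big_seq [RHS]big_seq; apply: eq_bigr => F FS.
  under [RHS]eq_bigr do rewrite mul1r.
  rewrite -ey; apply: facet_crossing => //.
  apply: cell_forms_generic; first exact: cover_unit cS _ FS.
  move=> l lF; apply: hL'; first by rewrite ey.
  by apply/flattenP; exists (cell_forms w F) => //; apply: map_f.
split=> //.
- by move=> _ /linkP[F [g [FS hg ->]]]; apply: unit.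
- by move=> _ i /linkP[F [g [FS hg ->]]]; apply: gensP => //; apply: unit.
(* Nonemptiness: a generic point in some link of a cell lies in the projected cone, so it has
   multiplicity 1, which an empty list could not give. *)
- have [F FS] : exists F, F \in S.
    by case: S (cover_nil cS) => // F S' _; exists F; rewrite mem_head.
  have uF := cover_unit cS FS.
  have [g cg] : exists g, cellcoord F w g != 0.
    apply: contrapT => /forallNP h; move/eqP: w0; apply.
    rewrite (cellcoordE uF w) big1 // => g _.
    by have /negP := h g; rewrite negbK => /eqP->; rewrite scale0r.
  have ul := link_unit w0 wM uF cg.
  have [L [L0 hL]] := countS; have [x [gx ix]] := generic_in_cell ul L0.
  have := hL x gx; have -> : `[< cone facet_gens x >].
    by apply/asboolP/(cone_of_ind ul) => // k; apply: gensP.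
  by case: facet_links => //; rewrite big_nil => /eqP; rewrite eq_sym oner_eq0.
- have [_ _ [u1 wu1 hu1]] := fw; have [y ey] := chart_rowspace w0 wM wu1.
  exists y => v; rewrite mem_filter => /andP[v0 /mapP[u uW eu]].
  rewrite eu -dot_mulmx -ey; case: (hu1 u uW) => // -[s es].
  by move: v0; rewrite eu es -scalemxAl hw scaler0 eqxx.
Qed.

End LinkCover.
End Covers.

(** * The dual volume of a cover *)

Section CoverVolume.
Variables (R : realType) (K : fieldType) (iota : {rmorphism R -> K}).
Local Notation lin := (lin iota).
Local Notation cst := (cst iota).
Local Notation Phi := (Phi iota).
Local Notation vol := (vol iota).

Definition volume n (S : seq 'M[R]_n) : {fraction {mpoly K[n]}} :=
  \sum_(F <- S) Phi F.

Lemma vol_weight1 n (S : seq 'M[R]_n) : vol (weight1 S) = volume S.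
Proof.
rewrite /vol /weight1 big_map; apply: eq_bigr => F _ /=.
by rewrite cst1 mul1r.
Qed.

Lemma meval_lin n (w u : 'rV[R]_n) :
  (lin w).@[fun i => iota (u 0 i)] = iota (dot w u).
Proof.
rewrite /lin /linf !raddf_sum; apply: eq_bigr => i _ /=.
by rewrite mevalZ mevalXU mxE rmorphM.
Qed.

(** At u0 all generators are positive, so every term has a positive value there and the terms cannot
    cancel. *)
Lemma volume_neq0 n (W : seq 'rV[R]_n) S : cover W S -> volume S != 0.
Proof.
move=> cS; have [u0 hu0] := cover_pointed cS.
pose ev := @meval n K (fun i => iota (u0 0 i)).
pose a F := `|\det F| / \prod_i dot (row i F) u0.
have ap F : F \in S -> 0 < a F.
  move=> FS; rewrite divr_gt0 ?normr_gt0 -?unitfE -?unitmxE ?(cover_unit cS) //.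
  by apply: prodr_gt0 => i _; apply/hu0/(cover_rows cS).
have hv F : F \in S -> val_at ev (Phi F) (tofrac (iota (a F))).
  move=> FS; have eb : ev (\prod_i lin (row i F)) = iota (\prod_i dot (row i F) u0).
    rewrite [RHS]rmorph_prod /ev rmorph_prod.
    by apply: eq_bigr => i _; apply: meval_lin.
  have p0 : \prod_i dot (row i F) u0 != 0.
    by apply/lt0r_neq0/prodr_gt0 => i _; apply/hu0/(cover_rows cS).
  have b0 : ev (\prod_i lin (row i F)) != 0 by rewrite eb fmorph_eq0.
  suff <- : (ev (iota `|\det F|)%:MP)%:F / (ev (\prod_i lin (row i F)))%:F =
    (iota (a F))%:F by exact: (val_at_frac (phi := ev) _ b0).
  rewrite eb /ev mevalC.
  have P0 : (iota (\prod_i dot (row i F) u0))%:F != 0.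
    by rewrite tofrac_eq0 fmorph_eq0.
  by apply: (mulIf P0); rewrite divfK // -tofracM -rmorphM divfK.
have hs : val_at ev (volume S) (\sum_(F <- S) tofrac (iota (a F))).
  rewrite /volume big_seq [X in val_at _ _ X]big_seq.
  by apply: val_at_sum => F FS; apply: hv.
have sp : 0 < \sum_(F <- S) a F.
  case: S {hs hv} cS ap => [|F S] cS ap; first by have := cover_nil cS.
  rewrite big_cons ltr_wpDr ?ap ?mem_head // big_seq.
  by apply: sumr_ge0 => G GS; rewrite ltW // ap // inE GS orbT.
apply/eqP => v0; rewrite v0 in hs.
have := val_at_uniq hs (val_at0 ev).
rewrite -rmorph_sum -rmorph_sum => /eqP.
by rewrite tofrac_eq0 fmorph_eq0 gt_eqF.
Qed.

Section Residues.
Variables (e : nat) (W : seq 'rV[R]_e.+2) (S : seq 'M[R]_e.+2).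
Variables (w : 'rV[R]_e.+2) (M : 'M[R]_e.+2).
Hypotheses (cS : cover W S) (w0 : w != 0) (wM : facet_chart w M).
Local Notation H := (hyp_mx M).
Local Notation scale := (`|dot w (row ix1 M)| / `|\det M|).

(** The projected cone contains a line, so the links have a translation invariant multiplicity, and
    [vol_line] makes the residue 0. *)
Lemma nonfacet_regular : w \in W -> ~ facet W w -> regular (lin w) (volume S).
Proof.
move=> wW nf; apply: (val_regular w0 (chart_hyper w0 wM)).
have [//|[v vW [v0 hv]]] := facet_or_line w0 (cone_mem wW) wM.
have uc : forall p, p \in links w M (weight1 S) -> p.2 \in unitmx.
  move=> p /allpairsPdep[[m F] [g [/mapP[F' FS [_ ->]] + ->]]].
  rewrite mem_filter => /andP[cg _] /=.
  exact: (link_unit w0 wM (cover_unit cS FS) cg).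
have tv : transl_inv (links w M (weight1 S)) (v *m H^T).
  have [L' [L'0 hL']] := links_cover cS w0 (cone_mem wW) wM.
  exists L'; split=> // x s gx gy; rewrite !hL' //; congr (_%:R).
  congr nat_of_bool; apply: asbool_equiv_eq.
  have pv : cone (proj W M) (v *m H^T) by apply/cone_mem/map_f.
  have sv t : cone (proj W M) (t *: (v *m H^T)).
    have [t0|t0] := leP 0 t; first exact: coneZ.
    rewrite -[t]opprK scaleNr -scalerN; apply: coneZ => //.
    by rewrite oppr_ge0 ltW.
  split=> h; first exact: coneD.
  by rewrite -[x](addrK (s *: (v *m H^T))) -scaleNr; apply: coneD.
rewrite -vol_weight1 -[0](mulr0 (cst _ scale)) -(vol_line iota uc v0 tv).
exact: (vol_residue iota w0 wM (weight1_unit (cover_unit cS))).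
Qed.

(** A cell with no generator on the ray of w has no pole along [lin w]; for the others the sum in
    [Phi_residue] reduces to one term with sign 1. *)
Lemma Phi_facet_residue F : facet W w -> F \in S ->
  val_at (sub (map_mx iota H)) ((lin w)%:F * Phi F)
    (\sum_(g | row g F *m H^T == 0) cst _ scale * Phi (link F M g)).
Proof.
move=> fw FS; have uF := cover_unit cS FS.
have hw : w *m H^T = 0 by case: (chart_hyper w0 wM).
have [[g hg]|/forallNP nr] := pselect (exists g, row g F *m H^T = 0).
  rewrite (facet_big cS fw wM _ FS hg).
  have [s s0 hs] := facet_cellcoord cS fw wM FS hg.
  have := Phi_residue iota w0 wM uF.
  rewrite (bigD1 g) /=; last by rewrite hs eqxx mulr1 lt0r_neq0.
  rewrite big1 ?addr0 => [|h /andP[+ hgh]]; last first.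
    by rewrite hs [g == h]eq_sym (negPf hgh) mulr0 eqxx.
  by rewrite hs eqxx mulr1 gtr0_sg // mul1r.
rewrite big1 => [|g /eqP hg]; last by have := nr g; rewrite hg.
have eb : sub (map_mx iota H) (\prod_i lin (row i F)) =
    \prod_i lin (row i F *m H^T).
  by rewrite rmorph_prod; apply: eq_bigr => i _; apply: sub_lin.
have b0 : sub (map_mx iota H) (\prod_i lin (row i F)) != 0.
  rewrite eb; apply/prodf_neq0 => i _; rewrite lin_eq0; exact/eqP/nr.
have := val_at_frac (phi := sub (map_mx iota H))
  (lin w * (iota `|\det F|)%:MP) b0.
rewrite tofracM -mulrA /=; congr (val_at _ _ _).
have -> : sub (map_mx iota H) (lin w * (iota `|\det F|)%:MP) = 0.
  rewrite rmorphM /= sub_lin hw; apply/eqP; rewrite mulf_eq0 lin_eq0.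
  by rewrite eqxx.
by rewrite tofrac0 mul0r.
Qed.

Lemma facet_residue : facet W w ->
  val_at (sub (map_mx iota H)) ((lin w)%:F * volume S)
    (cst _ scale * volume (facet_links S M)).
Proof.
move=> fw; rewrite /volume big_facet_links !mulr_sumr big_seq.
rewrite [X in val_at _ _ X]big_seq; apply: val_at_sum => F FS.
by rewrite mulr_sumr; apply: Phi_facet_residue.
Qed.

End Residues.

(** [reduce_linf] keeps only genuine poles, and by [nonfacet_regular] these are facets. *)
Lemma volume_repr e (W : seq 'rV[R]_e.+2) S : cover W S ->
  exists (s : seq 'rV[R]_e.+2) N k,
  [/\ forall w, w \in s -> w \in W /\ facet W w, N \is k.-homog,
      (k + e.+2 = size s)%N &
      volume S = N%:F / (\prod_(w <- s) lin w)%:F].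
Proof.
move=> cS; have uc := weight1_unit (cover_unit cS).
have [p [cells ec]] : exists p cells, weight1 S = p :: cells.
  by case: S cS {uc} => [/cover_nil|F S _] //; exists (1, F), (weight1 S).
rewrite ec in uc; have [N [hN eN]] := vol_repr iota uc.
have v0 := volume_neq0 cS; rewrite -{1}ec vol_weight1 in eN.
have [s' [N' [k' [ss hN' ks ef hr]]]] :=
  reduce_linf v0 (cell_rows_neq0 iota uc) hN eN.
have hs w' : w' \in s' -> exists w, [/\ w' = map_mx iota w, w \in W & facet W w].
  move=> ws; have [[m F] [i [+ ew]]] := cell_rowsP (ss _ ws).
  rewrite -ec => /mapP[F' FS [_ eF]]; rewrite /= eF in ew.
  have wW := cover_rows cS i FS.
  exists (row i F'); split; [exact: ew | exact: wW |].
  have w0 : row i F' != 0 by apply/unitmx_row_neq0/(cover_unit cS).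
  apply: contrapT => nf; have [M wM] := facet_chart_exists w0.
  by apply: (hr _ ws); rewrite ew; apply: (nonfacet_regular cS w0 wM wW nf).
(* The vectors of s' have coordinates in K; real generators are chosen from which they come. *)
have /choice[g hg] : forall w' : 'rV[K]_e.+2, exists w : 'rV[R]_e.+2,
    w' \in s' -> [/\ w' = map_mx iota w, w \in W & facet W w].
  move=> w'; have [/hs[w hw]|ns] := boolP (w' \in s'); first by exists w.
  by exists 0.
exists (map g s'), N', k'; split=> //.
- by move=> _ /mapP[w' ws ->]; have [_ h1 h2] := hg _ ws; split.
- move: ks; rewrite size_map size_cell_rows /=; move: (size s') => z.
  clear; lia.
- rewrite ef big_map; congr (_ / _%:F); rewrite big_seq [RHS]big_seq.
  by apply: eq_bigr => w' /hg[ew _ _]; rewrite /lin -ew.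
Qed.

End CoverVolume.

(** * Rational forms *)

Section Factors.
Variables (F : fieldType) (n : nat).
Implicit Types p q r : {mpoly F[n]}.

Lemma mpoly_unitE p : p \is a GRing.unit -> exists2 c, c != 0 & p = c%:MP.
Proof. by case/andP => /eqP e; rewrite unitfE => c0; exists p@_0%MM. Qed.

Lemma mpolyC_unit c : c != 0 -> (c%:MP : {mpoly F[n]}) \is a GRing.unit.
Proof.
by move=> c0; apply/unitrPr; exists (c^-1)%:MP; rewrite -mpolyCM mulfV // mpolyC1.
Qed.

Lemma msize_nonunit p : p != 0 -> p \isn't a GRing.unit -> (1 < msize p)%N.
Proof.
move=> p0; apply: contraR; rewrite -leqNgt => /msize1_polyC e; rewrite e.
by apply: mpolyC_unit; apply: contraNneq p0 => c0; rewrite e c0 mpolyC0.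
Qed.

Lemma msize_factor p q : p != 0 -> q != 0 -> p \isn't a GRing.unit ->
  (msize q < msize (p * q))%N.
Proof.
move=> p0 q0 pu; rewrite msizeM //; have := msize_nonunit p0 pu.
by move: (msize p) (msize q) => [|[|a]] // b _; rewrite !addSn /= ltnS leq_addl.
Qed.

Lemma pow_factor p q : p != 0 -> p \isn't a GRing.unit -> q != 0 ->
  exists j m, q = p ^+ j * m /\ ~ rdvd p m.
Proof.
move=> p0 pu; move: {2}(msize q) (leqnn (msize q)) => l.
elim: l q => [|l IH] q lq q0.
  by move: q0; rewrite -msize_poly_eq0 -leqn0 lq.
have [[r er]|h] := pselect (rdvd p q); last by exists 0%N, q; rewrite mul1r.
have r0 : r != 0 by apply: contraNneq q0 => r0; rewrite er r0 mulr0.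
have [||j [m [em hm]]] := IH r => //.
  by rewrite -ltnS (leq_trans _ lq) // er msize_factor.
by exists j.+1, m; rewrite er em mulrA exprS.
Qed.

Lemma irred_homog_factor k q : q != 0 -> q \is k.-homog ->
  q \isn't a GRing.unit -> exists p r, [/\ rirred p, q = p * r,
    exists j, p \is j.-homog & exists j, r \is j.-homog].
Proof.
move=> q0 hq qu; have [[|p s] [u [sp uu e]]] := factorial_mpoly q0.
  by move: qu; rewrite e big_nil mulr1 uu.
have pp := sp _ (mem_head _ _); set r := u * \prod_(j <- s) j.
have er : q = p * r by rewrite e big_cons mulrCA.
exists p, r; split=> //; first exact: rprime_irred.
  by apply: (@homog_factor _ _ k _ r); rewrite -er.
by apply: (@homog_factor _ _ k _ p); rewrite mulrC -er.
Qed.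

Definition order_at (f : {fraction {mpoly F[n]}}) p (k : int) : Prop :=
  exists a b, [/\ ~ rdvd p a, ~ rdvd p b & f = p%:F ^ k * (a%:F / b%:F)].

Lemma order_at_neg f p a b j : p != 0 -> b != 0 ->
  ~ rdvd p a -> ~ rdvd p b -> f = a%:F / (p ^+ j * b)%:F ->
  order_at f p (- j%:Z).
Proof.
move=> p0 b0 ha hb ->; exists a, b; split=> //.
by rewrite -exprnN tofracM tofracXn invfM mulrCA.
Qed.

Lemma homog_mul_deg k p q : p * q != 0 -> p * q \is k.-homog ->
  exists i j, [/\ p \is i.-homog, q \is j.-homog & k = (i + j)%N].
Proof.
move=> pq0 h; have [i hi] := homog_factor pq0 h.
have [||j hj] := @homog_factor _ _ k q p; rewrite 1?mulrC //.
exists i, j; split=> //; exact: (dhomog_uniq pq0 h (dhomogM hi hj)).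
Qed.

Lemma homog_const k (c : F) : c != 0 -> (c%:MP : {mpoly F[n]}) \is k.-homog -> k = 0%N.
Proof.
move=> c0 h; apply: (dhomog_uniq _ h); first by rewrite mpolyC_eq0.
by rewrite -alg_mpolyC; apply: dhomogZ; apply: dhomog1.
Qed.

(* f has at most a simple pole along {linf w = 0}. *)
Lemma homog_simple_pole (w : 'rV[F]_n) f N D k d : w != 0 -> f != 0 ->
  N \is k.-homog -> D \is (k + d)%N.-homog -> D != 0 -> f = N%:F / D%:F ->
  regular (linf w) ((linf w)%:F * f) ->
  exists a b i j, [/\ a \is i.-homog, b \is j.-homog, (j + 1 = i + d)%N,
    ~ rdvd (linf w) b & f = a%:F / (linf w * b)%:F].
Proof.
move=> w0 f0; have pL := linf_prime w0; have L0 : linf w != 0 by rewrite linf_eq0.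
have LF : (linf w)%:F != 0 by rewrite tofrac_eq0.
have uL : linf w \isn't a GRing.unit by case: pL.
move: {2}(msize D) (leqnn (msize D)) => l.
elim: l N D k => [|l IH] N D k lD hN hD D0 ef hr.
  by move: D0; rewrite -msize_poly_eq0 -leqn0 lD.
have N0 : N != 0 by apply: contraNneq f0 => N0; rewrite ef N0 tofrac0 mul0r.
have [[D' eD]|hD'] := pselect (rdvd (linf w) D); last first.
  exists (linf w * N), D, (1 + k)%N, (k + d)%N; split=> //.
  - exact: (dhomogM (linf_homog w) hN).
  - by rewrite addn1.
  - by rewrite ef !tofracM -mulf_div divff // mul1r.
have D'0 : D' != 0 by apply: contraNneq D0 => h; rewrite eD h mulr0.
have [i1 [j1 [h1 hj1 ed]]] : exists i j, [/\ linf w \is i.-homog, D' \is j.-homog &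
    (k + d = i + j)%N] by apply: homog_mul_deg; rewrite -eD.
have {}ed : (k + d = 1 + j1)%N by rewrite ed (dhomog_uniq L0 h1 (linf_homog w)).
have [[D2 eD2]|hD2] := pselect (rdvd (linf w) D'); last first.
  exists N, D', k, j1; split=> //; first by rewrite ed addnC.
  by rewrite ef eD.
have D20 : D2 != 0 by apply: contraNneq D'0 => h; rewrite eD2 h mulr0.
have [|r [eN ef2]] := regular_cancel pL D20 hr (a := N).
  rewrite ef eD eD2 !tofracM !invfM.
  by rewrite mulrCA (mulrA (linf w)%:F) divff // mul1r.
have [i2 [j2 [h2 hj2 ek]]] : exists i j, [/\ linf w \is i.-homog, r \is j.-homog &
    k = (i + j)%N] by apply: homog_mul_deg; rewrite -eN.
have {}ek : k = (1 + j2)%N by rewrite ek (dhomog_uniq L0 h2 (linf_homog w)).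
apply: (IH r D' j2) => //.
- by rewrite -ltnS (leq_trans _ lD) // eD msize_factor.
- suff -> : (j2 + d)%N = j1 by [].
  by move: ed; rewrite ek -addnA !add1n => -[].
- by rewrite ef eD eN !tofracM -mulf_div divff // mul1r.
Qed.

End Factors.

Section Reduction.
Variables (R : realType) (K : fieldType) (iota : {rmorphism R -> K}).
Local Notation lin := (lin iota).

Lemma prod_lin_homog n (s : seq 'rV[R]_n) : \prod_(w <- s) lin w \is (size s).-homog.
Proof.
have := prod_linf_homog (map (map_mx iota) s).
by rewrite size_map big_map.
Qed.

Lemma prod_lin_seq_neq0 n (s : seq 'rV[R]_n) :
  (forall w, w \in s -> w != 0) -> \prod_(w <- s) lin w != 0.
Proof.
by move=> h; rewrite prodf_seq_neq0; apply/allP => w /h w0; rewrite /= lin_eq0.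
Qed.

(** Irreducible factors of D are removed one at a time: such a factor either cancels against N or is
    a pole, hence one of the allowed linear forms, and moves to s. *)
Lemma pole_reduce n d (Q : 'rV[R]_n -> Prop) (f : {fraction {mpoly K[n]}}) N D k :
  (forall w, Q w -> w != 0) -> f != 0 ->
  (forall p k, rirred p -> (exists j, p \is j.-homog) -> order_at f p k -> k < 0 ->
     exists w c, Q w /\ p = c *: lin w) ->
  N \is k.-homog -> D \is (k + d).-homog -> D != 0 -> f = N%:F / D%:F ->
  exists (s : seq 'rV[R]_n) N' k', [/\ forall w, w \in s -> Q w, N' \is k'.-homog,
    (k' + d = size s)%N & f = N'%:F / (\prod_(w <- s) lin w)%:F].
Proof.
move=> Q0 f0 hp.
suff gen_case l (s : seq 'rV[R]_n) N1 D1 k1 j1 : (msize D1 <= l)%N ->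
    (forall w, w \in s -> Q w) ->
    N1 \is k1.-homog -> D1 \is j1.-homog -> D1 != 0 -> (k1 + d = j1 + size s)%N ->
    f = N1%:F / (D1 * \prod_(w <- s) lin w)%:F ->
    exists (s : seq 'rV[R]_n) N' k', [/\ forall w, w \in s -> Q w, N' \is k'.-homog,
      (k' + d = size s)%N & f = N'%:F / (\prod_(w <- s) lin w)%:F].
  move=> hN hD D0 ef; apply: (gen_case _ [::] N D k (k + d)%N (leqnn _)) => //.
    by rewrite addn0.
  by rewrite big_nil mulr1.
elim: l s N1 D1 k1 j1 => [|l IH] s N1 D1 k1 j1 lD hs hN hD D0 ek ef.
  by move: D0; rewrite -msize_poly_eq0 -leqn0 lD.
have N0 : N1 != 0 by apply: contraNneq f0 => N0; rewrite ef N0 tofrac0 mul0r.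
have P0 : \prod_(w <- s) lin w != 0 by apply: prod_lin_seq_neq0 => w /hs/Q0.
have [Du|Du] := boolP (D1 \is a GRing.unit).
  have [c c0 ec] := mpoly_unitE Du.
  rewrite ec in hD; have j0 := homog_const c0 hD.
  exists s, (c^-1 *: N1), k1; split=> //; first exact: dhomogZ.
    by rewrite ek j0.
  have C0 : (c%:MP : {mpoly K[n]}) != 0 by rewrite mpolyC_eq0.
  rewrite ef ec; apply: (proj2 (eq_tofrac _ _ _ _)); rewrite ?mulf_neq0 //.
  rewrite -mul_mpolyC mulrACA -mpolyCM mulVf // mpolyC1 mul1r mulrC.
  by rewrite mulrC.
have [p [D' [ip eD [i hpi] [j' hD']]]] := irred_homog_factor D0 hD Du.
have [p0 pu _] := ip.
have D'0 : D' != 0 by apply: contraNneq D0 => h; rewrite eD h mulr0.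
have lD' : (msize D' <= l)%N by rewrite -ltnS (leq_trans _ lD) // eD msize_factor.
have ej : j1 = (i + j')%N.
  by apply: (dhomog_uniq _ hD); rewrite // eD; apply: dhomogM.
have pF : p%:F != 0 by rewrite tofrac_eq0.
have [[N' eN]|hN'] := pselect (rdvd p N1).
  have [i2 [k2 [h2 hN2 ek2]]] : exists i j, [/\ p \is i.-homog, N' \is j.-homog &
    k1 = (i + j)%N] by apply: homog_mul_deg; rewrite -eN.
  have ei : i2 = i by apply: dhomog_uniq h2 hpi.
  apply: (IH s N' D' k2 j') => //.
    by apply/eqP; rewrite -(eqn_add2l i) !addnA -ej -ei -ek2 ek.
  by rewrite ef eN eD -mulrA !(tofracM p) -mulf_div divff // mul1r.
have DP0 : D' * \prod_(w <- s) lin w != 0 by rewrite mulf_neq0.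
(* p may divide the rest of the denominator too, including the forms already collected; the order of
   the pole is j + 1. *)
have [j [m [em hm]]] := pow_factor p0 pu DP0.
have m0 : m != 0 by apply: contraNneq DP0 => h; rewrite em h mulr0.
have [w [c [Qw ep]]] : exists w c, Q w /\ p = c *: lin w.
  apply: (hp p (- j.+1%:Z)) => //; first by exists i.
  apply: (order_at_neg p0 m0 hN' hm).
  by rewrite ef eD -mulrA em mulrA -exprS.
have c0 : c != 0 by apply: contraNneq p0 => c0; rewrite ep c0 scale0r.
have i1 : i = 1%N.
  apply: (dhomog_uniq p0 hpi); rewrite ep; apply: dhomogZ; exact: linf_homog.
apply: (IH (w :: s) (c^-1 *: N1) D' k1 j') => //.
- by move=> v; rewrite inE => /orP[/eqP->|/hs].
- exact: dhomogZ.
- by rewrite ek ej i1 /= addnS addnAC add1n addSn addnC.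
have lw0 : lin w != 0 by rewrite lin_eq0 Q0.
rewrite ef; apply: (proj2 (eq_tofrac _ _ _ _)).
- by rewrite !mulf_neq0.
- by rewrite big_cons !mulf_neq0.
rewrite eD ep big_cons -!scalerAl -scalerAr scalerA mulVf // scale1r.
by congr (_ * _); rewrite mulrCA mulrA.
Qed.

Lemma pole_factor n (s : seq 'rV[R]_n) N p j k f : (forall w, w \in s -> w != 0) ->
  rirred p -> p \is j.-homog -> order_at f p k -> k < 0 ->
  f = N%:F / (\prod_(w <- s) lin w)%:F ->
  exists w c, w \in s /\ p = c *: lin w.
Proof.
move=> s0 ip hp [a [b [ha hb ef]]] k0 ef2.
have pp := factorial_irred_prime (factorial_mpoly (n := n)) ip.
have [p0 pu p_dvd] := pp.
have P0 := prod_lin_seq_neq0 s0.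
have b0 : b != 0 by apply: contra_not_neq hb => ->; apply: rdvd0.
have [m em] : exists m : nat, k = - m.+1%:Z by case: k k0 {ef} => // m _; exists m.
have : rdvd p (a * \prod_(w <- s) lin w).
  have e1 : a%:F / (p ^+ m.+1 * b)%:F = N%:F / (\prod_(w <- s) lin w)%:F.
    by rewrite -ef2 ef em -exprnN tofracM tofracXn invfM mulrCA.
  have pb0 : p ^+ m.+1 * b != 0 by rewrite mulf_neq0 // expf_neq0.
  rewrite (proj1 (eq_tofrac _ _ pb0 P0) e1) exprS.
  by exists (N * (p ^+ m * b)); ring.
case/p_dvd => // {}ha.
have [w ws dw] : exists2 w, w \in s & rdvd p (lin w).
  have := rprime_dvd_prod (s := [seq lin w | w <- s]) (u := 1) pp (unitr1 _).
  rewrite mul1r big_map => /(_ ha)[q /mapP[w ws ->] dq]; by exists w.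
have w0 := s0 w ws; have pL : rprime (lin w) by apply: linf_prime; rewrite map_mx_eq0.
have [u uu eu] := rprime_assoc pp pL dw.
have [c c0 ec] := mpoly_unitE uu.
exists w, c^-1; split=> //.
by rewrite eu ec mulrC mul_mpolyC scalerA mulVf // scale1r.
Qed.

(** A nonzero residue makes the order exactly -1: neither the numerator nor the denominator of its
    representative is divisible by [lin w]. *)
Lemma order_of_val n (A : idomainType) (phi : {rmorphism {mpoly K[n]} -> A})
    (w : 'rV[R]_n) f g : w != 0 -> phi (lin w) = 0 ->
  val_at phi ((lin w)%:F * f) g -> g != 0 -> order_at f (lin w) (- 1).
Proof.
move=> w0 pw [a [b [b0 e1 e2]]] g0; exists a, b; split.
- move/(rdvd_ker pw) => a0; case/eqP: g0.
  by rewrite e2 a0 tofrac0 mul0r.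
- by move/(rdvd_ker pw)/eqP; rewrite (negPf b0).
- by rewrite exprN1 -e1 mulrA mulVf ?mul1r // tofrac_eq0 lin_eq0.
Qed.

End Reduction.

Lemma mulf_cancel (E : fieldType) (x a b : E) :
  x != 0 -> x * (a / (x * b)) = a / b.
Proof.
move=> x0; rewrite invfM.
have -> : x * (a * (x^-1 * b^-1)) = a * b^-1 * (x * x^-1) by ring.
by rewrite mulfV // mulr1.
Qed.

Section RationalForms.
Variable R : realType.
Local Notation C := R[i].
Local Notation iota := (real_complex R).
Local Notation lin := (lin iota).
Local Notation cst := (cst iota).

Lemma toC_linform n (w : 'rV[R]_n) : toC (linform w) = lin w.
Proof.
rewrite /toC /linform /lin /linf raddf_sum; apply: eq_bigr => i _ /=.
by rewrite map_mpolyZ map_mpolyX mxE.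
Qed.

Lemma chart_coefE d (M : 'M[R]_d.+1) (Om : ratform R d) :
  chart_coef M Om = ((iota (\det M))%:MP)%:F *
    ((deh (sub (map_mx iota M) (num Om)))%:F /
     (deh (sub (map_mx iota M) (den Om)))%:F).
Proof. by rewrite /chart_coef -!comp_chart. Qed.

Lemma chart_coef1E d (Om : ratform R d) :
  chart_coef 1%:M Om = (deh (num Om))%:F / (deh (den Om))%:F.
Proof.
by rewrite chart_coefE det1 -/(cst d 1) cst1 mul1r map_mx1 !sub1.
Qed.

Lemma chart_coef1_hcoef d (Om : ratform R d) k (a b : {mpoly C[d.+1]}) :
  a \is k.-homog -> b \is (k + d.+1).-homog -> b != 0 ->
  (chart_coef 1%:M Om = (deh a)%:F / (deh b)%:F <-> hcoef Om = a%:F / b%:F).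
Proof.
move=> ha hb b0; rewrite chart_coef1E /hcoef.
have [j [hn hd]] := num_den_homog Om; have D0 := den_neq0 Om.
split; first exact: (deh_frac_inj hn hd ha hb D0 b0).
move=> e; apply: (@morph_frac _ _ (@deh C d)) => //=.
  exact: (deh_neq0 hd).
exact: (deh_neq0 hb).
Qed.

Section Residue.
Variables (e : nat) (w : 'rV[R]_e.+2) (M : 'M[R]_e.+2).
Hypotheses (w0 : w != 0) (wM : facet_chart w M).
Local Notation H := (map_mx iota (hyp_mx M)).
Local Notation beta := (dot w (row ix1 M)).

Let wC0 : map_mx iota w != 0. Proof. by rewrite map_mx_eq0. Qed.

Let wH : hyper (map_mx iota w) H.
Proof. exact/hyper_map/chart_hyper. Qed.

(** Moves the affine definition of the residue to homogeneous coordinates. The existence of a value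
    g makes the pole at most simple, so [residue_chart] applies; there a / b has degree -(e+1), that
    of a form on P^e, and the chart z_0 = 1 loses nothing. *)
Lemma residue_hcoef (Om : ratform R e.+1) (eta : ratform R e) g :
  num Om != 0 -> val_at (sub H) ((lin w)%:F * hcoef Om) g ->
  (residue M Om eta <-> hcoef eta = cst e.+1 (\det M / beta) * g).
Proof.
move=> n0 hv; have [j [hn hd]] := num_den_homog Om; have D0 := den_neq0 Om.
have f0 : hcoef Om != 0 by rewrite mulf_neq0 // ?invr_eq0 tofrac_eq0.
have rg : regular (lin w) ((lin w)%:F * hcoef Om).
  have [a [b [b0 e1 _]]] := hv; exists a, b; split=> // h.
  by move/eqP: b0; apply; apply: rdvd_ker h; apply: sub_hyper wH.
have [a [b [i [k [ha hb ek nb ef]]]]] :=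
  homog_simple_pole wC0 f0 hn hd D0 (erefl _) rg.
have sb : sub H b != 0 by apply: (sub_neq0 wH).
have eg : g = (sub H a)%:F / (sub H b)%:F.
  apply: (val_at_uniq hv); have := val_at_frac (phi := sub H) a sb.
  by rewrite -(mulf_cancel (x := (lin w)%:F)) ?tofrac_eq0 ?lin_eq0 // -tofracM -ef.
have [uM _] := wM.
have uMC : map_mx iota M \in unitmx by rewrite map_unitmx.
have wMC : map_mx iota w *m (map_mx iota M)^T =
    iota beta *: delta_mx 0 (lift ord0 ord0).
  by rewrite matrix.map_trmx -map_mxM (facet_chartE wM) map_mxZ map_delta_mx.
have eH : row' (lift ord0 ord0) (map_mx iota M) = H.
  by apply/matrixP => i' j'; rewrite !mxE.
have sb' : sub (row' (lift ord0 ord0) (map_mx iota M)) b != 0 by rewrite eH.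
have rc := residue_chart uMC wC0 wMC (iota (\det M)) hd D0 hb sb' ef
   (chart_coef 1%:M eta).
have b0 : iota beta != 0 by rewrite fmorph_eq0 (chart_beta_neq0 w0 wM).
have ec : ((iota (\det M) / iota beta)%:MP)%:F *
    ((deh (sub H a))%:F / (deh (sub H b))%:F) =
    (deh ((iota (\det M / beta))%:MP * sub H a))%:F / (deh (sub H b))%:F.
  rewrite mulrA -tofracM; congr (_%:F / _).
  rewrite [in RHS]mul_mpolyC dehZ -mul_mpolyC; congr (_%:MP * _).
  exact/esym/fmorph_div.
rewrite eH ec in rc.
have hcoefE : hcoef eta = cst e.+1 (\det M / beta) * g <->
    chart_coef 1%:M eta = (deh ((iota (\det M / beta))%:MP * sub H a))%:F /
      (deh (sub H b))%:F.
  rewrite eg mulrA -tofracM; apply: iff_sym; apply: (@chart_coef1_hcoef _ _ i).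
  - by rewrite mul_mpolyC; apply: dhomogZ; apply: sub_homog.
  - have -> : (i + e.+1)%N = k by move: ek; rewrite addn1 addnS => -[].
    exact: sub_homog.
  - exact: sb.
split=> [[n [m [m0 e1 e2]]]|/hcoefE /rc [n [m [m0 e1 e2]]]].
  apply/hcoefE/rc; exists n, m; split=> //.
  by rewrite -chart_coefE.
by exists n, m; split=> //; rewrite chart_coefE.
Qed.

End Residue.
End RationalForms.

(** * Orientations *)

Section Orientation.
Variable R : realType.

Lemma col_mx_ord0 m n (u : 'rV[R]_n) (V : 'M[R]_(m, n)) k :
  (col_mx u V : 'M[R]_(m.+1, n)) ord0 k = u 0 k.
Proof. by rewrite mxE; case: splitP => // j _; rewrite ord1. Qed.

Lemma col_mx_lift m n (u : 'rV[R]_n) (V : 'M[R]_(m, n)) j k :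
  (col_mx u V : 'M[R]_(m.+1, n)) (lift ord0 j) k = V j k.
Proof.
rewrite mxE; case: splitP => [i /= h|i /= [h]]; first by have := ltn_ord i; rewrite -h.
by congr (V _ _); apply/val_inj.
Qed.

Section FacetOrientation.
Variables (e : nat) (w : 'rV[R]_e.+2) (M : 'M[R]_e.+2).
Hypotheses (w0 : w != 0) (wM : facet_chart w M).
Local Notation H := (hyp_mx M).
Local Notation beta := (dot w (row ix1 M)).

(** In the basis of the rows of M, vectors of the hyperplane have no component along row [ix1], and
    n has the component dot w n / beta; the determinant is expanded along that column. *)
Lemma facet_det (y : 'rV[R]_e.+1) (n : 'rV[R]_e.+2) (V : 'M[R]_(e, e.+1)) :
  \det (col_mx (y *m H) (col_mx n (V *m H)) : 'M[R]_e.+2) =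
  dot w n / beta * \det M * \det (col_mx y V : 'M[R]_e.+1).
Proof.
have [uM _] := wM.
pose X : 'M[R]_e.+2 := col_mx (y *m H) (col_mx n (V *m H)); rewrite -/X; pose Y := X *m invmx M.
have -> : X = Y *m M by rewrite mulmxKV.
rewrite det_mulmx mulrAC; congr (_ * _).
have HM : H *m invmx M = row' ix1 1%:M.
  by rewrite /hyp_mx -row'_mulmx -mulmxA mulmxV // mulmx1.
have rX : row' ix1 X = (col_mx y V : 'M[R]_e.+1) *m H.
  apply/matrixP => i k; rewrite [LHS]mxE.
  have -> : ((col_mx y V : 'M[R]_e.+1) *m H) i k =
      \sum_l (col_mx y V : 'M[R]_e.+1) i l * H l k by rewrite mxE.
  case: (unliftP ord0 i) => [j ->|->].
    have -> : lift ix1 (lift ord0 j) = lift ord0 (lift ord0 j) :> 'I_e.+2.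
      exact/val_inj.
    rewrite /X (@col_mx_lift e.+1) col_mx_lift mxE.
    by apply: eq_bigr => l _; rewrite col_mx_lift.
  have -> : lift ix1 ord0 = ord0 :> 'I_e.+2 by apply/val_inj.
  rewrite /X (@col_mx_ord0 e.+1) mxE.
  by apply: eq_bigr => l _; rewrite col_mx_ord0.
have rY : row' ix1 Y = (col_mx y V : 'M[R]_e.+1) *m row' ix1 1%:M.
  rewrite -HM mulmxA -rX; apply/matrixP => i j; rewrite !mxE.
  by apply: eq_bigr => k _; rewrite [in RHS]mxE.
have Yn : row ix1 Y = n *m invmx M.
  rewrite row_mul; congr (_ *m _); apply/rowP => k; rewrite mxE.
  by rewrite /X /ix1 (@col_mx_lift e.+1) col_mx_ord0.
rewrite (expand_det_col Y ix1) (bigD1 ix1) //= big1 ?addr0 => [|i i1]; last first.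
  case: (unliftP ix1 i) i1 => [j -> _|->]; last by rewrite eqxx.
  have -> : Y (lift ix1 j) ix1 = (row' ix1 Y) j ix1 by rewrite [RHS]mxE.
  rewrite rY mxE big1 ?mul0r // => k _; rewrite !mxE.
  by rewrite eq_sym (negPf (neq_lift _ _)) mulr0.
rewrite /cofactor addnn -signr_odd odd_double expr0 mul1r.
have -> : row' ix1 (col' ix1 Y) = col_mx y V.
  apply/matrixP => i j; have -> : row' ix1 (col' ix1 Y) i j =
    (row' ix1 Y) i (lift ix1 j) by rewrite [LHS]mxE [LHS]mxE [RHS]mxE.
  rewrite rY mxE (bigD1 j) //= !mxE eqxx mulr1 big1 ?addr0 // => k kj.
  by rewrite !mxE (inj_eq lift_inj) (negPf kj) mulr0.
congr (_ * _); have b0 := chart_beta_neq0 w0 wM.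
apply: (mulIf b0); rewrite divfK //.
have -> : Y ix1 ix1 = (n *m invmx M) 0 ix1 by rewrite -Yn [RHS]mxE.
have -> : dot w n = dot w (n *m invmx M *m M) by rewrite mulmxKV.
rewrite dot_mulmx (facet_chartE wM) dotZl mulrC; congr (_ * _).
rewrite /dot (bigD1 ix1) //= [delta_mx _ _ _ _]mxE !eqxx mul1r big1 ?addr0 //.
by move=> i i1; rewrite [delta_mx _ _ _ _]mxE (negPf i1) andbF mul0r.
Qed.

Definition facet_sign (s : bool) : bool := s (+) (\det M * beta < 0).

Lemma facet_signE s : (-1) ^+ facet_sign s = (-1) ^+ s * Num.sg (\det M * beta) :> R.
Proof.
have b0 : \det M * beta != 0.
  rewrite mulf_neq0 ?(chart_beta_neq0 w0 wM) // -unitfE -unitmxE.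
  by case: wM.
rewrite /facet_sign signr_addb; congr (_ * _).
by case: ltgtP b0 => // h _; rewrite ?expr1 ?expr0 ?(gtr0_sg h) ?(ltr0_sg h).
Qed.

Lemma facet_orientation_sign K s : facet_orientation K w M s (facet_sign s).
Proof.
move=> y n V _ wn; rewrite /pos_frame facet_det facet_signE.
have b0 := chart_beta_neq0 w0 wM.
have m0 : \det M != 0 by rewrite -unitfE -unitmxE; case: wM.
set D := \det (col_mx y V).
have -> : (-1) ^+ s * (dot w n / beta * \det M * D) =
    ((-1) ^+ s * Num.sg (\det M * beta) * D) * (dot w n * `|\det M / beta|).
  rewrite normrEsg.
  have -> : Num.sg (\det M / beta) = Num.sg (\det M * beta).
    by rewrite !sgrM sgrV.
  have : Num.sg (\det M * beta) * Num.sg (\det M * beta) = 1.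
    by rewrite -expr2 sqr_sg mulf_neq0.
  move: (Num.sg _) => sg hsg.
  have -> : (-1) ^+ s * sg * D * (dot w n * (sg * (\det M / beta))) =
    (sg * sg) * ((-1) ^+ s * (dot w n / beta * \det M * D)) by ring.
  by rewrite hsg mul1r.
rewrite [RHS]pmulr_lgt0 // mulr_gt0 // normr_gt0 mulf_neq0 //.
by rewrite invr_eq0.
Qed.

End FacetOrientation.

Lemma complete_frame n (y : 'rV[R]_n.+1) : y != 0 ->
  exists V : 'M[R]_(n, n.+1), \det (col_mx y V : 'M[R]_n.+1) != 0.
Proof.
move=> y0; pose E : 'M[R]_(1 + n) := row_ebase y; pose c := col_ebase y 0 0.
have uE : E \in unitmx by apply: row_ebase_unit.
have uc : col_ebase y \in unitmx by apply: col_ebase_unit.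
have c0 : c != 0 by move: uc; rewrite unitmxE det_mx11 unitfE.
have ey : y = c *: usubmx E.
  rewrite -[LHS](mulmx_ebase y) rank_rV y0; apply/rowP => j.
  rewrite !mxE (bigD1 ord0) //= !mxE big_ord1 !mxE /= mulr1.
  rewrite big1 ?addr0 => [|i i0]; last first.
    rewrite !mxE big_ord1 !mxE /= eq_sym.
    by rewrite -val_eqE /= in i0; rewrite (negPf i0) mulr0 mul0r.
  by congr (_ * E _ _); apply/val_inj.
exists (dsubmx E).
have -> : (col_mx y (dsubmx E) : 'M_n.+1) = block_mx c%:M 0 0 1%:M *m E.
  rewrite -[E in RHS]vsubmxK mul_block_col mul_scalar_mx mul0mx addr0 -ey.
  by rewrite mul0mx add0r mul1mx.
have dc : \det (block_mx c%:M 0 0 1%:M : 'M[R]_(1 + n)) = c.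
  by rewrite det_ublock det1 mulr1 det_scalar1.
by rewrite det_mulmx dc mulf_neq0 // -unitfE -unitmxE.
Qed.

(** [canonical_form] only provides some orientation of a facet; one nonzero point of the facet,
    completed to a basis, determines it. *)
Lemma facet_orientation_uniq e K (w : 'rV[R]_e.+2) M s s1 s2 y : w != 0 ->
  facet_cone K w M y -> y != 0 ->
  facet_orientation K w M s s1 -> facet_orientation K w M s s2 -> s1 = s2.
Proof.
move=> w0 hy y0 h1 h2; have [V dV] := complete_frame y0.
have := h1 y w V hy (dot_self w0); rewrite -(h2 y w V hy (dot_self w0)).
rewrite /pos_frame; set D := \det _ in dV *; case: s1 s2 {h1 h2} => -[] //.
  by rewrite expr1 expr0 !mul1r mulN1r oppr_gt0; case: ltgtP dV.
by rewrite expr1 expr0 !mul1r mulN1r oppr_gt0; case: ltgtP dV.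
Qed.

End Orientation.

(** * Canonical forms and dual volumes *)

Section CanonicalVolume.
Variable R : realType.
Local Notation C := R[i].
Local Notation iota := (real_complex R).
Local Notation lin := (lin iota).
Local Notation cst := (cst iota).
Local Notation volume := (volume iota).

Lemma form_exists d (W : seq 'rV[R]_d.+1) S c : cover W S ->
  exists Om : ratform R d, hcoef Om = cst d.+1 c * volume S.
Proof.
move=> cS; have uc := weight1_unit (cover_unit cS).
have [p [cells ec]] : exists p cells, weight1 S = p :: cells.
  by case: S cS {uc} => [/cover_nil|F S _] //; exists (1, F), (weight1 S).
rewrite ec in uc; have [N [hN eN]] := vol_repr iota uc.
have D0 := prod_linf_neq0 (cell_rows_neq0 iota uc).
have hD := prod_linf_homog (cell_rows iota (p :: cells)).
rewrite size_cell_rows /= mulSn addnC in hD.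
have hom : exists k : nat, iota c *: N \is k.-homog /\
    \prod_(w <- cell_rows iota (p :: cells)) linf w \is (k + d.+1).-homog.
  by exists (size cells * d.+1)%N; split=> //; apply: dhomogZ.
exists (RatForm D0 hom).
by rewrite /hcoef /= -mul_mpolyC tofracM -vol_weight1 ec eN mulrA.
Qed.

Lemma val_cst m n (H : 'M[C]_(m, n)) c f g : val_at (sub H) f g ->
  val_at (sub H) (cst n c * f) (cst m c * g).
Proof.
apply: val_atM; have := val_at_tofrac (sub H) (iota c)%:MP.
by rewrite /= subC.
Qed.

(** With m = det M and b = beta, the residue of a form contributes m / b and that of the dual volume
    |b| / |m|; what is left is the sign in [facet_sign]. *)
Lemma sign_scale (m b : R) : m != 0 -> b != 0 ->
  m / b * (`|b| / `|m|) = Num.sg (m * b).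
Proof.
move=> m0 b0; rewrite sgrM.
have {1}-> := numEsg m; have {1}-> := numEsg b.
have n1 : `|m| != 0 by rewrite normr_eq0.
have n2 : `|b| != 0 by rewrite normr_eq0.
have e : Num.sg b * Num.sg b = 1 by rewrite -expr2 sqr_sg b0.
have s0 : Num.sg b != 0 by rewrite sgr_eq0.
have -> : (Num.sg b * `|b|)^-1 = Num.sg b * `|b|^-1.
  by apply: (mulIf (mulf_neq0 s0 n2)); rewrite mulVf ?mulf_neq0 // mulrACA e mul1r mulVf.
rewrite [X in X = _](_ : _ = (Num.sg m * Num.sg b) * (`|m| * `|m|^-1) * (`|b|^-1 * `|b|)); last by ring.
by rewrite mulfV // mulVf // !mulr1.
Qed.

(** Sections of a cone are dual to projections of its dual, by [dot_mulmx]; the zero projections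
    impose no condition. *)
Lemma facet_cone_dualc e (W : seq 'rV[R]_e.+2) w M : w != 0 -> facet_chart w M ->
  facet_cone (dualc W) w M = dualc (facet_gens W M).
Proof.
move=> w0 wM; apply/seteqP; split=> y /=.
  move=> [h _] v; rewrite mem_filter => /andP[_ /mapP[u uW ->]].
  by rewrite -dot_mulmx; apply: h.
move=> h; split; last exact: chart_ortho w0 wM _.
move=> v vW; rewrite dot_mulmx.
have [->|v0] := eqVneq (v *m (hyp_mx M)^T) 0; first by rewrite dot0l.
by apply: h; rewrite mem_filter v0; apply: map_f.
Qed.

(** The vectors of a half-line and the generators of its dual have the same sign, and by [vol1E] the
    dual volume is this sign divided by z_0. *)
Lemma canonical_volume0 W S K s (Om : ratform R 0) : cover W S -> K = dualc W ->
  canonical_form K s Om <-> hcoef Om = cst 1 ((-1) ^+ s) * volume S.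
Proof.
move=> cS eK; have [u0 hu0] := cover_pointed cS.
have [w wW] : exists w, w \in W.
  case: S cS => [/cover_nil|F S cS] //.
  by exists (row ord0 F); apply: (cover_rows cS); rewrite mem_head.
have dot1 (a b : 'rV[R]_1) : dot a b = a 0 0 * b 0 0 by rewrite /dot big_ord1.
have wu0 : 0 < w 0 0 * u0 0 0 by rewrite -dot1 hu0.
have w0 : w 0 0 != 0 by apply: contraTneq wu0 => ->; rewrite mul0r ltxx.
have volE : volume S = cst 1 (Num.sg (w 0 0)) / ('X_ord0)%:F.
  rewrite -vol_weight1 vol1E; last exact/weight1_unit/(cover_unit cS).
  congr (cst 1 _ / _); have [L [L0 hL]] := cover_count cS.
  have g1 c : c != 0 -> gen L (const_mx c).
    move=> c0 l /L0 l0; rewrite dot1 mxE mulf_neq0 //.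
    by apply: contraNneq l0 => l00; apply/eqP/rowP => i; rewrite ord1 l00 mxE.
  have h1 (c : R) : c != 0 ->
      count_at (weight1 S) (const_mx c) = (0 < w 0 0 * c)%R%:R.
    move=> c0; rewrite count_weight1 hL; last exact: g1.
    congr (_%:R); congr nat_of_bool; apply/asboolP/idP => [h|wc].
      have : 0 < dot (const_mx c : 'rV[R]_1) u0.
        apply: (cone_dot_gt0 hu0) => //.
        by apply: contraNneq c0 => /rowP/(_ 0); rewrite !mxE => ->.
      rewrite dot1 mxE => cu.
      have : 0 < (w 0 0 * u0 0 0) * (c * u0 0 0) by rewrite mulr_gt0.
      have -> : (w 0 0 * u0 0 0) * (c * u0 0 0) = (w 0 0 * c) * (u0 0 0 ^+ 2) by ring.
      have u00 : u0 0 0 != 0 by apply: contraTneq wu0 => ->; rewrite mulr0 ltxx.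
      by rewrite pmulr_lgt0 // exprn_even_gt0.
    have -> : const_mx c = (c / w 0 0) *: w :> 'rV[R]_1.
      by apply/rowP => i; rewrite ord1 !mxE divfK.
    apply: coneZ; last exact: cone_mem.
    have -> : c / w 0 0 = (w 0 0 * c) / (w 0 0 ^+ 2).
      by field.
    by rewrite divr_ge0 ?sqr_ge0 // ltW.
  rewrite !h1 ?oppr_eq0 ?oner_neq0 // mulr1 mulrN1 oppr_gt0.
  by case: (ltgtP (w 0 0) 0) w0 => // h _; rewrite ?(gtr0_sg h) ?(ltr0_sg h) ?subr0 ?sub0r.
pose c := (-1) ^+ s * Num.sg (w 0 0).
have X0 : 'X_ord0 != 0 :> {mpoly C[1]} by rewrite -msize_poly_eq0 msizeX.
have sgn u : K u -> u != 0 ->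
    (if pos_frame s u (0 : 'M[R]_(0, 1)) then 1 else -1) = cst 0 c.
  rewrite eK => /(_ w wW); rewrite dot1 => wu un.
  have u00 : u 0 0 != 0.
    by apply: contraNneq un => l00; apply/eqP/rowP => i; rewrite ord1 l00 mxE.
  have -> : pos_frame s u (0 : 'M[R]_(0, 1)) = (0 < (-1) ^+ s * u 0 0).
    by rewrite /pos_frame det_mx11 (@col_mx_ord0 R 0).
  have cN1 : cst 0 (-1) = -1.
    by apply/eqP; rewrite -subr_eq0 opprK -(cst1 iota 0) -cstD addNr cst0.
  rewrite /c; have -> : Num.sg (w 0 0) = Num.sg (u 0 0).
    have h : 0 < w 0 0 * u 0 0 by rewrite lt_neqAle wu andbT eq_sym mulf_neq0.
    have := gtr0_sg h; rewrite sgrM => e.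
    have : Num.sg (u 0 0) * Num.sg (u 0 0) = 1 by rewrite -expr2 sqr_sg u00.
    have s0 : Num.sg (u 0 0) != 0 by rewrite sgr_eq0.
    by move=> e'; apply: (mulIf s0); rewrite e e'.
  case: s {c}; case: (ltgtP (u 0 0) 0) u00 => // h _.
  - by rewrite expr1 mulN1r oppr_gt0 h (ltr0_sg h) mulrNN mulr1 cst1.
  - by rewrite expr1 mulN1r oppr_gt0 ltNge (ltW h) (gtr0_sg h) mulr1 cN1.
  - by rewrite expr0 !mul1r ltNge (ltW h) (ltr0_sg h) cN1.
  - by rewrite expr0 !mul1r h (gtr0_sg h) cst1.
have -> : cst 1 ((-1) ^+ s) * volume S = ((iota c)%:MP)%:F / ('X_ord0)%:F.
  by rewrite volE mulrA -cstM.
have e0 : (deh (iota c)%:MP)%:F / (deh ('X_ord0 : {mpoly C[1]}))%:F = cst 0 c.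
  by rewrite dehC dehX0 tofrac1 divr1.
have hc : ((iota c)%:MP : {mpoly C[1]}) \is 0.-homog.
  by rewrite -alg_mpolyC; apply: dhomogZ; apply: dhomog1.
have hX : ('X_ord0 : {mpoly C[1]}) \is (0 + 1).-homog.
  by rewrite dhomogX; apply/eqP/mdeg1.
have h := chart_coef1_hcoef Om hc hX X0.
rewrite e0 in h; split=> [hcan|/h e u Ku un]; last by rewrite e sgn.
apply/h; have Ku : K u0 by rewrite eK => v /hu0/ltW.
have un : u0 != 0 by apply: contraTneq wu0 => ->; rewrite mxE mulr0 ltxx.
by rewrite (hcan u0 Ku un) sgn.
Qed.

(** * Existence and uniqueness: the induction step *)

Section Step.
Variables (e : nat) (W : seq 'rV[R]_e.+2) (S : seq 'M[R]_e.+2).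
Variables (s : bool) (Om : ratform R e.+1).
Hypothesis cS : cover W S.
Hypothesis IH : forall (W' : seq 'rV[R]_e.+1) S' s' (eta : ratform R e),
  cover W' S' -> canonical_form (dualc W') s' eta <->
    hcoef eta = cst e.+1 ((-1) ^+ s') * volume S'.

Let facetP w : facet_normal (dualc W) w <-> facet W w.
Proof.
split; first exact: facet_normal_facet (cover_pointed cS).
exact: facet_facet_normal (cover_pointed cS).
Qed.

Let facet_neq0 w : facet W w -> w != 0. Proof. by case. Qed.

Lemma residue_volume w M : facet W w -> facet_chart w M ->
  val_at (sub (map_mx iota (hyp_mx M)))
    ((lin w)%:F * (cst e.+2 ((-1) ^+ s) * volume S))
    (cst e.+1 (\det M / dot w (row ix1 M))^-1 *
      (cst e.+1 ((-1) ^+ facet_sign w M s) * volume (facet_links S M))).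
Proof.
move=> fw wM; have w0 := facet_neq0 fw; rewrite mulrCA.
have b0 := chart_beta_neq0 w0 wM.
have m0 : \det M != 0 by rewrite -unitfE -unitmxE; case: wM.
have := val_cst ((-1) ^+ s) (facet_residue iota cS w0 wM fw).
congr (val_at _ _ _); rewrite !mulrA -!cstM; congr (cst e.+1 _ * _).
rewrite facet_signE // -sign_scale // [RHS]mulrCA; congr (_ * _).
rewrite mulrA mulVf ?mul1r // mulf_neq0 // invr_eq0 //.
Qed.

(** The form required on a facet is the volume of the links with the sign of the induced
    orientation; [IH] makes it canonical. *)
Lemma volume_form_canonical :
  hcoef Om = cst e.+2 ((-1) ^+ s) * volume S -> canonical_form (dualc W) s Om.
Proof.
move=> eOm; have v0 := volume_neq0 iota cS.
have n0 : num Om != 0.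
  apply: contraNneq v0 => h; move: eOm; rewrite /hcoef h tofrac0 mul0r => /esym/eqP.
  by rewrite mulf_eq0 cst_eq0 signr_eq0.
split=> //.
- move=> w /facetP fw; have w0 := facet_neq0 fw.
  have [M wM] := facet_chart_exists w0.
  rewrite toC_linform; apply: (@order_of_val _ _ iota _ _
    (sub (map_mx iota (hyp_mx M))) w _ _ w0 _ _ _).
  + have := sub_hyper (hyper_map iota (chart_hyper w0 wM)); exact.
  + by rewrite eOm; apply: residue_volume.
  + have b0 := chart_beta_neq0 w0 wM.
    have m0 : \det M != 0 by rewrite -unitfE -unitmxE; case: wM.
    rewrite !mulf_neq0 // ?cst_eq0 ?signr_eq0 ?invr_eq0 ?mulf_neq0 ?invr_eq0 //.
    exact: (volume_neq0 iota (facet_links_cover cS fw wM)).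
- move=> p k [p0 pu pi [j hp]] ho k0.
  have [t [N [l [ht hN el eV]]]] := volume_repr iota cS.
  have [|||w [c [wt ->]]] := @pole_factor _ _ iota _ t (iota ((-1) ^+ s) *: N) p j k
      (hcoef Om) _ _ hp ho k0.
  + by move=> w /ht[_ /facet_neq0].
  + by split.
  + by rewrite eOm eV -mul_mpolyC tofracM mulrA.
  exists w, c; rewrite toC_linform; split=> //.
  by apply/facetP; case: (ht w wt).
- move=> w M /facetP fw wM; have w0 := facet_neq0 fw.
  have cL := facet_links_cover cS fw wM.
  have [eta heta] := form_exists ((-1) ^+ facet_sign w M s) cL.
  exists (facet_sign w M s), eta; split.
  + exact: facet_orientation_sign.
  + have hv := residue_volume fw wM; rewrite -eOm in hv.
    apply/(residue_hcoef w0 wM eta n0 hv).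
    rewrite heta mulrA -cstM mulfV ?cst1 ?mul1r //.
    rewrite mulf_neq0 ?invr_eq0 ?(chart_beta_neq0 w0 wM) //.
    by rewrite -unitfE -unitmxE; case: wM.
  + by rewrite facet_cone_dualc //; apply: (IH (facet_sign w M s) eta cL).2.
Qed.

(** Poles of either side are facets, so the difference has a product of facet forms as denominator.
    Along each facet [IH] identifies the residue of Om with the volume of the links, so the residues
    cancel and [regular_hcancel] applies. *)
Lemma canonical_form_volume :
  canonical_form (dualc W) s Om -> hcoef Om = cst e.+2 ((-1) ^+ s) * volume S.
Proof.
move=> [n0 hord hpole hres]; have [k [hn hd]] := num_den_homog Om.
have D0 := den_neq0 Om.
have f0 : hcoef Om != 0 by rewrite mulf_neq0 // ?invr_eq0 tofrac_eq0.
have [|t1 [N1 [k1 [ht1 hN1 ek1 eOm]]]] :=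
  @pole_reduce _ _ iota _ e.+2 (facet W) _ _ _ _ facet_neq0 f0 _ hn hd D0 (erefl _).
  move=> p j [p0 pu pi] hp ho j0.
  have [|w [c [/facetP fw ->]]] := hpole p j _ ho j0; first by split.
  by exists w, c; rewrite toC_linform.
have [t2 [N2 [k2 [ht2 hN2 ek2 eV]]]] := volume_repr iota cS.
apply/eqP; rewrite -subr_eq0; apply/eqP.
set h := _ - _; pose N := N1 * \prod_(w <- t2) lin w -
  iota ((-1) ^+ s) *: N2 * \prod_(w <- t1) lin w.
have nz1 : \prod_(w <- t1) lin w != 0.
  by apply: prod_lin_seq_neq0 => w /ht1/facet_neq0.
have nz2 : \prod_(w <- t2) lin w != 0.
  by apply: prod_lin_seq_neq0 => w /ht2[_ /facet_neq0].
have hN : N \is (k1 + size t2).-homog.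
  apply: rpredB; first exact/dhomogM/prod_lin_homog.
  have -> : (k1 + size t2 = k2 + size t1)%N by rewrite -ek1 -ek2 addnCA.
  apply: dhomogM (prod_lin_homog iota t1); exact: dhomogZ.
apply: (@regular_hcancel _ e.+1 h N (k1 + size t2)
  [seq map_mx iota w | w <- t1 ++ t2]) => //.
- rewrite all_map; apply/allP => w; rewrite mem_cat /= map_mx_eq0.
  by case/orP => [/ht1/facet_neq0|/ht2[_ /facet_neq0]].
- by rewrite size_map size_cat -ek1 addnAC.
- rewrite /h eOm eV big_map big_cat /= mulrA.
  have -> : cst e.+2 ((-1) ^+ s) * N2%:F = (iota ((-1) ^+ s) *: N2)%:F.
    by rewrite -mul_mpolyC tofracM.
  rewrite -mulNr -tofracN addf_div ?tofrac_eq0 // -!tofracM -tofracD.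
  by rewrite /N mulNr.
- move=> _ /mapP[w wt ->].
  have fw : facet W w by move: wt; rewrite mem_cat => /orP[/ht1|/ht2[]].
  have w0 := facet_neq0 fw; have [M wM] := facet_chart_exists w0.
  have wH := chart_hyper w0 wM.
  have [s' [eta [hs' hreta hcan]]] := hres w M ((facetP w).2 fw) wM.
  (* The order -1 gives [lin w] times the form a value on the hyperplane, which [residue_hcoef]
     relates to eta. *)
  have [a [b [ha hb eab]]] := hord w ((facetP w).2 fw).
  rewrite toC_linform in ha hb eab.
  pose H := map_mx iota (hyp_mx M).
  have wHC : hyper (map_mx iota w) H := hyper_map iota wH.
  have Hb : sub H b != 0 by apply: (sub_neq0 wHC).
  pose g := (sub H a)%:F / (sub H b)%:F.
  have hv : val_at (sub H) ((lin w)%:F * hcoef Om) g.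
    rewrite eab exprN1 mulrA mulfV ?mul1r ?tofrac_eq0 ?lin_eq0 //.
    exact: (val_at_frac (phi := sub H)).
  have cL := facet_links_cover cS fw wM.
  have b0 := chart_beta_neq0 w0 wM.
  have m0 : \det M != 0 by rewrite -unitfE -unitmxE; case: wM.
  (* The vector u0 on which the generators of the facet are positive is a nonzero point of the
     facet, at which the orientation is tested. *)
  have es : s' = facet_sign w M s.
    have [u0 hu0] := cover_pointed cL.
    have y0 : u0 != 0.
      have [F [F' eS]] : exists F F', facet_links S M = F :: F'.
        by case: facet_links cL => [/cover_nil|F F' _] //; exists F, F'.
      have := hu0 _ (cover_rows cL ord0 (_ : F \in _)).
      rewrite eS mem_head => /(_ isT).
      by apply: contraTneq => ->; rewrite dot0r ltxx.
    apply: (facet_orientation_uniq w0 _ y0 hs'); last exact: facet_orientation_sign.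
    by rewrite facet_cone_dualc // => v /hu0/ltW.
  rewrite facet_cone_dualc // in hcan.
  have heta := (IH s' eta cL).1 hcan.
  have hg := (residue_hcoef w0 wM eta n0 hv).1 hreta.
  have hV := residue_volume fw wM.
  apply: (val_regular w0 wH).
  rewrite /h mulrBr.
  have -> : 0 = g - g by rewrite subrr.
  apply: val_atB => //; suff -> : g =
    cst e.+1 (\det M / dot w (row ix1 M))^-1 *
      (cst e.+1 ((-1) ^+ facet_sign w M s) * volume (facet_links S M)) by [].
  rewrite -es -heta hg mulrA -cstM mulVf ?cst1 ?mul1r //.
  by rewrite mulf_neq0 // invr_eq0.
Qed.

End Step.

Theorem canonical_volume d W S s (Om : ratform R d) : cover W S ->
  canonical_form (dualc W) s Om <->
    hcoef Om = cst d.+1 ((-1) ^+ s) * volume S.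
Proof.
elim: d W S s Om => [|e IH] W S s Om cS.
  exact: (canonical_volume0 s Om cS (erefl _)).
by split; [apply: canonical_form_volume | apply: volume_form_canonical].
Qed.

End CanonicalVolume.

(** * The cone over a polyhedron *)

Section ConeOver.
Variables (R : realType) (d : nat).
Implicit Types (P : set 'rV[R]_d) (u w : 'rV[R]_d.+1).

Lemma hvec0 (t : R) (y : 'rV[R]_d) : hvec t y 0 ord0 = t.
Proof.
by rewrite /hvec mxE; case: splitP => // j _; rewrite ord1 mxE eqxx mulr1n.
Qed.

Lemma hvecS (t : R) (y : 'rV[R]_d) j : hvec t y 0 (lift ord0 j) = y 0 j.
Proof.
rewrite /hvec mxE; case: splitP => [i /= h|i /= [h]].
  by have := ltn_ord i; rewrite -h.
by congr (y _ _); apply/val_inj.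
Qed.

Lemma dot_hvec (a t : R) (x y : 'rV[R]_d) :
  dot (hvec a x) (hvec t y) = a * t + dot x y.
Proof.
rewrite {1}/dot big_ord_recl !hvec0; congr (_ + _).
by apply: eq_bigr => j _; rewrite !hvecS.
Qed.

Lemma hvecE u : u = hvec (u 0 ord0) (\row_j u 0 (lift ord0 j)).
Proof.
apply/rowP => i; case: (unliftP ord0 i) => [j ->|->]; last by rewrite hvec0.
by rewrite hvecS mxE.
Qed.

Lemma hvecD (s t : R) (x y : 'rV[R]_d) : hvec s x + hvec t y = hvec (s + t) (x + y).
Proof.
apply/rowP => i; rewrite mxE; case: (unliftP ord0 i) => [j ->|->].
  by rewrite !hvecS mxE.
by rewrite !hvec0.
Qed.

Lemma hvecZ (c t : R) (y : 'rV[R]_d) : c *: hvec t y = hvec (c * t) (c *: y).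
Proof.
apply/rowP => i; rewrite mxE; case: (unliftP ord0 i) => [j ->|->].
  by rewrite !hvecS mxE.
by rewrite !hvec0.
Qed.

Lemma closure_dot_ge0 w (A : set 'rV[R]_d.+1) u :
  (forall v, A v -> 0 <= dot w v) -> closure A u -> 0 <= dot w u.
Proof.
move=> hA cu; rewrite leNgt; apply/negP => wu.
pose e := - dot w u / (\sum_i `|w 0 i| + 1).
have s1 : 0 < \sum_i `|w 0 i| + 1 by rewrite ltr_wpDl // sumr_ge0.
have e0 : 0 < e by rewrite divr_gt0 // oppr_gt0.
have [v [/hA hv [_ bv]]] := cu _ (nbhsx_ballx u e e0).
have : dot w v <= dot w u + (\sum_i `|w 0 i|) * e.
  rewrite -lerBlDl -dotNr -dotDr mulr_suml; apply: ler_sum => i _.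
  rewrite !mxE; apply: le_trans (ler_norm _) _; rewrite normrM ler_wpM2l //.
  by have := bv 0 i; rewrite /ball /= distrC => /ltW.
apply/negP; rewrite -ltNge; apply: lt_le_trans hv.
have : (\sum_i `|w 0 i| + 1) * e = - dot w u by rewrite mulrC divfK // lt0r_neq0.
lra.
Qed.

Lemma closure_segment (A : set 'rV[R]_d.+1) u h :
  (forall t, 0 < t -> A (u + t *: h)) -> closure A u.
Proof.
move=> hA B /nbhs_ballP[e /= e0 hB].
have s1 : 0 < \sum_i `|h 0 i| + 1 by rewrite ltr_wpDl // sumr_ge0.
pose t := e / (\sum_i `|h 0 i| + 1).
have t0 : 0 < t by rewrite divr_gt0.
exists (u + t *: h); split; first exact: hA.
apply: hB; split=> // i j; rewrite /ball /= !mxE opprD addNKr normrN normrM gtr0_norm //.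
rewrite /t mulrAC ltr_pdivrMr // ltr_pM2l // (ord1 i).
by rewrite (bigD1 j) //= -addrA ltrDl ltr_wpDl // sumr_ge0.
Qed.

Lemma cone_over_mem P t y : 0 <= t -> P y -> cone_over P (hvec t (t *: y)).
Proof. by move=> t0 Py; apply: subset_closure; exists t, y. Qed.

Lemma dual_cone_overP P w : dual_cone (cone_over P) w <->
  forall t y, 0 <= t -> P y -> 0 <= dot w (hvec t (t *: y)).
Proof.
split=> [h t y t0 Py|h u cu]; first exact/h/cone_over_mem.
by apply: (closure_dot_ge0 _ cu) => _ [t [y [t0 Py ->]]]; apply: h.
Qed.

Lemma dual_cone_overE P a x : dual_cone (cone_over P) (hvec a x) <->
  forall t y, 0 <= t -> P y -> 0 <= t * (a + dot x y).
Proof.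
by split=> [/dual_cone_overP h t y t0 Py|h];
  [have := h t y t0 Py | apply/dual_cone_overP => t y t0 Py; have := h t y t0 Py];
  rewrite dot_hvec dotZr mulrDr mulrC.
Qed.

(* The inequalities b_i <= <a_i, y> and 0 <= t defining P and its closed cone
   belong to the dual cone. *)
Lemma cone_over_dual P (W : seq 'rV[R]_d.+1) : polyhedron P -> P !=set0 ->
  (forall w, dual_cone (cone_over P) w <-> cone W w) -> cone_over P = dualc W.
Proof.
move=> [m [a [b eP]]] [y0 Py0] hW; apply/seteqP; split=> u hu.
  by move=> w wW; apply: (hW w).2 => //; apply: cone_mem.
have dualW w : dual_cone (cone_over P) w -> 0 <= dot w u.
  by move=> /hW; apply: cone_dot => v vW; apply: hu.
have u00 : 0 <= u 0 ord0.
  have : dual_cone (cone_over P) (hvec 1 0).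
    by apply/dual_cone_overE => t y t0 _; rewrite dot0l addr0 mulr1.
  by move/dualW; rewrite [u in dot _ u]hvecE dot_hvec mul1r dot0l addr0.
have ua i : b i * u 0 ord0 <= dot (a i) (\row_j u 0 (lift ord0 j)).
  have : dual_cone (cone_over P) (hvec (- b i) (a i)).
    apply/dual_cone_overE => t y t0; rewrite eP => /(_ i) hy.
    by rewrite mulr_ge0 // addrC subr_ge0.
  by move/dualW; rewrite [u in dot _ u]hvecE dot_hvec mulNr addrC subr_ge0.
(* Adding t times (1, y0) makes the first coordinate positive, which puts the point on a ray over
   P. *)
apply: (@closure_segment _ _ (hvec 1 y0)) => t t0.
pose s := u 0 ord0 + t; have s0 : 0 < s by rewrite ltr_wpDl.
exists s, (s^-1 *: (\row_j u 0 (lift ord0 j) + t *: y0)); split; first exact: ltW.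
  have hy0 i : b i <= dot (a i) y0 by move: Py0; rewrite eP.
  rewrite eP => i /=; rewrite dotZr dotDr dotZr mulrC ler_pdivlMr // /s mulrDr.
  by rewrite lerD // mulrC ler_pM2l.
rewrite scalerA mulfV ?lt0r_neq0 // scale1r [in LHS](hvecE u) hvecZ mulr1.
by rewrite hvecD.
Qed.

(** The sum of a basis of points (1, y) with y in P: a vector of the dual cone that vanishes on this
    sum vanishes on each basis vector. *)
Lemma full_pointed P : full_dimensional P -> exists u0,
  forall w, dual_cone (cone_over P) w -> w != 0 -> 0 < dot w u0.
Proof.
move=> [U [fU hU _]].
have cU i : cone_over P (row i U).
  have [y Py <-] := hU i.
  by have := cone_over_mem ler01 Py; rewrite scale1r.
exists (\sum_i row i U).
move=> w hw w0; rewrite dot_sumr lt_neqAle sumr_ge0 ?andbT => [|i _]; last exact: hw.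
apply: contra w0; rewrite eq_sym psumr_eq0 => [/allP h|i _]; last exact: hw.
have uU : U \in unitmx by rewrite -row_free_unit.
have uUT : U^T \in unitmx by rewrite unitmx_tr.
rewrite -[w](mulmxK uUT); have -> : w *m U^T = 0; last by rewrite mul0mx.
apply/rowP => i; rewrite [RHS]mxE mxE.
have := h i; rewrite mem_index_enum => /(_ isT)/eqP/= hi; rewrite -[RHS]hi.
by apply: eq_bigr => j _; rewrite !mxE.
Qed.

End ConeOver.

(** * Triangulations *)

Section Triangulation.
Variables (R : realType) (d : nat) (K : set 'rV[R]_d.+1) (W : seq 'rV[R]_d.+1).
Variable T : {set {set 'I_(size W)}}.
Hypothesis hT : triangulation K T.
Implicit Types F G : {set 'I_(size W)}.

Definition cells : seq 'M[R]_d.+1 := [seq cell_mx F | F <- enum T].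

(** The generators that occur in T. That they span K follows from the triangulation itself, without
    a theorem on extreme rays. *)
Definition cell_gens : seq 'rV[R]_d.+1 :=
  [seq W`_(val i) | F <- enum T, i <- enum F].

Lemma cell_unit F : F \in T -> cell_mx F \in unitmx.
Proof. by case: hT => h _ _ /h[_]; rewrite unitmxE unitfE. Qed.

Lemma cell_card F : F \in T -> #|F| = d.+1.
Proof. by case: hT => h _ _ /h[]. Qed.

Lemma cell_pick F : F \in T -> exists i, i \in F.
Proof. by move=> /cell_card h; apply/card_gt0P; rewrite h. Qed.

Lemma big_cell (A : Type) (idx : A) (op : Monoid.com_law idx) F i0 (f : 'I_(size W) -> A) :
  F \in T -> \big[op/idx]_(i in F) f i =
    \big[op/idx]_(k < d.+1) f (nth i0 (enum F) k).
Proof.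
by move=> FT; rewrite -big_enum /= (big_nth i0) -cardE (cell_card FT) big_mkord.
Qed.

Lemma row_cell F i0 k : F \in T -> row k (cell_mx F) = W`_(val (nth i0 (enum F) k)).
Proof.
move=> FT; rewrite rowK (nth_map i0) // -cardE (cell_card FT); exact: ltn_ord.
Qed.

Lemma cell_coord F i0 x c k : F \in T -> x = \sum_(i in F) c i *: W`_(val i) ->
  (x *m invmx (cell_mx F)) 0 k = c (nth i0 (enum F) k).
Proof.
move=> FT ->; rewrite (big_cell _ i0) //.
have -> : \sum_(k < d.+1) c (nth i0 (enum F) k) *: W`_(val (nth i0 (enum F) k)) =
    (\row_k c (nth i0 (enum F) k)) *m cell_mx F.
  rewrite mulmx_sum_row; apply: eq_bigr => l _.
  by rewrite mxE (row_cell i0).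
by rewrite mulmxK ?cell_unit // mxE.
Qed.

Lemma simplicial_ind F x : F \in T -> simplicial_cone F x <-> ind (cell_mx F) x.
Proof.
move=> FT; have [i0 _] := cell_pick FT; split=> [[c [c0 ex]]|/forallP h].
  by apply/forallP => k; rewrite (cell_coord i0 k FT ex).
pose y := x *m invmx (cell_mx F).
exists (fun i => \sum_(k < d.+1 | nth i0 (enum F) k == i) y 0 k); split.
  by move=> i; apply: sumr_ge0 => k _; apply: h.
rewrite (big_cell _ i0) // -[LHS](mulmxKV (cell_unit FT)) mulmx_sum_row.
apply: eq_bigr => k _; rewrite (row_cell i0) //; congr (_ *: _).
rewrite (bigD1 k) //= big1 ?addr0 // => l /andP[/eqP e lk].
case/eqP: lk; apply/val_inj/eqP.
have sF : size (enum F) = d.+1 by rewrite -cardE cell_card.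
by rewrite -(nth_uniq i0 _ _ (enum_uniq (mem F))) ?sF ?ltn_ord // e.
Qed.

Definition cell_walls : seq 'rV[R]_d.+1 :=
  [seq (col h (invmx (cell_mx F)))^T | F <- enum T, h <- enum 'I_d.+1].

Lemma cell_wallsE F h x :
  dot (col h (invmx (cell_mx F)))^T x = (x *m invmx (cell_mx F)) 0 h.
Proof. by rewrite mxE dotC; apply: eq_bigr => i _; rewrite !mxE. Qed.

Lemma cell_walls_neq0 l : l \in cell_walls -> l != 0.
Proof.
case/allpairsP => -[F h] /= [FT _ ->]; rewrite mem_enum in FT.
have : dot (col h (invmx (cell_mx F)))^T (row h (cell_mx F)) = 1.
  by rewrite cell_wallsE -row_mul mulmxV ?cell_unit // !mxE eqxx.
by apply: contra_eq_neq => ->; rewrite dot0l eq_sym oner_eq0.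
Qed.

(** Cells meet in the cone of their common generators. If F is not G, some generator of F is missing
    from G, as both have d + 1 elements, and the coordinate of x along it vanishes, which puts x on
    a wall. *)
Lemma cell_disjoint F G x : F \in T -> G \in T -> gen cell_walls x ->
  ind (cell_mx F) x -> ind (cell_mx G) x -> F = G.
Proof.
move=> FT GT gx /(simplicial_ind _ FT) hF /(simplicial_ind _ GT) hG.
apply: contrapT => /eqP FG.
have [j jF jG] : exists2 j, j \in F & j \notin G.
  apply/subsetPn; apply: contra FG => sFG.
  by rewrite eqEcard sFG (cell_card FT) (cell_card GT) leqnn.
have [c [c0 ex]] : simplicial_cone (F :&: G) x.
  by case: hT => _ _ h; rewrite -(h F G FT GT); split.
have ex' : x = \sum_(i in F) (if i \in G then c i else 0) *: W`_(val i).
  rewrite {1}ex big_mkcond [RHS]big_mkcond; apply: eq_bigr => i _.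
  by rewrite inE; case: (i \in F) => //; case: (i \in G); rewrite /= ?scale0r.
have jn : (index j (enum F) < d.+1)%N.
  by rewrite -[X in (_ < X)%N](cell_card FT) cardE index_mem mem_enum.
have := gx (col (Ordinal jn) (invmx (cell_mx F)))^T.
rewrite cell_wallsE (cell_coord j _ FT ex') /= nth_index ?mem_enum //.
rewrite (negPf jG) eqxx => /(_ _)/negP; apply=> //.
by apply/allpairsP; exists (F, Ordinal jn); rewrite !mem_enum.
Qed.

Hypothesis KD : forall a b, K a -> K b -> K (a + b).
Hypothesis KZ : forall (t : R) a, 0 <= t -> K a -> K (t *: a).
Hypothesis Kp : exists u0, forall w, K w -> w != 0 -> 0 < dot w u0.
Hypothesis K0 : K 0.

Lemma cell_gensP w : w \in cell_gens -> exists F i,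
  [/\ F \in T, i \in F & w = W`_(val i)].
Proof.
case/allpairsPdep => F [i [FT iF ->]]; exists F, i.
by rewrite mem_enum in FT; rewrite mem_enum in iF.
Qed.

Lemma cell_gens_mem F i : F \in T -> i \in F -> W`_(val i) \in cell_gens.
Proof.
by move=> FT iF; apply/allpairsPdep; exists F, i; rewrite !mem_enum.
Qed.

Lemma cell_gen_row F i : F \in T -> i \in F -> exists k, W`_(val i) = row k (cell_mx F).
Proof.
move=> FT iF; have jn : (index i (enum F) < d.+1)%N.
  by rewrite -[X in (_ < X)%N](cell_card FT) cardE index_mem mem_enum.
by exists (Ordinal jn); rewrite (row_cell i) //= nth_index // mem_enum.
Qed.

Lemma simplicial_sub F x : F \in T -> simplicial_cone F x -> K x.
Proof. by case: hT => _ -> _ FT hx; exists F. Qed.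

Lemma cell_gens_sub w : w \in cell_gens -> K w /\ w != 0.
Proof.
case/cell_gensP => F [i [FT iF ->]]; have [k ek] := cell_gen_row FT iF.
have uF := cell_unit FT; split; last by rewrite ek unitmx_row_neq0.
apply: (simplicial_sub FT); apply/simplicial_ind => //; apply/forallP => h.
by rewrite ek -row_mul mulmxV // !mxE ler0n.
Qed.

Lemma triangulation_cone x : K x <-> cone cell_gens x.
Proof.
split=> [|h]; last first.
  elim: h => // z t w _ Kz t0 /cell_gens_sub[Kw _].
  exact/KD/KZ.
case: hT => _ -> _ [F FT [c [c0 ->]]]; apply: cone_sum => i iF; split=> //.
exact/cone_mem/(cell_gens_mem FT).
Qed.

Lemma triangulation_cover : cover cell_gens cells.
Proof.
split.
- by move=> _ /mapP[F FT ->]; apply: cell_unit; rewrite mem_enum in FT.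
- move=> _ k /mapP[F + ->]; rewrite mem_enum => FT; have [i0 _] := cell_pick FT.
  rewrite (row_cell i0) //; apply: (cell_gens_mem FT).
  by rewrite -mem_enum mem_nth // -cardE cell_card.
- have [F FT] : exists F, F \in T.
    by case: hT => _ eK _; move: K0; rewrite {1}eK => -[F FT _]; exists F.
  have : cell_mx F \in cells by apply: map_f; rewrite mem_enum.
  by case: cells.
- have [u0 hu0] := Kp; exists u0 => w /cell_gens_sub[Kw w0]; exact: hu0.
exists cell_walls; split=> [l|x gx]; first exact: cell_walls_neq0.
rewrite /cells big_map big_enum /=.
have [hx|hx] := pselect (cone cell_gens x); last first.
  rewrite (asboolF hx) big1 // => F FT; case hF: (ind _ _) => //.
  case: hx; apply/triangulation_cone/(simplicial_sub FT)/simplicial_ind => //.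
rewrite asboolT //; have := (triangulation_cone x).2 hx.
case: (hT) => _ {1}-> _ [F FT /(simplicial_ind _ FT) hF].
rewrite (bigD1 F) //= hF big1 ?addr0 // => G /andP[GT GF].
case hG: (ind _ _) => //; case/eqP: GF.
exact: (cell_disjoint GT FT gx hG hF).
Qed.

Section Adjoint.
Hypothesis W0 : forall i : 'I_(size W), W`_(val i) != 0.
Local Notation C := R[i].
Local Notation iota := (real_complex R).
Local Notation lin := (lin iota).

Lemma toC_adj : toC (adj T) =
  \sum_(F in T) (iota `|\det (cell_mx F)|)%:MP *
    \prod_(i : 'I_(size W) | i \notin F) lin W`_(val i).
Proof.
rewrite /toC /adj raddf_sum; apply: eq_bigr => F FT /=.
rewrite map_mpolyZ mul_mpolyC rmorph_prod; congr (_ *: _).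
by apply: eq_bigr => i _; rewrite -toC_linform.
Qed.

(** Generators that lie in no cell, if any, occur in every term of the adjoint as well as in the
    product over W. *)
Lemma volume_adj : volume iota cells =
  (toC (adj T))%:F / (\prod_(i < size W) lin W`_(val i))%:F.
Proof.
rewrite /volume /cells big_map big_enum /= toC_adj raddf_sum mulr_suml /=.
apply: eq_bigr => F FT; rewrite /Phi.
have [i0 _] := cell_pick FT.
have -> : \prod_k lin (row k (cell_mx F)) = \prod_(i in F) lin W`_(val i).
  by rewrite (big_cell _ i0) //; apply: eq_bigr => k _; rewrite (row_cell i0).
have nz (Q : pred 'I_(size W)) : \prod_(i | Q i) lin W`_(val i) != 0.
  by apply/prodf_neq0 => i _; rewrite lin_eq0.
apply: (proj2 (eq_tofrac _ _ _ _)); rewrite ?nz //.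
rewrite [in LHS](bigID (fun i => i \in F)) /= mulrA mulrAC.
by congr (_ * _).
Qed.

Lemma adj_homog : toC (adj T) \is (size W - d.+1).-homog.
Proof.
rewrite toC_adj; apply: rpred_sum => F FT; rewrite mul_mpolyC; apply: dhomogZ.
have := prod_lin_homog iota [seq W`_(val i) | i <- enum (~: F)].
rewrite size_map -cardE cardsCs finset.setCK card_ord (cell_card FT).
congr (is_true (_ \is _)); rewrite big_map big_enum /=.
by apply: eq_bigl => i; rewrite inE.
Qed.

Lemma size_triangulation : (size W - d.+1 + d.+1 = size W)%N.
Proof.
have [F FT] : exists F, F \in T.
  by case: hT => _ eK _; move: K0; rewrite {1}eK => -[F FT _]; exists F.
by rewrite subnK // -{1}(cell_card FT) -[X in (_ <= X)%N]card_ord max_card.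
Qed.

End Adjoint.
End Triangulation.

(** * Generators of the dual cone *)

Section DualCone.
Variables (R : realType) (n : nat) (K : set 'rV[R]_n).

Lemma dual_coneD a b : dual_cone K a -> dual_cone K b -> dual_cone K (a + b).
Proof. by move=> ha hb u Ku; rewrite dotDl addr_ge0 ?ha ?hb. Qed.

Lemma dual_coneZ t a : 0 <= t -> dual_cone K a -> dual_cone K (t *: a).
Proof. by move=> t0 ha u Ku; rewrite dotZl mulr_ge0 ?ha. Qed.

Lemma dual_cone0 : dual_cone K 0.
Proof. by move=> u _; rewrite dot0l. Qed.

End DualCone.

Section Generators.
Variables (R : realType) (d : nat) (P : set 'rV[R]_d) (V : seq 'rV[R]_d).
Hypotheses (P_full : full_dimensional P) (V_gen : fan_generators P V).
Local Notation D := (dual_cone (cone_over P)).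
Local Notation W := (dual_generators P V).
Local Notation h v := (fine (support_fun P v)).

Lemma full_nonempty : P !=set0.
Proof. by have [U [_ /(_ ord0)[y Py _] _]] := P_full; exists y. Qed.

Lemma support_fun_min v y : P y -> support_fun P v = (- dot v y)%:E <->
  forall y', P y' -> dot v y <= dot v y'.
Proof.
move=> Py; split=> [e y' Py'|hy].
  have : (ereal_inf [set (dot v y)%:E | y in P] <= (dot v y')%:E)%E.
    by apply: ereal_inf_lbound; exists y'.
  have /(congr1 (fun x => - x)%E) := e; rewrite /support_fun oppeK => ->.
  by rewrite -EFinN opprK lee_fin.
rewrite /support_fun EFinN; congr (- _)%E; apply/eqP; rewrite eq_le.
rewrite ereal_inf_lbound /=; last by exists y.
by apply/ereal_infP => _ [y' Py' <-]; rewrite lee_fin; apply: hy.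
Qed.

(** If (h v, v) is a sum of two vectors of the dual cone, both are nonnegative on (1, z) and hence
    vanish there for z in F. So the linear part of each is minimal along F and lies in the normal
    cone of F, which is the ray of v; vanishing on F fixes the first coordinate. *)
Lemma ray_fan_extreme v : v != 0 -> normal_fan P (ray v) ->
  extreme_ray D (hvec (h v) v).
Proof.
move=> v0 [F [[y Fy] [u [c [_ eF]]]] eN].
have FP z : F z -> P z by rewrite eF => -[].
have vN : normal_cone P F v by rewrite eN; exists 1; rewrite /= ?scale1r.
have hv z : F z -> h v = - dot v z by move=> /vN ->.
have minv z : P z -> dot v y <= dot v z.
  exact: (support_fun_min v (FP _ Fy)).1 (vN _ Fy) z.
split.
- apply/dual_cone_overE => t z t0 Pz; rewrite mulr_ge0 // (hv y) //.
  by rewrite addrC subr_ge0 minv.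
- apply: contra v0 => /eqP e; apply/eqP/rowP => j.
  by rewrite -(hvecS (h v) v) e !mxE.
suff side a b : D a -> D b -> hvec (h v) v = a + b -> ray (hvec (h v) v) a.
  by move=> a b Da Db e; split; [exact: (side a b) | apply: (side b a); rewrite // addrC].
move=> Da Db e; rewrite (hvecE a); set a0 := a 0 ord0; set x := \row_j _.
have ga z : P z -> 0 <= a0 + dot x z.
  move=> Pz; have := (dual_cone_overE P a0 x).1; rewrite -hvecE => /(_ Da 1 z ler01 Pz).
  by rewrite mul1r.
have za z : F z -> a0 + dot x z = 0.
  move=> Fz; have Pz := FP z Fz; apply/le_anti; rewrite ga // andbT.
  have : dot (hvec (h v) v) (hvec 1 z) = 0 by rewrite dot_hvec (hv z) // mulr1 addNr.
  rewrite e dotDl [X in dot X _ + _](hvecE a) dot_hvec mulr1 => /eqP.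
  rewrite addr_eq0 => /eqP ->; rewrite oppr_le0.
  by have := cone_over_mem ler01 Pz; rewrite scale1r => /Db.
have : normal_cone P F x.
  move=> z Fz; apply/(support_fun_min _ (FP _ Fz)) => z' Pz'.
  by rewrite -(lerD2l a0) za // ga.
rewrite eN => -[s s0 ex]; exists s => //.
rewrite hvecZ (hv y) // ex mulrN -dotZl ex; congr (hvec _ _).
by apply/eqP; rewrite eq_sym -addr_eq0 za.
Qed.

Lemma dual_generators_extreme w : w \in W -> extreme_ray D w.
Proof.
rewrite mem_cat => /orP[/mapP[v vV ->]|].
  by have [_ /(_ v vV)[v0 fv] _] := V_gen; apply: ray_fan_extreme.
by case: asboolP => // hx; rewrite inE => /eqP->.
Qed.

Lemma dual_generators_neq0 w : w \in W -> w != 0.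
Proof. by case/dual_generators_extreme. Qed.

Lemma hvec_inj (s t : R) (x y : 'rV[R]_d) : hvec s x = hvec t y -> s = t /\ x = y.
Proof.
move=> e; split; first by rewrite -(hvec0 s x) e hvec0.
by apply/rowP => j; rewrite -(hvecS s x) e hvecS.
Qed.

Lemma dual_generators_uniq : uniq W.
Proof.
have [uV hV _] := V_gen; rewrite cat_uniq map_inj_uniq ?uV => [|x y]; last first.
  by case/hvec_inj.
case: ifP => _ //=; rewrite orbF andbT; apply/mapP => -[v vV /hvec_inj[_ e]].
by have [/eqP v0 _] := hV v vV; rewrite -e in v0.
Qed.

(** Pointedness makes c positive, so proportional generators span the same ray, and V has one
    generator on each ray; (1, 0) is set apart because the others have v nonzero. Hence no linear
    form divides the product over W twice. *)
Lemma dual_generators_prop w w' c : w \in W -> w' \in W -> w = c *: w' -> w = w'.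
Proof.
move=> wW w'W e.
have [Dw w0 _] := dual_generators_extreme wW.
have [Dw' w'0 _] := dual_generators_extreme w'W.
have [u0 hu0] := full_pointed P_full.
have c0 : 0 < c.
  by have := hu0 w Dw w0; rewrite e dotZl pmulr_lgt0 // hu0.
have [_ hV uV] := V_gen; move: wW w'W e {Dw w0 Dw' w'0}; rewrite !mem_cat.
case/orP => [/mapP[v vV ->]|h1]; case/orP => [/mapP[v' v'V ->]|h2].
- rewrite hvecZ => /hvec_inj[_ ev].
  have [v0 fv] := hV v vV; have [z [_ uz]] := uV v v0 fv.
  suff -> : v = v' by [].
  rewrite -(uz v) //; apply: uz; split=> //; apply/seteqP; split=> _ [t /= t0 <-].
    exists (t / c); first by rewrite /= divr_ge0 ?(ltW c0).
    by rewrite ev scalerA divfK ?lt0r_neq0.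
  exists (t * c); first by rewrite /= mulr_ge0 ?(ltW c0).
  by rewrite ev scalerA.
- move: h2; case: ifP => // _; rewrite inE => /eqP->; rewrite hvecZ scaler0 => /hvec_inj[_ ev].
  by have [] := hV v vV; rewrite ev eqxx.
- move: h1; case: ifP => // _; rewrite inE => /eqP->; rewrite hvecZ => /hvec_inj[_ /esym/eqP].
  by rewrite scaler_eq0 (gt_eqF c0) => /eqP v'0; have [] := hV v' v'V; rewrite v'0 eqxx.
- by move: h1 h2; case: ifP => // _; rewrite !inE => /eqP-> /eqP->.
Qed.

Local Notation lin := (lin (real_complex R)).

Lemma deh_lin (t : R) (v : 'rV[R]_d) : deh (lin (hvec t v)) = toC (t%:MP + linform v).
Proof.
rewrite /toC raddfD /= map_mpolyC -/(toC _) toC_linform /lin /linf big_ord_recl.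
rewrite raddfD /= dehZ dehX0 mxE hvec0 alg_mpolyC; congr (_ + _).
by rewrite raddf_sum; apply: eq_bigr => j _; rewrite /= dehZ dehXS mxE hvecS mxE.
Qed.

Lemma prod_lin_generators : \prod_(i < size W) lin W`_(val i) = \prod_(w <- W) lin w.
Proof. by rewrite (big_nth 0) big_mkord. Qed.

(** The generator (1, 0), when present, contributes the factor z_0, which becomes 1 in the chart;
    this is why [Bpoly] runs over V only. *)
Lemma deh_prod_lin : deh (\prod_(w <- W) lin w) = toC (Bpoly P V).
Proof.
rewrite big_cat big_map rmorphM /= !rmorph_prod /= [X in _ * X]big1_seq ?mulr1.
  rewrite /toC /Bpoly rmorph_prod; apply: eq_bigr => v _; exact: deh_lin.
move=> w; case: ifP => // _; rewrite inE => /eqP->.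
by rewrite deh_lin /linform big1 ?addr0 ?/toC ?rmorph1 // => i _; rewrite mxE scale0r.
Qed.

End Generators.

Lemma canonical_order (R : realType) d (G : seq 'rV[R]_d.+1) s (Om : ratform R d) w :
  (0 < d)%N -> pointed G -> extreme_ray (cone G) w ->
  canonical_form (dualc G) s Om -> order_at (hcoef Om) (lin (real_complex R) w) (-1).
Proof.
case: d G Om w => // e G Om w _ pG ex [_ h _ _].
by have := h w (facet_facet_normal pG (extreme_facet pG ex)); rewrite toC_linform.
Qed.

(** * The canonical form of a polyhedron and its zeros *)

Section MainTheorem.
Variables (R : realType) (d : nat) (P : set 'rV[R]_d) (V : seq 'rV[R]_d).
Hypotheses (P_polyhedron : polyhedron P) (P_full : full_dimensional P).
Hypothesis V_gen : fan_generators P V.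
Variable T : {set {set 'I_(size (dual_generators P V))}}.
Hypothesis T_triang : triangulation (dual_cone (cone_over P)) T.
Local Notation W := (dual_generators P V).
Local Notation D := (dual_cone (cone_over P)).
Local Notation lin := (lin (real_complex R)).
Local Notation A := (toC (adj T)).
Local Notation B := (\prod_(w <- W) lin w).

Let cov : cover (cell_gens T) (cells T).
Proof.
exact: (triangulation_cover T_triang (@dual_coneD _ _ _) (@dual_coneZ _ _ _)
  (full_pointed P_full) (@dual_cone0 _ _ _)).
Qed.

Let coneT w : D w <-> cone (cell_gens T) w.
Proof.
exact: (triangulation_cone T_triang (@dual_coneD _ _ _) (@dual_coneZ _ _ _)
  (@dual_cone0 _ _ _)).
Qed.

Lemma cone_over_gens : cone_over P = dualc (cell_gens T).
Proof. exact: (cone_over_dual P_polyhedron (full_nonempty P_full) coneT). Qed.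

Lemma canonical_hcoef (Om : ratform R d) :
  canonical_form (cone_over P) false Om <-> hcoef Om = A%:F / B%:F.
Proof.
rewrite cone_over_gens -prod_lin_generators -(volume_adj T_triang); last first.
  by move=> i; apply: (dual_generators_neq0 V_gen); apply: mem_nth; exact: ltn_ord.
by rewrite (canonical_volume false Om cov) expr0 cst1 mul1r.
Qed.

Let B0 : B != 0.
Proof. by apply: prod_lin_seq_neq0; apply: dual_generators_neq0. Qed.

Lemma canonical_chart (Om : ratform R d) : canonical_form (cone_over P) false Om <->
  chart_coef 1%:M Om = (A \mPo chart_point 1%:M)%:F / (toC (Bpoly P V))%:F.
Proof.
rewrite canonical_hcoef -deh_prod_lin -[chart_point _]/(chart_tuple _) comp_chart sub1.
apply: iff_sym; apply: chart_coef1_hcoef (adj_homog T_triang) _ B0.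
by rewrite (size_triangulation T_triang) ?prod_lin_homog //; apply: dual_cone0.
Qed.

Section ZeroSet.
Hypothesis P_proper : P <> setT.
Variable Om : ratform R d.
Hypothesis Om_canon : canonical_form (cone_over P) false Om.

(** In dimension 0 a nonempty P is the whole space. In positive dimension the canonical form has a
    pole along every facet. *)
Let d_gt0 : (0 < d)%N.
Proof.
rewrite lt0n; apply/eqP => d0; apply: P_proper; apply/seteqP; split=> // y _.
have [z Pz] := full_nonempty P_full; suff -> : y = z by [].
by apply/rowP => i; have := ltn_ord i; rewrite [X in (_ < X)%N]d0.
Qed.

(** The form has order -1 along [lin w], and [lin w] divides the product over W only once; if it
    divided the adjoint as well, the pole would cancel. *)
Lemma lin_ndvd_adj w : w \in W -> ~ rdvd (lin w) A.
Proof.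
move=> wW [r eA]; have w0 := dual_generators_neq0 V_gen wW.
have eG : extreme_ray (cone (cell_gens T)) w.
  have [Dw _ ew] := dual_generators_extreme V_gen wW.
  split=> // [|a b ca cb]; first exact/coneT.
  by apply: ew; apply/coneT.
have := Om_canon; rewrite cone_over_gens => /(canonical_order d_gt0 (cover_pointed cov) eG).
move=> [n [m [hn hm]]]; rewrite ((canonical_hcoef Om).1 Om_canon) => e.
have L0 : lin w != 0 by rewrite lin_eq0.
have pL : rprime (lin w) by apply: linf_prime; rewrite map_mx_eq0.
have m0 : m != 0 by apply: contra_not_neq hm => ->; apply: rdvd0.
have e2 : A%:F / B%:F = n%:F / (lin w * m)%:F.
  by rewrite e exprN1 tofracM invfM mulrCA.
have := proj1 (eq_tofrac _ _ B0 (mulf_neq0 L0 m0)) e2.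
rewrite eA (big_rem w) //= => e3.
have e4 : n * \prod_(v <- rem w W) lin v = r * (lin w * m).
  by apply: (mulfI L0); rewrite mulrCA -e3 -mulrA.
have [_ _ /(_ n (\prod_(v <- rem w W) lin v))[]//] := pL.
  by rewrite e4 mulrCA; exists (r * m).
have := rprime_dvd_prod (s := [seq lin v | v <- rem w W]) (u := 1) pL (unitr1 _).
rewrite mul1r big_map => h /h[_ /mapP[v vr ->] dv].
have [|c ec] := rdvd_linf _ dv; first by rewrite map_mx_eq0.
have uW := dual_generators_uniq V_gen.
have vW := mem_rem vr.
(* The complex ratio is a quotient of coordinates of real vectors, hence real. *)
have [c' ec'] : exists c', v = c' *: w.
  have [j wj] := rV0Pn _ w0; exists (v 0 j / w 0 j); apply/rowP => k.
  have := congr1 (fun x : 'rV_d.+1 => (x 0 k, x 0 j)) ec; rewrite !mxE => -[ek ej].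
  apply: (fmorph_inj (real_complex R)).
  rewrite !rmorphM fmorphV /= ek ej mulfK ?fmorph_eq0 //.
have := dual_generators_prop P_full V_gen vW wW ec' => evw.
by move: vr; rewrite evw mem_rem_uniqF.
Qed.

(** A prime along which the form vanishes divides the adjoint. Conversely a zero of the adjoint lies
    on one of its prime factors, which is homogeneous by [homog_factor] and does not divide the
    denominator by [lin_ndvd_adj]. *)
Lemma zero_set_adj : zero_set Om = vanishing_set A.
Proof.
have eOm := (canonical_hcoef Om).1 Om_canon.
have A0 : A != 0.
  apply: contraNneq (volume_neq0 (real_complex R) cov) => h.
  rewrite (volume_adj T_triang) ?h ?tofrac0 ?mul0r // => i.
  by apply: (dual_generators_neq0 V_gen); apply: mem_nth; exact: ltn_ord.
apply/seteqP; split=> x [].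
  move=> p [k [[p0 pu pi _] [n [m [hn hm e]]] k0 [x0 px]]]; split=> //.
  have [_ _ p_dvd] : rprime p.
    by apply: factorial_irred_prime; [apply: factorial_mpoly | split].
  have m0 : m != 0 by apply: contra_not_neq hm => ->; apply: rdvd0.
  have [j ej] : exists j : nat, k = j.+1 by case: k k0 {e} => // -[|j] // _; exists j.
  have e2 : A%:F / B%:F = (p ^+ j.+1 * n)%:F / m%:F.
    by rewrite -eOm e ej -exprnP tofracM tofracXn mulrA.
  have e3 := proj1 (eq_tofrac _ _ B0 m0) e2.
  have : rdvd p (A * m).
    by rewrite e3 exprS; exists (p ^+ j * n * B); rewrite !mulrA.
  case/p_dvd => // -[r ->]; by rewrite mevalM px mul0r.
move=> x0 Ax; have [s [u [sp uu eA]]] := factorial_mpoly A0.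
have [p ps px] : exists2 p, p \in s & p.@[fun i => x 0 i] = 0.
  have [c c0 ec] := mpoly_unitE uu.
  move/eqP: Ax; rewrite eA ec mevalM mevalC mulf_eq0 (negPf c0) /=.
  rewrite rmorph_prod /= prodf_seq_eq0 => /hasP[p ps /eqP px]; by exists p.
have pp := sp p ps; have [p0 pu pi] := rprime_irred pp.
have [q eq] : rdvd p A.
  by rewrite eA (big_rem p) //= mulrCA; exists (u * \prod_(y <- rem p s) y).
have [k hk] : exists k : nat, p \is k.-homog.
  by apply: (@homog_factor _ _ (size W - d.+1) _ q); rewrite -eq ?(adj_homog T_triang).
have nB : ~ rdvd p B.
  have := rprime_dvd_prod (s := [seq lin v | v <- W]) (u := 1) pp (unitr1 _).
  rewrite mul1r big_map => h /h[_ /mapP[w wW ->] dw].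
  apply: (lin_ndvd_adj wW); have w0 := dual_generators_neq0 V_gen wW.
  have pL : rprime (lin w) by apply: linf_prime; rewrite map_mx_eq0.
  have [t tu ->] := rprime_assoc pp pL dw.
  by exists (t^-1 * q); rewrite -mulrA (mulrA t) mulrV // mul1r.
(* As p does not divide the denominator, the order of the form along p is the multiplicity j of p in
   the adjoint, which is positive. *)
have [j [m [em hm]]] := pow_factor p0 pu A0.
exists p, j%:Z; split.
- by split=> //; exists k.
- by exists m, B; split=> //; rewrite eOm em tofracM tofracXn mulrA.
- case: j em => // em; case: hm; exists q.
  by move: em; rewrite mul1r => <-.
- by split.
Qed.

End ZeroSet.
End MainTheorem.

Theorem corollary5p7 (R : realType) (d : nat) (P : set 'rV[R]_d)
  (P_polyhedron : polyhedron P) (P_proper : P <> setT)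
  (P_full : full_dimensional P) (P_noline : ~ contains_line P)
  (V : seq 'rV[R]_d) (V_gen : fan_generators P V)
  (T : {set {set 'I_(size (dual_generators P V))}})
  (T_triang : triangulation (dual_cone (cone_over P)) T)
  (Om : ratform R d) :
  (canonical_form (cone_over P) false Om <->
     chart_coef 1%:M Om =
       tofrac (toC (adj T) \mPo chart_point 1%:M) / tofrac (toC (Bpoly P V)))
  /\
  (canonical_form (cone_over P) false Om ->
     zero_set Om = vanishing_set (toC (adj T))).
Proof.
split; first exact: canonical_chart.
exact: zero_set_adj.
Qed.
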